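(* Let $\Bbbk$ be a field. (1) Let $(L,[,]_L,d)$ be a differential graded Lie algebra over $\Bbbk$ and let $\mathbb{S}L$ be its graded symmetric algebra. Then $\mathbb{S}L$ is a differential graded Poisson algebra and $(\mathbb{S}L)^e\cong\mathbf{U}(L\rtimes L)$ as differential graded algebras, where $L\rtimes L$ denotes the graded semidirect product of $L$, which is also a differential graded Lie algebra. (2) Let $A$ be a differential graded Poisson algebra over $\Bbbk$. Then $(A^{\mathcal{E}})^e\cong(A^e)^{\mathcal{E}}$ (as differential graded algebras), where $A^{\mathcal{E}}:=A\otimes A^{op}$.
   Context: Everything is over a field $\Bbbk$; all algebras have an identity and maps of algebras preserve it; gradings are by $\mathbb{Z}$ and $|x|$ is the degree of a homogeneous element $x$. A differential graded (DG) algebra is a graded algebra with a linear map $d$ of degree $1$ with $d^2=0$ and $d(ab)=d(a)b+(-1)^{|a|}a\,d(b)$ for homogeneous $a,b$. DG algebra maps are graded algebra maps of degree $0$ commuting with differentials. A DG Lie algebra $(L,[,],d)$ is a graded vector space with a degree $0$ bracket satisfying $[a,b]=-(-1)^{|a||b|}[b,a]$ and $[a,[b,c]]=[[a,b],c]+(-1)^{|a||b|}[b,[a,c]]$, and a degree $1$ linear map $d$ with $d^2=0$, $d([a,b])=[d(a),b]+(-1)^{|a|}[a,d(b)]$. Its universal enveloping algebra is $\mathbf{U}(L)=T(L)/(x\otimes y-(-1)^{|x||y|}y\otimes x-[x,y])$ ($x,y$ homogeneous) with the differential extending $d$ by the graded Leibniz rule. A DG Poisson algebra $(A,\cdot,\{,\},d)$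 is a DG algebra $(A,\cdot,d)$ that is graded commutative, $ab=(-1)^{|a||b|}ba$, such that $(A,\{,\},d)$ is a DG Lie algebra and $\{a,bc\}=\{a,b\}c+(-1)^{|a||b|}b\{a,c\}$ for homogeneous $a,b,c$. Graded symmetric algebra: $\mathbb{S}L=T(L)/(x\otimes y-(-1)^{|x||y|}y\otimes x)$ ($x,y\in L$ homogeneous), with differential extending $d$ by the graded Leibniz rule and Poisson bracket determined by $\{x,y\}=[x,y]_L$ for $x,y\in L$ and the biderivation property. Graded semidirect product: $L\rtimes L$ is the graded space whose homogeneous elements are the pairs $(x_1,x_2)$ with $x_1,x_2\in L$ homogeneous of the same degree $|x|:=|(x_1,x_2)|$, with bracket $\{(x_1,x_2),(y_1,y_2)\}=([x_2,y_1]_L-(-1)^{|x||y|}[y_2,x_1]_L,\,[x_2,y_2]_L)$ and differential $\partial(x_1,x_2)=(d(x_1),d(x_2))$. Tensor products: for DG algebras, $(a\otimes b)(a'\otimes b')=(-1)^{|a'||b|}aa'\otimes bb'$ and $d(a\otimes b)=d(a)\otimes b+(-1)^{|a|}a\otimes d(b)$; for DG Poisson algebras, moreover $\{a\otimes b,a'\otimes b'\}=(-1)^{|a'||b|}(\{a,a'\}\otimes bb'+aa'\otimes\{b,b'\})$. Opposites: for a DG algebra $R$, $R^{op}$ is the same graded space with $a\cdot_{op}b=(-1)^{|a||b|}ba$ and the same differential; for a DG Poisson algebra $A$, moreover $\{a,b\}_{op}=(-1)^{|a||b|}\{b,a\}=-\{a,b\}$. For a DG (Poisson) algebra $R$, $R^{\mathcal{E}}:=R\otimes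 R^{op}$. For a DG Poisson algebra $A$, the DG algebra $A^e$ is: let $m_A=\{m_a\mid a\in A\}$ and $h_A=\{h_a\mid a\in A\}$ be two copies of the graded vector space $A$ (via linear isomorphisms $a\mapsto m_a$, $a\mapsto h_a$), with $|m_a|=|h_a|=|a|$. $A^e$ is the graded algebra generated by $m_A$ and $h_A$ subject to, for all homogeneous $a,b\in A$: $m_{ab}=m_am_b$; $h_{ab}=m_ah_b+(-1)^{|a||b|}m_bh_a$; $m_{\{a,b\}}=h_am_b-(-1)^{|a||b|}m_bh_a$; $h_{\{a,b\}}=h_ah_b-(-1)^{|a||b|}h_bh_a$; $m_1=1$. Its differential $\partial$ is the degree $1$ map determined by $\partial(m_a)=m_{d(a)}$, $\partial(h_a)=h_{d(a)}$ and $\partial(xy)=\partial(x)y+(-1)^{|x|}x\partial(y)$. *)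

(* Defs.v *)
From HB Require Import structures.
From mathcomp Require Import all_boot all_order all_algebra.
From mathcomp Require Import finmap boolp classical_sets cardinality fsbigop.
From mathcomp Require Import monalg.

Set Implicit Arguments.
Unset Strict Implicit.
Unset Printing Implicit Defensive.

Import GRing.Theory.
Local Open Scope classical_set_scope.
Local Open Scope ring_scope.
Local Open Scope quotient_scope.

(* The records dgSpace, dgAlg, dgLie, dgPois hold bare operations; the laws are
   the predicates is_dgSpace, is_dgAlg, is_dgLie, is_dgPois.  Algebras are not
   algTypes because these satisfy 1 != 0, whereas the zero algebra is allowed
   here, and a quotient by relations may be zero.  An operation on a quotient is
   computed on canonical representatives, so it can be named before it is known
   to be independent of their choice. *)

Section LinearSpans.
Variables (k : fieldType) (V : lmodType k).

Inductive lspan (S : set V) : set V :=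
| lspan0 : lspan S 0
| lspan_cons (c : k) (u v : V) of S u & lspan S v : lspan S (c *: u + v).

Lemma lspan_add S u v : lspan S u -> lspan S v -> lspan S (u + v).
Proof.
elim=> [|c x y Sx _ IH] Sv; first by rewrite add0r.
by rewrite -addrA; apply: lspan_cons (IH Sv).
Qed.

Lemma lspan_scale S c v : lspan S v -> lspan S (c *: v).
Proof.
elim=> [|e x y Sx _ IH]; first by rewrite scaler0; apply: lspan0.
by rewrite scalerDr scalerA; apply: lspan_cons.
Qed.

Definition lspan_pred (S : set V) : {pred V} := fun v => `[< lspan S v >].

Lemma lspan_zmod_closed S : zmod_closed (lspan_pred S).
Proof.
split=> [|u v /asboolP Su /asboolP Sv]; first exact/asboolP/lspan0.
by apply/asboolP; rewrite -scaleN1r; apply: lspan_add Su (lspan_scale _ Sv).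
Qed.

HB.instance Definition _ S :=
  GRing.isZmodClosed.Build V (lspan_pred S) (lspan_zmod_closed S).

(* V / lspan S *)
Definition quospan (S : set V) := Quotient.quot (lspan_pred S : zmodClosed V).
HB.instance Definition _ S := GRing.Zmodule.on (quospan S).

Definition cls (S : set V) (v : V) : quospan S := \pi_(quospan S) v.
Definition rep (S : set V) (x : quospan S) : V := repr x.
Definition qscale (S : set V) (c : k) (x : quospan S) : quospan S :=
  cls S (c *: rep x).

Lemma repK S : cancel (@rep S) (cls S).
Proof. by move=> x; rewrite /cls /rep reprK. Qed.

Lemma cls_eq S u v : lspan S (u - v) -> cls S u = cls S v.
Proof.
by move=> Suv; apply/eqP; rewrite /cls -Quotient.idealrBE; apply/asboolP.
Qed.

Lemma cls_rep S v : lspan S (rep (cls S v) - v).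
Proof.
have /eqP : cls S (rep (cls S v)) = cls S v by rewrite repK.
by rewrite /cls -Quotient.idealrBE => /asboolP.
Qed.

Lemma clsD S u v : cls S (u + v) = cls S u + cls S v.
Proof. by rewrite /cls piE. Qed.

Lemma clsZ S c v : cls S (c *: v) = qscale c (cls S v).
Proof.
apply: cls_eq; rewrite -scalerBr; apply: lspan_scale.
by rewrite -opprB -scaleN1r; apply: lspan_scale; apply: cls_rep.
Qed.

Lemma qscaleA S a b (x : quospan S) : qscale a (qscale b x) = qscale (a * b) x.
Proof. by rewrite -[x]repK -!clsZ scalerA. Qed.

Lemma qscale1 S : left_id 1 (@qscale S).
Proof. by move=> x; rewrite -[x]repK -clsZ scale1r. Qed.

Lemma qscaleDr S : right_distributive (@qscale S) +%R.
Proof.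
by move=> c x y; rewrite -[x]repK -[y]repK -clsD -!clsZ -clsD scalerDr.
Qed.

Lemma qscaleDl S (x : quospan S) : {morph (@qscale S)^~ x : a b / a + b}.
Proof. by move=> a b; rewrite -[x]repK -!clsZ -clsD scalerDl. Qed.

HB.instance Definition _ S := GRing.Zmodule_isLmodule.Build k (quospan S)
  (@qscaleA S) (@qscale1 S) (@qscaleDr S) (@qscaleDl S).

End LinearSpans.

Definition lin_ext (k : fieldType) (K : choiceType) (V : lmodType k)
    (f : K -> V) (g : {malg k[K]}) : V :=
  \sum_(x <- msupp g) g@_x *: f x.

Definition bilin (k : fieldType) (U V W : lmodType k) (f : U -> V -> W) :=
  (forall v, linear (f^~ v)) /\ (forall u, linear (f u)).

Record dgSpace (k : fieldType) := DGSpace {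
  car :> lmodType k;
  gr : int -> set car;   (* gr n = the homogeneous elements of degree n *)
  dif : car -> car }.
Arguments gr {k d}.
Arguments dif {k d}.

Record dgAlg (k : fieldType) := DGAlg {
  alg_space :> dgSpace k;
  amul : alg_space -> alg_space -> alg_space;
  aone : alg_space }.
Arguments amul {k d}.
Arguments aone {k d}.

Record dgLie (k : fieldType) := DGLie {
  lie_space :> dgSpace k;
  br : lie_space -> lie_space -> lie_space }.
Arguments br {k d}.

Record dgPois (k : fieldType) := DGPois {
  pois_alg :> dgAlg k;
  pbr : pois_alg -> pois_alg -> pois_alg }.
Arguments pbr {k d}.

Definition pois_lie (k : fieldType) (A : dgPois k) : dgLie k := DGLie (@pbr k A).

Notation "a ** b" := (amul a b) (at level 40, left associativity) : ring_scope.

Section Structures.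
Variable k : fieldType.

Definition ksgn (i j : int) : k := (-1) ^ (i * j).

(* f gives the homogeneous components of v; unique existence of f for every v
   says that V is the direct sum of the gr n. *)
Definition decomposes (V : dgSpace k) (v : V) (f : int -> V) :=
  [/\ forall n, gr n (f n),
      finite_set [set n | f n <> 0] &
      v = \sum_(n \in [set: int]) f n].

Definition is_dgSpace (V : dgSpace k) :=
  [/\ forall n (c : k) (u v : V), gr n u -> gr n v -> gr n (c *: u + v),
      forall v : V, exists! f, decomposes v f,
      linear (@dif k V),
      forall n (v : V), gr n v -> gr (n + 1) (dif v) &
      forall v : V, dif (dif v) = 0].

Definition is_dgAlg (A : dgAlg k) :=
  [/\ is_dgSpace A,
      bilin (@amul k A),
      associative (@amul k A) /\
        (left_id aone (@amul k A) /\ right_id aone (@amul k A)),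
      gr 0 (aone : A) /\
        (forall i j (a b : A), gr i a -> gr j b -> gr (i + j) (a ** b)) &
      forall i (a b : A), gr i a ->
        dif (a ** b) = dif a ** b + ksgn 1 i *: (a ** dif b)].

Definition is_dgLie (L : dgLie k) :=
  [/\ is_dgSpace L,
      bilin (@br k L) /\
        (forall i j (a b : L), gr i a -> gr j b -> gr (i + j) (br a b)),
      forall i j (a b : L), gr i a -> gr j b ->
        br a b = - (ksgn i j *: br b a),
      forall i j l (a b c : L), gr i a -> gr j b -> gr l c ->
        br a (br b c) = br (br a b) c + ksgn i j *: br b (br a c) &
      forall i (a b : L), gr i a ->
        dif (br a b) = br (dif a) b + ksgn 1 i *: br a (dif b)].

Definition is_dgPois (A : dgPois k) :=
  [/\ is_dgAlg A,
      forall i j (a b : A), gr i a -> gr j b -> a ** b = ksgn i j *: (b ** a),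
      is_dgLie (pois_lie A) &
      forall i j l (a b c : A), gr i a -> gr j b -> gr l c ->
        pbr a (b ** c) = pbr a b ** c + ksgn i j *: (b ** pbr a c)].

Definition dgAlg_iso (A B : dgAlg k) :=
  [/\ is_dgAlg A, is_dgAlg B &
      exists f : A -> B,
        [/\ linear f, bijective f,
            (forall a b, f (a ** b) = f a ** f b) /\ f aone = aone,
            forall n a, gr n a -> gr n (f a) &
            forall a, f (dif a) = dif (f a)]].

End Structures.

Section Signs.
Variable k : fieldType.

(* The degree n component of v. *)
Definition hcomp (V : dgSpace k) (n : int) (v : V) : V :=
  xget 0 [set u | exists2 f, decomposes v f & u = f n].

(* The linear map equal to v |-> (-1)^|v| v on homogeneous elements. *)
Definition sgv (V : dgSpace k) (v : V) : V :=
  \sum_(n \in [set: int]) ksgn k 1 n *: hcomp n v.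

(* For bilinear f, the bilinear map equal to (v, w) |-> (-1)^(|v||w|) f v w on
   homogeneous elements. *)
Definition koszul (V W : dgSpace k) (Z : lmodType k) (f : V -> W -> Z) v w : Z :=
  \sum_(i \in [set: int]) \sum_(j \in [set: int])
    ksgn k i j *: f (hcomp i v) (hcomp j w).

End Signs.

Section Presented.
Variables (k : fieldType) (V : dgSpace k).

(* Noncommutative polynomials whose variables are the vectors of V: the tensor
   algebra T(V) is its quotient by the linearity relations between variables. *)
Definition freealg := {malg k[{fmonom V}]}.

Definition var (x : V) : freealg := << fmu x >>.

(* rel l r stands for the relation l = r. *)
Inductive tensor_rel (rel : freealg -> freealg -> Prop) :
    freealg -> freealg -> Prop :=
| tensor_lin (c : k) (x y : V) :
    tensor_rel rel (var (c *: x + y)) (c *: var x + var y)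
| tensor_extra l r of rel l r : tensor_rel rel l r.

Definition ideal_gen (rel : freealg -> freealg -> Prop) : set freealg :=
  [set u | exists a b l r, tensor_rel rel l r /\ u = a * (l - r) * b].

(* The graded derivation extending dif, on words. *)
Fixpoint word_dif (s : seq V) : freealg :=
  if s is x :: s' then
    var (dif x) * \prod_(y <- s') var y + var (sgv x) * word_dif s'
  else 0.

Inductive hword : int -> seq V -> Prop :=
| hword_nil : hword 0 [::]
| hword_cons i n x s of gr i x & hword n s : hword (i + n) (x :: s).

Variable rel : freealg -> freealg -> Prop.

Definition pres_car : lmodType k := quospan (ideal_gen rel).
Definition gen (x : V) : pres_car := cls _ (var x).

(* T(V) / (rel), with the differential induced by that of V. *)
Definition presented : dgAlg k :=
  @DGAlg k
    (@DGSpace k pres_car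
       (fun n => lspan [set cls _ (\prod_(x <- s) var x) | s in hword n])
       (fun p => cls _ (lin_ext (fun w : {fmonom V} => word_dif w) (rep p))))
    (fun p q => cls _ (rep p * rep q))
    (cls _ 1).

End Presented.

Section SymmetricAndEnveloping.
Variables (k : fieldType) (L : dgLie k).

Inductive sym_rel : freealg L -> freealg L -> Prop :=
| sym_comm i j (x y : L) of gr i x & gr j y :
    sym_rel (var x * var y) (ksgn k i j *: (var y * var x)).

Definition Sym : dgAlg k := presented sym_rel.
Definition sym_gen (x : L) : Sym := gen sym_rel x.

(* Bilinear, extends the bracket of L, derivation in each argument. *)
Definition is_sym_bracket (b : Sym -> Sym -> Sym) :=
  [/\ bilin b,
      forall x y : L, b (sym_gen x) (sym_gen y) = sym_gen (br x y),
      forall i j l (p q r : Sym), gr i p -> gr j q -> gr l r ->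
        b p (q ** r) = b p q ** r + ksgn k i j *: (q ** b p r) &
      forall i j l (p q r : Sym), gr i p -> gr j q -> gr l r ->
        b (p ** q) r = p ** b q r + ksgn k j l *: (b p r ** q)].

Inductive uea_rel : freealg L -> freealg L -> Prop :=
| uea_comm i j (x y : L) of gr i x & gr j y :
    uea_rel (var x * var y - ksgn k i j *: (var y * var x)) (var (br x y)).

Definition Uea : dgAlg k := presented uea_rel.

End SymmetricAndEnveloping.

(* Also used as the space of generators of Env: (a, 0) is m_a, (0, a) is h_a. *)
Definition dsum (k : fieldType) (V W : dgSpace k) : dgSpace k :=
  @DGSpace k (V * W)%type
    (fun n p => gr n p.1 /\ gr n p.2)
    (fun p => (dif p.1, dif p.2)).

Definition semidirect (k : fieldType) (L : dgLie k) : dgLie k :=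
  @DGLie k (dsum L L)
    (fun x y => (br x.2 y.1 - koszul (fun a b => br b a) x.1 y.2, br x.2 y.2)).

Section PoissonEnveloping.
Variables (k : fieldType) (A : dgPois k).

Definition mv (a : A) : freealg (dsum A A) := var ((a, 0) : dsum A A).
Definition hv (a : A) : freealg (dsum A A) := var ((0, a) : dsum A A).

Inductive env_rel : freealg (dsum A A) -> freealg (dsum A A) -> Prop :=
| env_m_mul i j (a b : A) of gr i a & gr j b :
    env_rel (mv (a ** b)) (mv a * mv b)
| env_h_mul i j (a b : A) of gr i a & gr j b :
    env_rel (hv (a ** b)) (mv a * hv b + ksgn k i j *: (mv b * hv a))
| env_m_br i j (a b : A) of gr i a & gr j b :
    env_rel (mv (pbr a b)) (hv a * mv b - ksgn k i j *: (mv b * hv a))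
| env_h_br i j (a b : A) of gr i a & gr j b :
    env_rel (hv (pbr a b)) (hv a * hv b - ksgn k i j *: (hv b * hv a))
| env_m_one : env_rel (mv aone) 1.

Definition Env : dgAlg k := presented env_rel.

End PoissonEnveloping.

Section Opposite.
Variable k : fieldType.

Definition op (A : dgAlg k) : dgAlg k :=
  @DGAlg k A (koszul (fun a b : A => b ** a)) aone.

Definition pop (A : dgPois k) : dgPois k :=
  @DGPois k (op A) (koszul (fun a b : A => pbr b a)).

End Opposite.

Section Tensor.
Variable k : fieldType.

Section Space.
Variables (V W : lmodType k).

Definition pure0 (v : V) (w : W) : {malg k[(V * W)%type]} := << (v, w) >>.

Inductive bilin_gen : set {malg k[(V * W)%type]} :=
| bilin_l c v v' w :
    bilin_gen (pure0 (c *: v + v') w - (c *: pure0 v w + pure0 v' w))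
| bilin_r c v w w' :
    bilin_gen (pure0 v (c *: w + w') - (c *: pure0 v w + pure0 v w')).

Definition tens : lmodType k := quospan bilin_gen.
Definition pure (v : V) (w : W) : tens := cls _ (pure0 v w).

Definition tens_ext (Z : lmodType k) (f : V -> W -> Z) (t : tens) : Z :=
  lin_ext (fun p : V * W => f p.1 p.2) (rep t).

End Space.

Definition tens_space (V W : dgSpace k) : dgSpace k :=
  @DGSpace k (tens V W)
    (fun n => lspan [set t | exists i j v w,
                      [/\ gr i v, gr j w, i + j = n & t = pure v w]])
    (tens_ext (fun v w => pure (dif v) w + pure (sgv v) (dif w))).

Definition tens_alg (A B : dgAlg k) : dgAlg k :=
  @DGAlg k (tens_space A B)
    (fun s t =>
       tens_ext (fun a b => tens_ext (fun a' b' =>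
         koszul (fun (x' : A) (y : B) => pure (a ** x') (y ** b')) a' b) t) s)
    (pure aone aone).

Definition tens_pois (A B : dgPois k) : dgPois k :=
  @DGPois k (tens_alg A B)
    (fun s t =>
       tens_ext (fun a b => tens_ext (fun a' b' =>
         koszul (fun (x' : A) (y : B) =>
           pure (pbr a x') (y ** b') + pure (a ** x') (pbr y b')) a' b) t) s).

End Tensor.

(* The enveloping algebra R (x) R^op, for DG algebras and DG Poisson algebras. *)
Definition envE (k : fieldType) (R : dgAlg k) : dgAlg k := tens_alg R (op R).
Definition penvE (k : fieldType) (A : dgPois k) : dgPois k :=
  tens_pois A (pop A).

(* Main.v *)
Require Import Defs.
From mathcomp Require Import all_boot all_order all_algebra.
From mathcomp Require Import finmap boolp classical_sets functions cardinality.
From mathcomp Require Import fsbigop monalg ring.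

Set Implicit Arguments.
Unset Strict Implicit.
Unset Printing Implicit Defensive.

Import GRing.Theory.
Local Open Scope classical_set_scope.
Local Open Scope ring_scope.

(** A presented algebra acts on a module M as soon as its generators act by
operators that satisfy the relations.  The action on functions from the integers
to the algebra gives the homogeneous components, the action by upper triangular
2x2 matrices gives the differential and the derivations, and the action on an
algebra gives algebra maps.

(1) A derivation D of S L into a left module, D(pq) = p D(q) + (-1)^(|p||q|) q D(p),
is an arbitrary linear map on L.  Extending the bracket of L first in one argument
and then in the other gives the Poisson bracket of S L; its axioms are statements
about derivations, hence need only be checked on L.  The map from (S L)^e to
U(L x| L) sends m_p to the algebra map extending x |-> (x, 0) and h_p to the
derivation along it extending x |-> (0, x); the inverse sends (x, y) to m_x + h_y.

(2) The relations of A^e hold for m_a (x) m_b and h_a (x) m_b + m_a (x) h_b in a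
tensor product, and the relations of (A^op)^e hold for m_a and h_a in (A^e)^op.
This gives the map from (A (x) A^op)^e to A^e (x) (A^e)^op.  Its inverse comes from
a |-> a (x) 1 and b |-> 1 (x) b, since {a (x) 1, 1 (x) b} = 0 makes the two images
commute. *)

(** * Linear maps, gradings and signs *)

Arguments gr : simpl never.
Arguments dif : simpl never.
Arguments amul : simpl never.
Arguments aone : simpl never.
Arguments br : simpl never.
Arguments pbr : simpl never.
Arguments presented : simpl never.
Arguments dsum : simpl never.
Arguments semidirect : simpl never.
Arguments Sym : simpl never.
Arguments Uea : simpl never.
Arguments Env : simpl never.
Arguments op : simpl never.
Arguments pop : simpl never.
Arguments tens_space : simpl never.
Arguments tens_alg : simpl never.
Arguments tens_pois : simpl never.
Arguments envE : simpl never.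
Arguments penvE : simpl never.

(** A quotient by relations comes without a basis. That its grading is a direct sum, or that its
    differential is independent of representatives, cannot be read off and has to be extracted from
    a module on which the relations visibly hold. No theorem of Poincare-Birkhoff-Witt type enters:
    both composites of each isomorphism are compared with the identity on generators. Koszul signs
    make sense for homogeneous elements only. Whatever carries a sign is therefore extended linearly
    from homogeneous components, and identities are checked on homogeneous arguments. U(L x| L)
    appears in (1) because its commutators are the relations of (S L)^e on generators: [(x,0),(y,0)]
    = 0 makes the m's commute, [(0,x),(y,0)] = ([x,y],0) is the relation for m_{x,y}, and
    [(0,x),(0,y)] = (0,[x,y]) is the one for h_{x,y}. The relation for h of a product says that h is
    a derivation along m, so h is fixed by its values on L. In (2) the opposite is harmless for the
    product of A, which is graded commutative, and only negates the bracket; reversing the products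
    of A^e negates commutators as well. *)

Section LinearMaps.
Variables (k : fieldType) (V W : lmodType k) (f : V -> W).
Hypothesis f_lin : linear f.

Lemma lin0 : f 0 = 0.
Proof. by have := f_lin (-1) 0 0; rewrite scaler0 addr0 scaleN1r addNr. Qed.

Lemma linD u v : f (u + v) = f u + f v.
Proof. by have := f_lin 1 u v; rewrite !scale1r. Qed.

Lemma linZ c v : f (c *: v) = c *: f v.
Proof. by have := f_lin c v 0; rewrite lin0 !addr0. Qed.

Lemma linN v : f (- v) = - f v.
Proof. by rewrite -!scaleN1r linZ. Qed.

Lemma linB u v : f (u - v) = f u - f v.
Proof. by rewrite linD linN. Qed.

Lemma lin_sum (I : Type) (r : seq I) (F : I -> V) :
  f (\sum_(i <- r) F i) = \sum_(i <- r) f (F i).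
Proof.
by elim: r => [|i r IH]; rewrite ?big_nil ?big_cons ?lin0// linD IH.
Qed.

Lemma lspan_lin0 S v : (forall u, S u -> f u = 0) -> lspan S v -> f v = 0.
Proof. by move=> Sf; elim=> [|c u w Su _ IH]; rewrite ?lin0// f_lin Sf// IH scaler0 addr0. Qed.

(** Operations on a quotient are computed on canonical representatives; this removes the
    representative once f kills the relations. *)
Lemma rep_cls S v : (forall u, S u -> f u = 0) -> f (rep (cls S v)) = f v.
Proof.
by move=> Sf; apply/eqP; rewrite -subr_eq0 -linB; apply/eqP;
  apply: lspan_lin0 Sf _; apply: cls_rep.
Qed.

End LinearMaps.

Section LinearSpan.
Variables (k : fieldType) (V : lmodType k).

Lemma lspan_sub (S T : set V) v :
  (forall u, S u -> lspan T u) -> lspan S v -> lspan T v.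
Proof.
move=> ST; elim=> [|c x y Sx _ IH]; first exact: lspan0.
by apply: lspan_add => //; apply/lspan_scale/ST.
Qed.

Lemma lspan_gen (S : set V) v : S v -> lspan S v.
Proof. by move=> Sv; rewrite -[v]addr0 -[v]scale1r; apply: lspan_cons => //; apply: lspan0. Qed.

Lemma cls_ker (S : set V) u v : cls S u = cls S v -> lspan S (u - v).
Proof.
move=> E; have := cls_rep S u; rewrite E => H.
have -> : u - v = (rep (cls S v) - v) - (rep (cls S v) - u) by rewrite opprB [RHS]addrC subrKA.
apply: lspan_add; first exact: cls_rep.
by rewrite -scaleN1r; apply: lspan_scale.
Qed.

Lemma lspan_lin (S : set V) c u v : lspan S u -> lspan S v -> lspan S (c *: u + v).
Proof. by move=> Su Sv; apply: lspan_add => //; apply: lspan_scale. Qed.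

End LinearSpan.

Section LinearComb.
Variables (k : fieldType) (U V W : lmodType k).

Lemma lin_id : linear (fun v : V => v). Proof. by []. Qed.

Lemma lin_cst0 : linear (fun _ : V => 0 : W).
Proof. by move=> c u v; rewrite scaler0 addr0. Qed.

Lemma lin_comp (f : V -> W) (g : U -> V) :
  linear f -> linear g -> linear (fun u => f (g u)).
Proof. by move=> fl gl c u v; rewrite gl fl. Qed.

Lemma lin_add (f g : V -> W) :
  linear f -> linear g -> linear (fun v => f v + g v).
Proof. by move=> fl gl c u v; rewrite fl gl scalerDr addrACA. Qed.

Lemma lin_scale (c : k) (f : V -> W) : linear f -> linear (fun v => c *: f v).
Proof. by move=> fl a u v; rewrite fl scalerDr !scalerA mulrC. Qed.

Lemma lin_opp (f : V -> W) : linear f -> linear (fun v => - f v).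
Proof. by move=> fl a u v; rewrite fl opprD scalerN. Qed.

Lemma lin_sub (f g : V -> W) :
  linear f -> linear g -> linear (fun v => f v - g v).
Proof. by move=> fl gl; apply: lin_add => //; apply: lin_opp. Qed.

Lemma lspan_img (f : V -> W) S T v : linear f ->
  (forall u, S u -> lspan T (f u)) -> lspan S v -> lspan T (f v).
Proof.
move=> fl Sf; elim=> [|c x y Sx _ IH]; first by rewrite lin0//; apply: lspan0.
by rewrite fl; apply: lspan_lin => //; apply: Sf.
Qed.

Lemma lspan_eq (f g : V -> W) S v : linear f -> linear g ->
  (forall u, S u -> f u = g u) -> lspan S v -> f v = g v.
Proof.
move=> fl gl Sf; elim=> [|c x y Sx _ IH]; first by rewrite !lin0.
by rewrite fl gl Sf// IH.
Qed.

Lemma cls_lin (S : set V) : linear (cls S).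
Proof. by move=> c u v; rewrite clsD clsZ. Qed.

Lemma cls_ind (S : set V) (P : quospan S -> Prop) :
  (forall v, P (cls S v)) -> forall x, P x.
Proof. by move=> H x; rewrite -[x]repK. Qed.

End LinearComb.

Section LinExt.
Variables (k : fieldType) (K : choiceType) (V : lmodType k) (f : K -> V).

Lemma lin_extEw (d : {fset K}) (g : {malg k[K]}) :
  (msupp g `<=` d)%fset -> lin_ext f g = \sum_(x <- d) g@_x *: f x.
Proof.
move=> le; rewrite /lin_ext; apply: big_fset_incl => // x _ /mcoeff_outdom ->.
by rewrite scale0r.
Qed.

Lemma lin_ext_lin : linear (lin_ext f).
Proof.
move=> c u v.
pose d := (msupp u `|` msupp v)%fset.
rewrite (@lin_extEw d u) ?fsubsetUl// (@lin_extEw d v) ?fsubsetUr//.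
rewrite (@lin_extEw d).
  rewrite scaler_sumr -big_split/=; apply: eq_bigr => x _.
  by rewrite mcoeffD mcoeffZ scalerDl scalerA.
apply: fsubset_trans (msuppD_le _ _) _.
by apply: fsetUSS => //; apply: msuppZ_le.
Qed.

Lemma lin_extU x : lin_ext f << x >> = f x.
Proof. by rewrite /lin_ext msuppU oner_eq0 big_seq_fset1 mcoeffUU scale1r. Qed.

End LinExt.

Section MalgInd.
Variables (k : fieldType) (K : choiceType).

Lemma malg_span (g : {malg k[K]}) : lspan [set << x >> | x in [set: K]] g.
Proof.
rewrite (monalgE g); elim: (msupp g : seq K) => [|x s IH].
  by rewrite big_nil; apply: lspan0.
rewrite big_cons; suff -> : << g@_x *g x >> = g@_x *: << x >> :> {malg k[K]}.
  by apply: lspan_cons IH; exists x.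
by apply/malgP => y; rewrite mcoeffZ !mcoeffU mulrnAr mulr1.
Qed.

Lemma malg_lin_eq (V : lmodType k) (f g : {malg k[K]} -> V) :
  linear f -> linear g -> (forall x, f << x >> = g << x >>) -> f =1 g.
Proof.
by move=> fl gl fg u; apply: lspan_eq (malg_span u) => // _ [x _ <-].
Qed.

End MalgInd.

(** * Homogeneous components and linear extension from homogeneous elements *)

Section Homogeneous.
Variables (k : fieldType) (V : dgSpace k) (HV : is_dgSpace V).

Lemma gr_lin n c (u v : V) : gr n u -> gr n v -> gr n (c *: u + v).
Proof. by case: HV => H *; apply: H. Qed.

Lemma dif_lin : linear (@dif k V). Proof. by case: HV. Qed.

Lemma gr_dif n (v : V) : gr n v -> gr (n + 1) (dif v).
Proof. by case: HV => *; auto. Qed.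

Lemma dif_dif (v : V) : dif (dif v) = 0. Proof. by case: HV. Qed.

Lemma decompP (v : V) : exists f, decomposes v f.
Proof. by case: HV => _ /(_ v)[f [? _]] *; exists f. Qed.

Lemma decomp_uniq (v : V) f g : decomposes v f -> decomposes v g -> f = g.
Proof. by case: HV => _ /(_ v)[h [_ U]] _ _ _ /U <- /U <-. Qed.

(** The laws give closure under linear combinations only, so some element of degree n is needed
    first; a decomposition of 0 provides one. *)
Lemma gr0 n : gr n (0 : V).
Proof.
have [f [fg _ _]] := decompP 0.
by have := gr_lin (-1) (fg n) (fg n); rewrite scaleN1r addNr.
Qed.

Lemma grZ n c (v : V) : gr n v -> gr n (c *: v).
Proof. by move=> ?; rewrite -[_ *: _]addr0; apply: gr_lin => //; apply: gr0. Qed.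

Lemma grD n (u v : V) : gr n u -> gr n v -> gr n (u + v).
Proof. by move=> gu gv; rewrite -[u]scale1r; apply: gr_lin. Qed.

Lemma grN n (u : V) : gr n u -> gr n (- u).
Proof. by move=> gu; rewrite -scaleN1r; apply: grZ. Qed.

Lemma hcompE (v : V) f n : decomposes v f -> hcomp n v = f n.
Proof.
move=> fv; rewrite /hcomp.
case: xgetP => [u -> [g gv ->]|/(_ (f n))[]]; last by exists f.
by rewrite (decomp_uniq gv fv).
Qed.

Lemma hcompP (v : V) : decomposes v (fun n => hcomp n v).
Proof.
have [f fv] := decompP v.
by rewrite (_ : (fun n => _) = f)//; apply/funext => n; apply: hcompE.
Qed.

Lemma hcomp_gr n (v : V) : gr n (hcomp n v).
Proof. by have [+ _ _] := hcompP v. Qed.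

Lemma hcomp_supp (v : V) :
  exists A : {fset int}, forall n, n \notin A -> hcomp n v = 0.
Proof.
have [_ fin _] := hcompP v.
exists (fset_set [set n | hcomp n v <> 0]) => n.
by rewrite in_fset_set// => nA; apply: contrapT => n0; rewrite mem_set in nA.
Qed.

Lemma hcomp_sum (v : V) (A : {fset int}) :
  (forall n, n \notin A -> hcomp n v = 0) -> v = \sum_(n <- A) hcomp n v.
Proof.
by move=> HA; have [_ _ {1}->] := hcompP v; apply: fsbigTE.
Qed.

Lemma decomp_fset (A : {fset int}) (v : V) f : (forall n, gr n (f n)) ->
  (forall n, n \notin A -> f n = 0) -> v = \sum_(n <- A) f n -> decomposes v f.
Proof.
move=> fg f0 ->; split=> //; last by rewrite (fsbigTE A).
apply: sub_finite_set (finite_fset A) => n /= fn.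
by apply/negPn/negP => /f0.
Qed.

Lemma hcomp_lin n : linear (@hcomp k V n).
Proof.
move=> c u v.
have [A HA] := hcomp_supp u; have [B HB] := hcomp_supp v.
pose C := (A `|` B)%fset.
have HA' m : m \notin C -> hcomp m u = 0.
  by rewrite inE negb_or => /andP[/HA].
have HB' m : m \notin C -> hcomp m v = 0.
  by rewrite inE negb_or => /andP[_ /HB].
apply: (@hcompE _ (fun n => c *: hcomp n u + hcomp n v)).
apply: (@decomp_fset C) => [m|m mC|].
- by apply: gr_lin; apply: hcomp_gr.
- by rewrite HA'// HB'// scaler0 addr0.
- rewrite big_split/= -scaler_sumr.
  by rewrite -(hcomp_sum HA') -(hcomp_sum HB').
Qed.

Lemma hcomp_hom n m (v : V) : gr n v -> hcomp m v = if m == n then v else 0.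
Proof.
move=> gv; apply: (@hcompE _ (fun m => if m == n then v else 0)).
apply: (@decomp_fset [fset n]%fset) => [i|i|].
- by case: eqP => [->|_] //; apply: gr0.
- by rewrite inE => /negPf ->.
- by rewrite big_seq_fset1 eqxx.
Qed.

Lemma hcomp_same n (v : V) : gr n v -> hcomp n v = v.
Proof. by move=> gv; rewrite (hcomp_hom _ gv) eqxx. Qed.

Lemma gr_span (v : V) : lspan [set u | exists n, gr n u] v.
Proof.
have [A HA] := hcomp_supp v; rewrite (hcomp_sum HA).
elim: (A : seq int) => [|i s IH]; first by rewrite big_nil; apply: lspan0.
rewrite big_cons -[hcomp i v]scale1r; apply: lspan_cons IH.
by exists i; apply: hcomp_gr.
Qed.

Lemma gr_lin_eq (W : lmodType k) (f g : V -> W) : linear f -> linear g ->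
  (forall n v, gr n v -> f v = g v) -> f =1 g.
Proof.
by move=> fl gl fg u; apply: lspan_eq (gr_span u) => // v [n /fg].
Qed.

Variable W : lmodType k.
Implicit Type F : int -> V -> W.

(* The linear map that equals F n on the homogeneous elements of degree n. *)
Definition hext F (v : V) : W := \sum_(n \in [set: int]) F n (hcomp n v).

(** The condition F n 0 = 0 confines the summands to the degrees in which v has a component, so that
    the sum is finite. *)
Lemma hext_fset F (A : {fset int}) v : (forall n, F n 0 = 0) ->
  (forall n, n \notin A -> hcomp n v = 0) ->
  hext F v = \sum_(n <- A) F n (hcomp n v).
Proof. by move=> F0 HA; apply: fsbigTE => n /HA ->. Qed.

Lemma hext_lin F : (forall n, linear (F n)) -> linear (hext F).
Proof.
move=> Fl c u v.
have F0 n : F n 0 = 0 by apply/lin0/Fl.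
have [A HA] := hcomp_supp u; have [B HB] := hcomp_supp v.
pose C := (A `|` B)%fset.
have HA' m : m \notin C -> hcomp m u = 0.
  by rewrite inE negb_or => /andP[/HA].
have HB' m : m \notin C -> hcomp m v = 0.
  by rewrite inE negb_or => /andP[_ /HB].
rewrite (hext_fset F0 HA') (hext_fset F0 HB') (@hext_fset F C)//.
  rewrite scaler_sumr -big_split/=; apply: eq_bigr => n _.
  by rewrite hcomp_lin Fl.
by move=> n nC; rewrite hcomp_lin HA'// HB'// scaler0 addr0.
Qed.

Lemma hextE F n v : (forall n, F n 0 = 0) -> gr n v -> hext F v = F n v.
Proof.
move=> F0 gv; rewrite (@hext_fset F [fset n]%fset)//.
  by rewrite big_seq_fset1 hcomp_same.
by move=> m; rewrite inE (hcomp_hom _ gv) => /negPf ->.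
Qed.

(** Linearity in the family F: it yields linearity in any further argument on which F depends. *)
Lemma hext_linF c F G H v : (forall n, F n 0 = 0) -> (forall n, G n 0 = 0) ->
  (forall n u, H n u = c *: F n u + G n u) ->
  hext H v = c *: hext F v + hext G v.
Proof.
move=> F0 G0 E; have [A HA] := hcomp_supp v.
rewrite (hext_fset F0 HA) (hext_fset G0 HA) (hext_fset _ HA).
  by rewrite scaler_sumr -big_split/=; apply: eq_bigr => n _; rewrite E.
by move=> n; rewrite E F0 G0 scaler0 addr0.
Qed.

End Homogeneous.

Section Sign.
Variable k : fieldType.

Definition oddz (i : int) : bool := odd `|i|%N.

Lemma oddzD i j : oddz (i + j) = oddz i (+) oddz j.
Proof.
have D m n : odd `|m%:Z - n%:Z|%N = odd m (+) odd n.
  have [le|/ltnW le] := leqP n m; first by rewrite distnEl// oddB.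
  by rewrite distnEr// oddB// addbC.
rewrite /oddz; case: i j => [m|m] [n|n]; rewrite ?NegzE ?abszN ?D//.
- by rewrite -PoszD !absz_nat oddD.
- by rewrite addrC D addbC.
- by rewrite -opprD abszN -PoszD absz_nat oddD.
Qed.

Lemma oddzN i : oddz (- i) = oddz i. Proof. by rewrite /oddz abszN. Qed.
Lemma oddz0 : oddz 0 = false. Proof. by []. Qed.
Lemma oddz1 : oddz 1 = true. Proof. by []. Qed.

(** Only the parities matter, so an identity between Koszul signs becomes a finite case analysis on
    Booleans. *)
Lemma ksgnE i j : ksgn k i j = (-1) ^+ (oddz i && oddz j).
Proof.
rewrite /ksgn /oddz -oddM -abszM signr_odd.
case: (i * j) => n //.
by rewrite -[LHS]/(((-1) ^+ n.+1)^-1) -exprVn invrN1 NegzE abszN.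
Qed.

End Sign.

(** * Linear identities by reflection *)

Section LinearNormalForm.
Variables (k : fieldType) (V : lmodType k).

(** Syntax for linear combinations of atoms. Two terms with equal coefficients at every atom have
    equal values, which reduces an equation in a module to equations in k. *)
Inductive lterm :=
| LAtom of nat | LZero | LAdd of lterm & lterm | LOpp of lterm
| LScale of k & lterm.

Fixpoint leval (env : seq V) (e : lterm) : V :=
  match e with
  | LAtom n => nth 0 env n
  | LZero => 0
  | LAdd a b => leval env a + leval env b
  | LOpp a => - leval env a
  | LScale c a => c *: leval env a
  end.

Fixpoint lcoef (e : lterm) (n : nat) : k :=
  match e with
  | LAtom m => if eqn m n then 1 else 0
  | LZero => 0
  | LAdd a b => lcoef a n + lcoef b n
  | LOpp a => - lcoef a n
  | LScale c a => c * lcoef a n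
  end.

(** Unfolds by computation to one scalar equation for each atom. *)
Fixpoint lcheck (n : nat) (a b : lterm) : Prop :=
  if n is m.+1 then lcoef a m = lcoef b m /\ lcheck m a b else True.

Lemma lcoefP env e : leval env e = \sum_(i < size env) lcoef e i *: nth 0 env i.
Proof.
elim: e => [n||a Ea b Eb|a Ea|c a Ea] /=; rewrite ?Ea ?Eb.
- have [nlt|nge] := ltnP n (size env); last first.
    rewrite nth_default// big1// => i _; rewrite -[eqn n i]/(n == i).
    case: eqP => [E|_]; last by rewrite scale0r.
    by move: nge; rewrite E leqNgt ltn_ord.
  rewrite (bigD1 (Ordinal nlt))//= -[eqn n n]/(n == n) eqxx scale1r big1 ?addr0// => i.
  rewrite -[eqn n i]/(n == i) -val_eqE/= eq_sym => /negPf ->.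
  by rewrite scale0r.
- by rewrite big1// => i _; rewrite scale0r.
- by rewrite -big_split; apply: eq_bigr => i _; rewrite scalerDl.
- by rewrite -sumrN; apply: eq_bigr => i _; rewrite scaleNr.
- by rewrite scaler_sumr; apply: eq_bigr => i _; rewrite scalerA.
Qed.

Lemma lcheckP env a b : lcheck (size env) a b -> leval env a = leval env b.
Proof.
rewrite !lcoefP => H; apply: eq_bigr => i _; congr (_ *: _).
elim: (size env) H {i}(val i) (ltn_ord i) => //= n IH [E /IH H] j.
by rewrite ltnS leq_eqVlt => /predU1P[->|/H].
Qed.

End LinearNormalForm.

Ltac lm_find x env :=
  lazymatch env with
  | cons ?y ?env' =>
      match tt with
      | _ => let _ := match tt with _ => constr_eq x y end in constr:(O)
      | _ => let n := lm_find x env' in constr:(S n)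
      end
  end.

Ltac lm_add x env :=
  match tt with
  | _ => let _ := lm_find x env in env
  | _ => constr:(cons x env)
  end.

Ltac lm_env e env :=
  lazymatch e with
  | (?a + ?b)%R => let env1 := lm_env b env in lm_env a env1
  | (- ?a)%R => lm_env a env
  | (_ *: ?a)%R => lm_env a env
  | 0%R => env
  | _ => lm_add e env
  end.

Ltac lm_reify k e env :=
  lazymatch e with
  | (?a + ?b)%R =>
      let x := lm_reify k a env in let y := lm_reify k b env in
      constr:(@LAdd k x y)
  | (- ?a)%R => let x := lm_reify k a env in constr:(@LOpp k x)
  | (?c *: ?a)%R => let x := lm_reify k a env in constr:(@LScale k c x)
  | 0%R => constr:(@LZero k)
  | _ => let n := lm_find e env in constr:(@LAtom k n)
  end.

Ltac sgn_cases :=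
  rewrite ?ksgnE ?oddzD ?oddzN ?oddz0 ?oddz1 /=;
  repeat match goal with |- context [oddz ?x] => case: (oddz x) => /= end;
  rewrite ?expr0 ?expr1.

(* Decides an equation between linear combinations over [k] of atomic vectors,
   up to case analysis on the parities of the degrees in the Koszul signs. *)
Ltac lmod_with k V :=
  lazymatch goal with
  | |- ?a = ?b =>
      let env0 := constr:(@nil V) in
      let env1 := lm_env b env0 in
      let env := lm_env a env1 in
      let x := lm_reify k a env in
      let y := lm_reify k b env in
      refine (@lcheckP k V env x y _);
      cbn [lcheck lcoef eqn size];
      repeat split; sgn_cases; ring
  end.

Tactic Notation "lmod" constr(k) constr(V) := lmod_with k V.

(** * Bilinear maps with Koszul signs *)

Section Bilinear.
Variables (k : fieldType) (V W : dgSpace k).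
Hypotheses (HV : is_dgSpace V) (HW : is_dgSpace W).
Variable Z : lmodType k.
Implicit Types f g h : V -> W -> Z.

Lemma bilin0l f w : bilin f -> f 0 w = 0.
Proof. by case=> /(_ w) /lin0. Qed.

Lemma bilin0r f v : bilin f -> f v 0 = 0.
Proof. by case=> _ /(_ v) /lin0. Qed.

Lemma bilin_gr_eq f g : bilin f -> bilin g ->
  (forall i j v w, gr i v -> gr j w -> f v w = g v w) -> f =2 g.
Proof.
move=> [fl fr] [gl g'r] fg v w.
apply: (gr_lin_eq HV (fl w) (gl w)) => i {}v vi.
by apply: (gr_lin_eq HW (fr v) (g'r v)) => j {}w wj; apply: fg vi wj.
Qed.

Lemma koszul_hext f v w :
  koszul f v w =
  hext (fun i v' => hext (fun j w' => ksgn k i j *: f v' w') w) v.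
Proof. by []. Qed.

Let inner f w (i : int) (v : V) : Z :=
  hext (fun j w' => ksgn k i j *: f v w') w.

Let inner0 f : bilin f -> forall v (i j : int), ksgn k i j *: f v 0 = 0.
Proof. by move=> fb v i j; rewrite bilin0r// scaler0. Qed.

Let outer0 f : bilin f -> forall w (i : int),
  hext (fun j w' => ksgn k i j *: f 0 w') w = 0 :> Z.
Proof.
by move=> fb w i; rewrite /hext fsbig1// => j _; rewrite bilin0l// scaler0.
Qed.

Lemma koszul_bilin f : bilin f -> bilin (koszul f).
Proof.
move=> fb; have [fl fr] := fb; split=> [w|v].
  apply: (@hext_lin _ _ HV _ (inner f w)) => i c u v.
  apply: (hext_linF HW) => [j|j|j w']; rewrite ?inner0//.
  by rewrite fl scalerDr !scalerA mulrC.
move=> c w w'.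
apply: (@hext_linF _ _ HV _ c (inner f w) (inner f w')
  (inner f (c *: w + w'))) => [i|i|i v'].
- exact: outer0.
- exact: outer0.
- apply: (@hext_lin _ _ HW _ (fun j w' => ksgn k i j *: f v' w')) => j.
  exact/lin_scale/fr.
Qed.

Lemma koszulE f i j v w : bilin f -> gr i v -> gr j w ->
  koszul f v w = ksgn k i j *: f v w.
Proof.
move=> fb vi wj.
have E1 : koszul f v w = hext (fun j w' => ksgn k i j *: f v w') w.
  by rewrite koszul_hext (hextE HV _ vi)// => n; apply: outer0.
by rewrite E1 (hextE HW _ wj)// => n; apply: inner0.
Qed.

(** Linearity in the map itself. In a product of tensors [koszul] is applied to a map that has the
    outer factors as parameters; this gives linearity in those. *)
Lemma koszul_linf c f g h v w : bilin f -> bilin g ->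
  (forall v w, h v w = c *: f v w + g v w) ->
  koszul h v w = c *: koszul f v w + koszul g v w.
Proof.
move=> fb gb E.
apply: (@hext_linF _ _ HV _ c (inner f w) (inner g w) (inner h w)) => [i|i|i v'].
- exact: outer0.
- exact: outer0.
apply: (hext_linF HW) => [j|j|j w'].
- exact: inner0.
- exact: inner0.
- by rewrite E scalerDr !scalerA mulrC.
Qed.

End Bilinear.

Section SgV.
Variables (k : fieldType) (V : dgSpace k) (HV : is_dgSpace V).

Lemma sgvE i (v : V) : gr i v -> sgv v = ksgn k 1 i *: v.
Proof. move=> vi; apply: (@hextE _ _ HV _ (fun i v => ksgn k 1 i *: v) _ _ _ vi) => n.
exact: scaler0. Qed.

Lemma sgv_lin : linear (@sgv k V).
Proof. apply: (@hext_lin _ _ HV _ (fun i v => ksgn k 1 i *: v)) => n.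
exact/lin_scale/lin_id. Qed.

End SgV.

Section SpaceCriterion.
Variables (k : fieldType) (V : dgSpace k).

(** Linear projections that select a degree replace the unique existence of decompositions. They can
    be produced by a universal property, for presented algebras and for tensor products alike. *)
Lemma mk_dgSpace (pr : int -> V -> V) :
  (forall n (c : k) (u v : V), gr n u -> gr n v -> gr n (c *: u + v)) ->
  (forall n, gr n (0 : V)) ->
  (forall v : V, lspan [set u | exists n, gr n u] v) ->
  (forall n, linear (pr n)) ->
  (forall n m (v : V), gr n v -> pr m v = if m == n then v else 0) ->
  linear (@dif k V) ->
  (forall n (v : V), gr n v -> gr (n + 1) (dif v)) ->
  (forall n (v : V), gr n v -> dif (dif v) = 0) ->
  is_dgSpace V.
Proof.
move=> grl gr00 grs prl prE dl dg dd.
have dec_sum (v : V) f : decomposes v f ->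
    exists2 A : {fset int}, (forall n, n \notin A -> f n = 0)
    & v = \sum_(n <- A) f n.
  case=> _ fin ->; exists (fset_set [set n | f n <> 0]) => [n|].
    by rewrite in_fset_set// => nA; apply: contrapT => n0; rewrite mem_set in nA.
  apply: fsbigTE => n; rewrite in_fset_set// => nA.
  by apply: contrapT => n0; rewrite mem_set in nA.
(* Applied to a decomposition, the projection to degree n leaves its single term of that degree;
   this is uniqueness. *)
have dec_pr (v : V) f : decomposes v f -> f = pr^~ v.
  move=> D; have [fg _ _] := D; have [A fA ->] := dec_sum _ _ D.
  apply/funext => n; rewrite lin_sum//.
  have [nA|nA] := boolP (n \in A); last first.
    rewrite fA// big_seq big1// => m mA; rewrite (prE m)//.
    by case: eqP nA => // ->; rewrite mA.
  rewrite (big_fsetD1 n)//= (prE n)// eqxx big_seq big1 ?addr0// => m.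
  by rewrite !inE (prE m)// eq_sym => /andP[/negPf ->].
split=> //; last first.
  move=> v; apply: (lspan_eq _ _ _ (grs v) (f := fun v => dif (dif v)) (g := (fun=> 0))).
  - exact: lin_comp.
  - exact: lin_cst0.
  - by move=> u [n /dd].
move=> v; exists (pr^~ v); split; last by move=> f /dec_pr ->.
suff [f D] : exists f, decomposes v f by rewrite -(dec_pr _ _ D).
(* Existence: each homogeneous summand c u is added to the component of its degree. *)
elim: (grs v) => [|c u w [n un] _ [f D]].
  exists (fun=> 0); split=> //; last by rewrite fsbig1.
  by rewrite (_ : [set _ | _] = set0)// -subset0.
have [fg _ _] := D; have [A fA ->] := dec_sum _ _ D.
pose g m := c *: (if m == n then u else 0) + f m.
have gA m : m \notin (n |` A)%fset -> g m = 0.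
  rewrite !inE negb_or /g => /andP[/negPf-> /fA ->].
  by rewrite scaler0 addr0.
exists g; split=> [m||].
- by apply: grl => //; case: eqP => [->|].
- apply: sub_finite_set (finite_fset (n |` A)%fset) => m /= gm.
  by apply/negPn/negP => /gA.
- rewrite (fsbigTE (n |` A)%fset _ gA) big_split/= -scaler_sumr; congr (_ *: _ + _).
    rewrite (big_fsetD1 n)/= ?fset1U1// eqxx big_seq big1 ?addr0// => m.
    by rewrite !inE => /andP[/negPf ->].
  by apply: big_fset_incl; [exact: fsubsetU1 | move=> m _ /fA].
Qed.

End SpaceCriterion.

(** * Algebras given by generators and relations *)

Section AlgebraLaws.
Variables (k : fieldType) (A : dgAlg k).

(** The ungraded laws, which a presented algebra satisfies before anything is known of its grading
    and differential. *)
Definition is_alg :=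
  [/\ bilin (@amul k A), associative (@amul k A),
      left_id aone (@amul k A) & right_id aone (@amul k A)].

Hypothesis HA : is_alg.
Implicit Types a b : A.

Lemma amul_bilin : bilin (@amul k A). Proof. by case: HA. Qed.
Lemma amulA : associative (@amul k A). Proof. by case: HA. Qed.
Lemma amul1l : left_id aone (@amul k A). Proof. by case: HA. Qed.
Lemma amul1r : right_id aone (@amul k A). Proof. by case: HA. Qed.
Lemma amulLl a : linear (fun b => b ** a). Proof. by case: amul_bilin. Qed.
Lemma amulLr a : linear (fun b => a ** b). Proof. by case: amul_bilin. Qed.
Lemma amulDl a b c : (a + b) ** c = a ** c + b ** c.
Proof. exact: linD (amulLl c) _ _. Qed.
Lemma amulDr a b c : a ** (b + c) = a ** b + a ** c.
Proof. exact: linD (amulLr a) _ _. Qed.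
Lemma amulZl x a b : (x *: a) ** b = x *: (a ** b).
Proof. exact: linZ (amulLl b) _ _. Qed.
Lemma amulZr x a b : a ** (x *: b) = x *: (a ** b).
Proof. exact: linZ (amulLr a) _ _. Qed.
Lemma amulNl a b : (- a) ** b = - (a ** b).
Proof. exact: linN (amulLl b) _. Qed.
Lemma amulNr a b : a ** (- b) = - (a ** b).
Proof. exact: linN (amulLr a) _. Qed.
Lemma amul0l a : 0 ** a = 0. Proof. exact: lin0 (amulLl a). Qed.
Lemma amul0r a : a ** 0 = 0. Proof. exact: lin0 (amulLr a). Qed.

Definition amulE := (amulDl, amulDr, amulZl, amulZr, amulNl, amulNr, amul0l,
  amul0r, amul1l, amul1r, amulA).

End AlgebraLaws.

Section DgAlgebraLaws.
Variables (k : fieldType) (A : dgAlg k).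
Hypothesis HA : is_dgAlg A.

Lemma dgAlg_space : is_dgSpace A. Proof. by case: HA. Qed.
Lemma dgAlg_alg : is_alg A. Proof. by case: HA => _ ? [? []]. Qed.
Lemma gr_one : gr 0 (aone : A). Proof. by case: HA => _ _ _ []. Qed.
Lemma gr_mul i j (a b : A) : gr i a -> gr j b -> gr (i + j) (a ** b).
Proof. by case: HA => _ _ _ [_ H] _; apply: H. Qed.
Lemma dif_mul i (a b : A) : gr i a ->
  dif (a ** b) = dif a ** b + ksgn k 1 i *: (a ** dif b).
Proof. by case: HA => _ _ _ _; apply. Qed.

Lemma dif_one : dif (aone : A) = 0.
Proof.
have ha := dgAlg_alg.
have := dif_mul aone gr_one; rewrite !(amulE ha) ksgnE oddz0 andbF expr0 scale1r.
by rewrite -{1}[dif aone]addr0 => /addrI ->.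
Qed.

End DgAlgebraLaws.

(** * Actions of the free algebra *)

Section Actions.
Variables (k : fieldType) (V : dgSpace k) (M : lmodType k) (T : V -> M -> M).

Definition wact (s : seq V) (m : M) : M := foldr T m s.

Definition act (u : freealg V) (m : M) : M :=
  lin_ext (fun w : {fmonom V} => wact w m) u.

Lemma act_linl m : linear (act^~ m). Proof. exact: lin_ext_lin. Qed.

Hypothesis Tb : bilin T.

Lemma wact_lin s : linear (wact s).
Proof.
elim: s => [|x s IH] // c u v.
by rewrite -[LHS]/(T x (wact s _)) IH Tb.2.
Qed.

Lemma act_linr u : linear (act u).
Proof.
move=> c m m'; rewrite /act /lin_ext scaler_sumr -big_split/=.
by apply: eq_bigr => w _; rewrite wact_lin scalerDr !scalerA mulrC.
Qed.

Lemma actU w m : act << w >> m = wact w m.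
Proof. exact: lin_extU. Qed.

Lemma act1 m : act 1 m = m.
Proof. by rewrite actU fm1. Qed.

Lemma act_var x m : act (var x) m = T x m.
Proof. by rewrite actU fmU. Qed.

End Actions.

Section MonomialAlgebra.
Variables (k : fieldType) (K : monomType).
Implicit Types u v : {malg k[K]}.

(** Scalars are central because k is commutative; linearity in u and v leaves a check on two
    monomials. *)
Lemma malg_scaleAr c u v : c *: (u * v) = u * (c *: v).
Proof.
have Z d (w : K) : d *: << w >> = << d *g w >> :> {malg k[K]}.
  by apply/malgP => y; rewrite mcoeffZ !mcoeffU mulrnAr mulr1.
elim: (malg_span u) => [|a ? u' [w _ <-] _ IHu]; first by rewrite !mul0r scaler0.
rewrite !mulrDl scalerDr IHu; congr (_ + _).
elim: (malg_span v) => [|b ? v' [w' _ <-] _ IHv].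
  by rewrite scaler0 mulr0 scaler0.
rewrite scalerDr !mulrDr scalerDr IHv; congr (_ + _).
have Z' d (x : K) : d *: (<< x >> : ({malg k[K]} : lmodType k)) = << d *g x >>.
  exact: Z.
rewrite !Z' malgM_def fgmulUU.
have ZZ d e (x : K) : d *: << e *g x >> = << d * e *g x >> :> {malg k[K]}.
  by apply/malgP => y; rewrite mcoeffZ !mcoeffU mulrnAr.
rewrite !ZZ malgM_def fgmulUU.
by congr (<< _ *g _ >>); ring.
Qed.

Lemma malgUM (w w' : K) : << mmul w w' >> = << w >> * << w' >> :> {malg k[K]}.
Proof. by rewrite malgM_def fgmulUU mulr1. Qed.

End MonomialAlgebra.

Section FreeAlgebra.
Variables (k : fieldType) (V : dgSpace k).
Implicit Types u v : freealg V.

Lemma free_mulrl v : linear (fun u : freealg V => u * v).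
Proof. by move=> c u u'; rewrite mulrDl; congr (_ + _); apply/esym/scalerAl. Qed.

Lemma free_mulrr u : linear (fun v : freealg V => u * v).
Proof. by move=> c v v'; rewrite mulrDr; congr (_ + _); apply/esym/malg_scaleAr. Qed.

Lemma prod_var (w : {fmonom V}) : << w >> = \prod_(x <- w) var x.
Proof.
case: w => s; elim: s => [|x s IH] /=; first by rewrite big_nil -fmoneE.
rewrite big_cons /= -IH /var -malgUM.
have -> : FMonom (x :: s) = mmul (fmu x) (FMonom s) by rewrite [RHS]fmmulE fmuE.
by [].
Qed.

End FreeAlgebra.

Section ActionsMul.
Variables (k : fieldType) (V : dgSpace k) (M : lmodType k) (T : V -> M -> M).
Hypothesis Tb : bilin T.

Lemma actM (u v : freealg V) m : act T (u * v) m = act T u (act T v m).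
Proof.
pose f (u : freealg V) := act T (u * v) m.
apply: (@malg_lin_eq _ _ _ f (fun u => act T u (act T v m))) => [||w].
- by apply: lin_comp; [apply: act_linl|apply: free_mulrl].
- exact: act_linl.
apply: (@malg_lin_eq _ _ _ (fun v => act T (<<w>> * v) m)
  (fun v => act T << w >> (act T v m))) => [||w'].
- by apply: lin_comp; [apply: act_linl|apply: free_mulrr].
- by apply: lin_comp; [apply: act_linr|apply: act_linl].
- by rewrite -malgUM !actU fmM /wact foldr_cat.
Qed.

Lemma actD (u v : freealg V) m : act T (u + v) m = act T u m + act T v m.
Proof. exact: (linD (act_linl T m)). Qed.
Lemma actN (u : freealg V) m : act T (- u) m = - act T u m.
Proof. exact: (linN (act_linl T m)). Qed.
Lemma actZ c (u : freealg V) m : act T (c *: u) m = c *: act T u m.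
Proof. exact: (linZ (act_linl T m)). Qed.

Definition actE := (actD, actN, actZ, actM, act1, act_var).

(** This and the next three evaluations cover the quadratic shapes that occur in the relations of
    [Sym], [Uea] and [Env]. *)
Lemma act_M2 x y m : act T (var x * var y) m = T x (T y m).
Proof. by rewrite actM !act_var. Qed.

Lemma act_Z2 c x y m : act T (c *: (var x * var y)) m = c *: T x (T y m).
Proof. exact: etrans (actZ _ _ _) (congr1 _ (act_M2 _ _ _)). Qed.

Lemma act_MZ c x y z t m : act T (var x * var y + c *: (var z * var t)) m =
  T x (T y m) + c *: T z (T t m).
Proof. exact: etrans (actD _ _ _) (congr2 _ (act_M2 _ _ _) (act_Z2 _ _ _ _)). Qed.

Lemma act_MNZ c x y z t m : act T (var x * var y - c *: (var z * var t)) m =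
  T x (T y m) - c *: T z (T t m).
Proof.
apply: etrans (actD _ _ _) (congr2 _ (act_M2 _ _ _) _).
exact: etrans (actN _ _) (congr1 _ (act_Z2 _ _ _ _)).
Qed.

Lemma act_prod s m : act T (\prod_(x <- s) var x) m = wact T s m.
Proof. by elim: s => [|x s IH]; rewrite ?big_nil ?big_cons ?actE//= IH. Qed.

End ActionsMul.

(** * Quotients of the free algebra *)

Section PresentedAlgebra.
Variables (k : fieldType) (V : dgSpace k) (rel : freealg V -> freealg V -> Prop).

Notation P := (presented rel).
Notation I := (ideal_gen rel).
Notation cl := (cls I : freealg V -> P).

Lemma ideal_mulr (x v : freealg V) : I x -> I (x * v).
Proof.
move=> [a [b [l [r [lr ->]]]]]; exists a, (b * v), l, r; split; first exact: lr.
exact: (esym (mulrA (a * (l - r)) b v)).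
Qed.

Lemma ideal_mull (x v : freealg V) : I x -> I (v * x).
Proof.
move=> [a [b [l [r [lr ->]]]]]; exists (v * a), b, l, r; split; first exact: lr.
transitivity (v * (a * (l - r)) * b); first exact: (mulrA v (a * (l - r)) b).
exact: (congr1 (fun y : freealg V => y * b) (mulrA v a (l - r))).
Qed.

(** Independence of representatives: u' v' - u v = (u' - u) v' + u (v' - v), and the relations span
    a two-sided ideal. *)
Lemma pres_mulE (u v : freealg V) : cl u ** cl v = cl (u * v).
Proof.
apply: cls_eq; set u' := rep _; set v' := rep _.
have -> : u' * v' - u * v = (u' - u) * v' + u * (v' - v).
  by rewrite mulrBl mulrBr addrA subrK.
apply: lspan_add.
  by apply: (lspan_img (free_mulrl v')) (cls_rep _ _) => x /(ideal_mulr v')/lspan_gen.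
by apply: (lspan_img (free_mulrr u)) (cls_rep _ _) => x /(ideal_mull u)/lspan_gen.
Qed.

Lemma pres_alg : is_alg P.
Proof.
split=> [|p q r|p|p].
- split=> p c; elim/(@cls_ind _ _ I): p => v; elim/(@cls_ind _ _ I)=> u;
    elim/(@cls_ind _ _ I)=> u'.
    transitivity (cl ((c *: u + u') * v)); first by rewrite -pres_mulE (cls_lin I).
    rewrite !pres_mulE; exact: (lin_comp (cls_lin I) (free_mulrl v)).
  transitivity (cl (v * (c *: u + u'))); first by rewrite -pres_mulE (cls_lin I).
  rewrite !pres_mulE; exact: (lin_comp (cls_lin I) (free_mulrr v)).
- elim/(@cls_ind _ _ I): p => p; elim/(@cls_ind _ _ I): q => q.
  by elim/(@cls_ind _ _ I): r => r; rewrite !pres_mulE mulrA.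
- by elim/(@cls_ind _ _ I): p => p; rewrite -[aone]/(cl 1) pres_mulE mul1r.
- by elim/(@cls_ind _ _ I): p => p; rewrite -[aone]/(cl 1) pres_mulE mulr1.
Qed.

Lemma pres_rel l r : tensor_rel rel l r -> cl l = cl r.
Proof.
move=> lr; apply: cls_eq; apply: lspan_gen.
by exists 1, 1, l, r; rewrite mul1r mulr1.
Qed.

End PresentedAlgebra.

(* What is used of a presented algebra; keeping the algebra abstract also
   keeps its operations from being unfolded to quotients. *)
Record presents (k : fieldType) (V : dgSpace k)
    (rel : freealg V -> freealg V -> Prop) (P : dgAlg k) (cl : freealg V -> P)
    (gn : V -> P) : Prop := Presents {
  ps_gen : forall x, cl (var x) = gn x;
  ps_alg : is_alg P;
  ps_lin : linear cl;
  ps_mul : forall u v, cl (u * v) = cl u ** cl v;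
  ps_one : cl 1 = aone;
  ps_surj : forall p, exists u, p = cl u /\
    dif p = cl (lin_ext (fun w : {fmonom V} => word_dif w) u);
  ps_ker : forall u v, cl u = cl v -> lspan (ideal_gen rel) (u - v);
  ps_rel : forall l r, tensor_rel rel l r -> cl l = cl r;
  ps_gr : forall n, @gr k P n = lspan [set cl (\prod_(x <- s) var x) | s in hword n] }.

Lemma presented_presents (k : fieldType) (V : dgSpace k)
    (rel : freealg V -> freealg V -> Prop) :
  presents rel (cls (ideal_gen rel) : freealg V -> presented rel) (gen rel).
Proof.
split.
- by move=> x; exact: erefl.
- exact: pres_alg.
- exact: cls_lin.
- by move=> u v; rewrite -pres_mulE.
- exact: erefl.
- by move=> p; exists (rep p); split; [rewrite repK|exact: erefl].
- by move=> u v; apply: cls_ker.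
- by move=> l r; apply: pres_rel.
- by move=> n; exact: erefl.
Qed.

(** Replaces both sides of a relation by their evaluations through explicit proof terms, without
    rewriting under the quotient. *)
Lemma eq_by (T : Type) (a b a' b' : T) : a = a' -> b = b' -> a' = b' -> a = b.
Proof. by move=> -> ->. Qed.

Section PresentedTheory.
Variables (k : fieldType) (V : dgSpace k) (rel : freealg V -> freealg V -> Prop).
Variables (P : dgAlg k) (cl : freealg V -> P) (gn : V -> P).
Hypothesis Pcl : presents rel cl gn.

Let ha : is_alg P := ps_alg Pcl.

Lemma pres_ind (Q : P -> Prop) : (forall u, Q (cl u)) -> forall p, Q p.
Proof. by move=> H p; have [u [-> _]] := ps_surj Pcl p. Qed.

Lemma gen_lin : linear gn.
Proof.
move=> c x y; rewrite -!(ps_gen Pcl).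
exact: etrans (ps_rel Pcl (tensor_lin _ _ _ _)) (ps_lin Pcl _ _ _).
Qed.

Lemma cl_M2 x y : cl (var x * var y) = gn x ** gn y.
Proof. by rewrite -!(ps_gen Pcl); apply: ps_mul Pcl _ _. Qed.

Lemma cl_Z2 c x y : cl (c *: (var x * var y)) = c *: (gn x ** gn y).
Proof. exact: etrans (linZ (ps_lin Pcl) _ _) (congr1 _ (cl_M2 _ _)). Qed.

Lemma cl_MZ c x y z t : cl (var x * var y + c *: (var z * var t)) =
  gn x ** gn y + c *: (gn z ** gn t).
Proof. exact: etrans (linD (ps_lin Pcl) _ _) (congr2 _ (cl_M2 _ _) (cl_Z2 _ _ _)). Qed.

Lemma cl_MNZ c x y z t : cl (var x * var y - c *: (var z * var t)) =
  gn x ** gn y - c *: (gn z ** gn t).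
Proof. exact: etrans (linB (ps_lin Pcl) _ _) (congr2 _ (cl_M2 _ _) (congr1 _ (cl_Z2 _ _ _))). Qed.

Lemma ps_rel2 l r a b : rel l r -> cl l = a -> cl r = b -> a = b.
Proof. by move=> lr <- <-; apply: ps_rel Pcl _ _ (tensor_extra lr). Qed.

(** The representative from which [dif] is computed. That another one would do as well is known only
    after [difT] is shown to respect the relations. *)
Definition prep (p : P) : freealg V := sval (cid (ps_surj Pcl p)).

Lemma prepK p : cl (prep p) = p.
Proof. by rewrite /prep; case: cid => u [] /=. Qed.

Lemma prep_dif p :
  dif p = cl (lin_ext (fun w : {fmonom V} => word_dif w) (prep p)).
Proof. by rewrite /prep; case: cid => u [] /=. Qed.

Lemma cl_prod x s :
  cl (\prod_(y <- x :: s) var y) = gn x ** cl (\prod_(y <- s) var y).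
Proof. by rewrite big_cons -(ps_gen Pcl); apply: (ps_mul Pcl). Qed.

Lemma cl_prod0 : cl (\prod_(y <- [::]) var y) = aone.
Proof. by rewrite big_nil (ps_one Pcl). Qed.

Section Act.
Variables (M : lmodType k) (T : V -> M -> M).
Hypothesis Tb : bilin T.
Hypothesis Trel : forall l r, rel l r -> forall m, act T l m = act T r m.

Definition pact (p : P) (m : M) : M := act T (prep p) m.

(** The relations are required as operators on all of M because a * (l - r) * b applies l - r to the
    arbitrary vector b m. *)
Lemma act_ideal u m : lspan (ideal_gen rel) u -> act T u m = 0.
Proof.
apply: (lspan_lin0 (act_linl T m)) => _ [a [b [l [r [lr ->]]]]].
rewrite !(actE Tb).
suff -> : act T l (act T b m) = act T r (act T b m).
  by rewrite subrr (lin0 (act_linr Tb a)).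
case: lr => [c x y|{}l {}r /Trel //].
by rewrite !(actE Tb) Tb.1.
Qed.

Lemma pact_cls u m : pact (cl u) m = act T u m.
Proof.
apply/eqP; rewrite -subr_eq0 -(linB (act_linl T m)); apply/eqP.
by apply/act_ideal/(ps_ker Pcl); rewrite prepK.
Qed.

Lemma pact_bilin : bilin pact.
Proof.
split=> [m c p q|p]; last exact: act_linr.
elim/pres_ind: p => u; elim/pres_ind: q => v.
by rewrite -(ps_lin Pcl) !pact_cls (act_linl T m).
Qed.

Lemma pact_mul p q m : pact (p ** q) m = pact p (pact q m).
Proof.
elim/pres_ind: p => u; elim/pres_ind: q => v.
by rewrite -(ps_mul Pcl) !pact_cls (actM Tb).
Qed.

Lemma pact_one m : pact aone m = m.
Proof. by rewrite -(ps_one Pcl) pact_cls act1. Qed.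

Lemma pact_gen x m : pact (gn x) m = T x m.
Proof. by rewrite -(ps_gen Pcl) pact_cls act_var. Qed.

End Act.

(** Each letter of a word is split into homogeneous components. This uses the linearity of [gn] and
    so takes place in P: variables of the free algebra are not linear in their index. *)
Lemma pres_span : is_dgSpace V -> forall p : P,
  lspan [set q | exists n, exists2 s, hword n s & q = cl (\prod_(x <- s) var x)] p.
Proof.
move=> HV; elim/pres_ind => u.
apply: (lspan_img (ps_lin Pcl)) (malg_span u) => _ [w _ <-].
rewrite prod_var; elim: (w : seq V) => [|x s IH].
  by apply: lspan_gen; exists 0, [::] => //; constructor.
rewrite cl_prod.
apply: (lspan_img (amulLr ha _)) IH => _ [n [s' ns' ->]].
have L : linear (fun x => gn x ** cl (\prod_(y <- s') var y)).
  apply: (@lin_comp _ _ _ _ (fun p => p ** _)); last exact: gen_lin.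
  exact: amulLl ha _.
apply: (lspan_img L) (gr_span HV x) => {}x [i xi].
apply: lspan_gen; exists (i + n), (x :: s'); first by constructor.
by rewrite cl_prod.
Qed.

(** The main induction principle: homogeneous elements are built from 1 by left multiplication with
    homogeneous generators and by linear combinations within a degree. *)
Lemma pres_gr_ind (Q : int -> P -> Prop) :
  (forall n, Q n 0) ->
  (forall n c p q, gr n p -> gr n q -> Q n p -> Q n q -> Q n (c *: p + q)) ->
  Q 0 aone ->
  (forall i n x p, gr i x -> gr n p -> Q n p -> Q (i + n) (gn x ** p)) ->
  forall n p, gr n p -> Q n p.
Proof.
move=> Q0 Ql Q1 Qm.
have Qw n s : hword n s -> Q n (cl (\prod_(x <- s) var x)).
  elim=> [|i {}n x {}s xi ns IH]; first by rewrite cl_prod0.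
  rewrite cl_prod; apply: Qm => //.
  by rewrite (ps_gr Pcl); apply: lspan_gen; exists s.
move=> n p; rewrite {1}(ps_gr Pcl); elim=> [|c u v [s ns <-] vS IH]; first exact: Q0.
apply: Ql => //; [|by rewrite (ps_gr Pcl)|exact: Qw].
by rewrite (ps_gr Pcl); apply: lspan_gen; exists s.
Qed.

Lemma pres_gr0 n : gr n (0 : P).
Proof. by rewrite (ps_gr Pcl); apply: lspan0. Qed.

Lemma pres_gr_lin n (c : k) (p q : P) : gr n p -> gr n q -> gr n (c *: p + q).
Proof. by rewrite (ps_gr Pcl); apply: lspan_lin. Qed.

Lemma pres_gr_one : gr 0 (aone : P).
Proof. by rewrite (ps_gr Pcl); apply: lspan_gen; exists [::]; [constructor|rewrite cl_prod0]. Qed.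

Lemma pres_gr_gen n x : gr n x -> gr n (gn x).
Proof.
move=> xn; rewrite (ps_gr Pcl); apply: lspan_gen.
exists [:: x]; last by rewrite big_seq1 (ps_gen Pcl).
by rewrite -[n]addr0; constructor => //; constructor.
Qed.

Lemma pres_gr_genM i n x (p : P) : gr i x -> gr n p -> gr (i + n) (gn x ** p).
Proof.
move=> xi; rewrite !(ps_gr Pcl); apply: (lspan_img (amulLr ha _)) => _ [s ns <-].
apply: lspan_gen; exists (x :: s); first by constructor.
by rewrite cl_prod.
Qed.

Lemma pres_gr_mul i j (p q : P) : gr i p -> gr j q -> gr (i + j) (p ** q).
Proof.
move=> pi qj; elim/pres_gr_ind: i p / pi => [i|i c p q' _ _||i n x p xi pn IH].
- by rewrite (amul0l ha) (ps_gr Pcl); apply: lspan0.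
- by rewrite (amulDl ha) (amulZl ha); apply: pres_gr_lin.
- by rewrite add0r (amul1l ha).
- by rewrite -addrA -(amulA ha); apply: pres_gr_genM.
Qed.

Lemma pres_lin_ind (Q : P -> Prop) : is_dgSpace V ->
  Q 0 -> (forall c p q, Q p -> Q q -> Q (c *: p + q)) ->
  (forall n p, gr n p -> Q p) -> forall p, Q p.
Proof.
move=> HV Q0 Ql Qg p; elim: (pres_span HV p) => [|c u v [n [s ns ->]] _ IH] //.
by apply: Ql => //; apply: (Qg n); rewrite (ps_gr Pcl); apply: lspan_gen; exists s.
Qed.

End PresentedTheory.

Section HomogeneousSpan.
Variables (k : fieldType) (V : dgSpace k).
Implicit Types u v : freealg V.

(** Serves to say that a relation is homogeneous, in the free algebra where its two sides live. *)
Definition hspan n : set (freealg V) :=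
  lspan [set \prod_(x <- s) var x | s in hword n].

Lemma hword_cat i j (s t : seq V) : hword i s -> hword j t -> hword (i + j) (s ++ t).
Proof.
move=> si tj; elim: si => [|i' n x s' xi _ IH]; first by rewrite add0r.
by rewrite -addrA; constructor.
Qed.

Lemma hspan_one : hspan 0 1.
Proof. by apply: lspan_gen; exists [::]; [constructor|rewrite big_nil]. Qed.

Lemma hspan_var n x : gr n x -> hspan n (var x).
Proof.
move=> xn; apply: lspan_gen; exists [:: x]; last by rewrite big_seq1.
by rewrite -[n]addr0; constructor => //; constructor.
Qed.

Lemma hspan_mul i j u v : hspan i u -> hspan j v -> hspan (i + j) (u * v).
Proof.
move=> ui vj; apply: (lspan_img (free_mulrl v)) ui => _ [s si <-].
apply: (lspan_img (free_mulrr _)) vj => _ [t tj <-].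
by apply: lspan_gen; exists (s ++ t); [apply: hword_cat|rewrite big_cat].
Qed.

Lemma hspanD n u v : hspan n u -> hspan n v -> hspan n (u + v).
Proof. exact: lspan_add. Qed.

Lemma hspanZ n c u : hspan n u -> hspan n (c *: u).
Proof. exact: lspan_scale. Qed.

Lemma hspanN n u : hspan n u -> hspan n (- u).
Proof. by rewrite -scaleN1r; apply: lspan_scale. Qed.

End HomogeneousSpan.

(** * Grading and differential of a presented algebra *)

Section PresentedDgAlgebra.
Variables (k : fieldType) (V : dgSpace k) (rel : freealg V -> freealg V -> Prop).
Variables (P : dgAlg k) (cl : freealg V -> P) (gn : V -> P).
Hypotheses (Pcl : presents rel cl gn) (HV : is_dgSpace V).

Let ha : is_alg P := ps_alg Pcl.

Hypothesis rel_gr : forall l r, rel l r -> exists n, hspan n l /\ hspan n r.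

(** A function g stands for the formal series with coefficient g(n) at t^n, and a homogeneous x of
    degree i acts as multiplication by gn(x) t^i. *)
Definition shiftT (x : V) (g : int -> P) : int -> P :=
  fun n => hext (fun i x' => gn x' ** g (n - i)) x.

Lemma shiftT_bilin : bilin shiftT.
Proof.
split=> [g c x y|x c g h]; apply/funext => n.
  apply: (@hext_lin _ _ HV _ (fun i x' => gn x' ** g (n - i))) => i.
  by apply: (@lin_comp _ _ _ _ (fun p => p ** g (n - i))); [apply: amulLl|apply: gen_lin Pcl].
apply: (@hext_linF _ _ HV _ c (fun i x' => gn x' ** g (n - i))
  (fun i x' => gn x' ** h (n - i)) (fun i x' => gn x' ** (c *: g + h) (n - i))).
- by move=> i; rewrite (lin0 (gen_lin Pcl)) (amul0l ha).
- by move=> i; rewrite (lin0 (gen_lin Pcl)) (amul0l ha).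
- by move=> i u; rewrite !fctE !(amulE ha).
Qed.

Lemma shiftT_word d s g n : hword d s ->
  wact shiftT s g n = cl (\prod_(x <- s) var x) ** g (n - d).
Proof.
move=> ds; elim: ds n => [|i d' x s' xi _ IH] n.
  by rewrite (cl_prod0 Pcl) (amul1l ha) subr0.
rewrite (cl_prod Pcl) -[LHS]/(hext (fun i x' => gn x' ** wact shiftT s' g (n - i)) x).
rewrite (hextE HV _ xi); last first.
  by move=> j; rewrite (lin0 (gen_lin Pcl)) (amul0l ha).
by rewrite IH (amulA ha) opprD addrA.
Qed.

Lemma shiftT_hspan d u g n : hspan d u -> act shiftT u g n = cl u ** g (n - d).
Proof.
have fl : linear (fun u => act shiftT u g n).
  by move=> c v w; rewrite (act_linl shiftT g).
pose h u := cl u ** g (n - d).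
apply: (lspan_eq fl (_ : linear h)).
  apply: (@lin_comp _ _ _ _ (fun p => p ** g (n - d))) (ps_lin Pcl).
  exact: amulLl ha _.
by move=> _ [s ds <-]; rewrite (act_prod shiftT_bilin) (shiftT_word _ _ ds).
Qed.

(** Both sides have a common degree d, hence act as t^d times their classes, and the classes agree
    in P. *)
Lemma shiftT_rel l r : rel l r -> forall g, act shiftT l g = act shiftT r g.
Proof.
move=> lr g; have [d [ld rd]] := rel_gr lr.
apply/funext => n; rewrite !(shiftT_hspan _ _ ld, shiftT_hspan _ _ rd).
by rewrite (ps_rel Pcl (tensor_extra lr)).
Qed.

(** Acting on the constant series 1 turns p into the series of its homogeneous components; the
    coefficient at t^n is read off. *)
Definition pres_pr (n : int) (p : P) : P :=
  pact Pcl shiftT p (fun m => if m == 0 then aone else 0) n.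

Lemma pres_pr_lin n : linear (pres_pr n).
Proof.
move=> c p q; rewrite /pres_pr.
by rewrite ((pact_bilin Pcl shiftT_bilin shiftT_rel).1 _).
Qed.

Lemma pres_prE n m (p : P) : gr n p -> pres_pr m p = if m == n then p else 0.
Proof.
rewrite (ps_gr Pcl) => pn; pose f (p : P) : P := if m == n then p else 0.
apply: (lspan_eq (pres_pr_lin m) (_ : linear f)) pn => [c u v|_ [s ns <-]].
  by rewrite /f; case: eqP => // _; rewrite scaler0 addr0.
rewrite /pres_pr (pact_cls Pcl shiftT_bilin shiftT_rel) (act_prod shiftT_bilin).
rewrite (shiftT_word _ _ ns) subr_eq0 /f.
by case: eqP => _; rewrite !(amulE ha).
Qed.

(** The matrix with rows (gn (sgv x), gn (dif x)) and (0, gn x). Multiplying such matrices is the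
    graded Leibniz rule, so the upper right corner of a product is its differential. *)
Definition difT (x : V) (m : P * P) : P * P :=
  (gn (dif x) ** m.2 + gn (sgv x) ** m.1, gn x ** m.2).

Lemma difT_bilin : bilin difT.
Proof.
split=> [m c x y|x c m m']; congr pair => /=.
- rewrite (dif_lin HV) (sgv_lin HV) !(gen_lin Pcl) !(amulE ha).
  lmod k P.
- by rewrite (gen_lin Pcl) !(amulE ha).
- by rewrite !(amulE ha); lmod k P.
- by rewrite !(amulE ha).
Qed.

Lemma difT_word s : wact difT s (0, aone) = (cl (word_dif s), cl (\prod_(x <- s) var x)).
Proof.
elim: s => [|x s IH]; first by rewrite (cl_prod0 Pcl) -[word_dif _]/0 (lin0 (ps_lin Pcl)).
rewrite big_cons -[LHS]/(difT x (wact difT s (0, aone))) IH.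
rewrite /difT /= -!(ps_gen Pcl); congr pair; last exact/esym/(ps_mul Pcl).
exact/esym/(etrans (linD (ps_lin Pcl) _ _) (congr2 +%R (ps_mul Pcl _ _) (ps_mul Pcl _ _))).
Qed.

Lemma difT_free u : act difT u (0, aone) =
  (cl (lin_ext (fun w : {fmonom V} => word_dif w) u), cl u).
Proof.
pose f u : P * P := (cl (lin_ext (fun w : {fmonom V} => word_dif w) u), cl u).
apply: (@malg_lin_eq _ _ _ (fun u => act difT u (0, aone)) f) => [|c {}u v|w].
- exact: act_linl.
- by rewrite /f lin_ext_lin !(ps_lin Pcl).
- by rewrite actU difT_word /f lin_extU prod_var.
Qed.

(* The left-hand side is the class of the differential of l. *)
Hypothesis rel_dif : forall l r, rel l r ->
  (act difT l (0, aone)).1 = (act difT r (0, aone)).1.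

(** An element of degree d acts by the matrix with rows ((-1)^d u, d(u)) and (0, u), which is
    determined by its last column and by d. A homogeneous relation thus need only be checked on the
    vector (0, 1). *)
Lemma difT_hspan d u m : hspan d u ->
  act difT u m = ((act difT u (0, aone)).1 ** m.2 + ksgn k 1 d *: (cl u ** m.1),
                  cl u ** m.2).
Proof.
pose f u := ((act difT u (0, aone)).1 ** m.2 + ksgn k 1 d *: (cl u ** m.1),
             cl u ** m.2) : P * P.
apply: (lspan_eq (act_linl difT m) (_ : linear f)) => [c v w|_ [s ds <-]].
  rewrite /f (act_linl difT) (ps_lin Pcl) !(amulE ha); congr pair => /=.
  lmod k P.
rewrite /f !(act_prod difT_bilin); elim: ds => [|i d' x s' xi _ IH].
  rewrite (cl_prod0 Pcl) /= !(amulE ha) ksgnE oddz0 andbF expr0 scale1r add0r.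
  by case: m {f}.
rewrite (cl_prod Pcl) -[LHS]/(difT x (wact difT s' m)) IH.
rewrite -[wact _ (x :: s') _]/(difT x (wact difT s' (0, aone))) difT_word /difT /=.
rewrite (sgvE HV xi) (linZ (gen_lin Pcl)) !(amulE ha); congr pair => /=.
lmod k P.
Qed.

Lemma difT_rel l r : rel l r -> forall m, act difT l m = act difT r m.
Proof.
move=> lr m; have [d [ld rd]] := rel_gr lr.
rewrite (difT_hspan _ ld) (difT_hspan _ rd) (rel_dif lr).
by rewrite (ps_rel Pcl (tensor_extra lr)).
Qed.

Lemma pres_difE (p : P) : dif p = (pact Pcl difT p (0, aone)).1.
Proof. by rewrite (prep_dif Pcl) /pact difT_free. Qed.

Lemma pres_pact2 (p : P) : (pact Pcl difT p (0, aone)).2 = p.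
Proof. by rewrite /pact difT_free /= prepK. Qed.

Let bil := pact_bilin Pcl difT_bilin difT_rel.

Lemma pres_dif_lin : linear (@dif k P).
Proof. by move=> c p q; rewrite !pres_difE bil.1. Qed.

Lemma pres_dif_one : dif (aone : P) = 0.
Proof. by rewrite pres_difE (pact_one Pcl difT_bilin difT_rel). Qed.

Lemma pres_dif_genM x (p : P) :
  dif (gn x ** p) = gn (dif x) ** p + gn (sgv x) ** dif p.
Proof.
rewrite [LHS]pres_difE (pact_mul Pcl difT_bilin difT_rel).
by rewrite (pact_gen Pcl difT_bilin difT_rel) /= pres_pact2 -pres_difE.
Qed.

Lemma pres_dif_genMh i x (p : P) : gr i x ->
  dif (gn x ** p) = gn (dif x) ** p + ksgn k 1 i *: (gn x ** dif p).
Proof.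
by move=> xi; rewrite pres_dif_genM (sgvE HV xi) (linZ (gen_lin Pcl)) (amulZl ha).
Qed.

Lemma pres_dif_gen x : dif (gn x) = gn (dif x).
Proof.
have := pres_dif_genM x aone.
by rewrite pres_dif_one !(amulE ha) addr0.
Qed.

Lemma presented_dgAlg : is_dgAlg P /\ forall x, dif (gn x) = gn (dif x).
Proof.
split; last exact: pres_dif_gen.
have hs : is_dgSpace P.
  apply: (mk_dgSpace (pr := pres_pr)).
  - exact: pres_gr_lin Pcl.
  - exact: pres_gr0 Pcl.
  - move=> p; elim/(pres_lin_ind Pcl): p => //; first exact: lspan0.
    + by move=> c p q; apply: lspan_lin.
    + by move=> n p pn; apply: lspan_gen; exists n.
  - exact: pres_pr_lin.
  - exact: pres_prE.
  - exact: pres_dif_lin.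
  - apply: (pres_gr_ind Pcl (Q := fun n p => gr (n + 1) (dif p)))
      => [n|n c p q pn qn IHp IHq||i n x p xi pn IH].
    + by rewrite (lin0 pres_dif_lin); apply: (pres_gr0 Pcl).
    + by rewrite pres_dif_lin; apply: (pres_gr_lin Pcl).
    + by rewrite pres_dif_one; apply: (pres_gr0 Pcl).
    + rewrite (pres_dif_genMh _ xi) [X in gr _ X]addrC; apply: (pres_gr_lin Pcl).
        by rewrite -addrA; apply: (pres_gr_genM Pcl).
      by rewrite addrAC; apply: (pres_gr_genM Pcl) => //; apply: gr_dif.
  - apply: (pres_gr_ind Pcl (Q := fun n p => dif (dif p) = 0))
      => [n|n c p q pn qn IHp IHq||i n x p xi pn IH].
    + by rewrite !(lin0 pres_dif_lin).
    + by rewrite !pres_dif_lin IHp IHq scaler0 addr0.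
    + by rewrite pres_dif_one (lin0 pres_dif_lin).
    (* The two mixed terms carry the signs of the degrees i and i + 1 and cancel. *)
    + rewrite (pres_dif_genMh _ xi) addrC pres_dif_lin (pres_dif_genMh _ xi).
      rewrite (pres_dif_genMh _ (gr_dif HV xi)) IH (dif_dif HV) (lin0 (gen_lin Pcl)).
      by rewrite !(amulE ha); lmod k P.
split=> //; [by case: ha|by case: ha| |].
  by split; [apply: (pres_gr_one Pcl)|apply: (pres_gr_mul Pcl)].
move=> n p q; move: n p; apply: (pres_gr_ind Pcl (Q := fun n p =>
  dif (p ** q) = dif p ** q + ksgn k 1 n *: (p ** dif q)))
  => [n|n c p p' _ _ E E'||i n x p xi pn IH].
- by rewrite (lin0 pres_dif_lin) !(amulE ha) (lin0 pres_dif_lin); lmod k P.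
- by rewrite pres_dif_lin !(amulE ha) pres_dif_lin E E'; lmod k P.
- by rewrite pres_dif_one !(amulE ha); lmod k P.
- rewrite -(amulA ha) !(pres_dif_genMh _ xi) IH !(amulE ha); lmod k P.
Qed.

End PresentedDgAlgebra.

(** * Maps out of a presented algebra *)

Section PresentedEq.
Variables (k : fieldType) (V : dgSpace k) (rel : freealg V -> freealg V -> Prop).
Variables (P : dgAlg k) (cl : freealg V -> P) (gn : V -> P).
Hypotheses (Pcl : presents rel cl gn) (HV : is_dgSpace V).


(** Only left multiplication by a generator enters, so this serves for algebra maps, derivations and
    maps twisted by a differential. *)
Lemma pres_eq (W : lmodType k) (f g : P -> W) : linear f -> linear g ->
  f aone = g aone ->
  (forall i n x p, gr i x -> gr n p -> f p = g p -> f (gn x ** p) = g (gn x ** p)) ->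
  f =1 g.
Proof.
move=> fl gl E1 EM; apply: (pres_lin_ind Pcl) => //.
- by rewrite !lin0.
- by move=> c p q Ep Eq; rewrite fl gl Ep Eq.
- apply: (pres_gr_ind Pcl (Q := fun _ p => f p = g p))
    => [_|_ c p q _ _ Ep Eq||i n x p xi pn IH] //.
  + by rewrite !lin0.
  + by rewrite fl gl Ep Eq.
  + exact: EM xi pn IH.
Qed.

Section Hom.
Variables (B : dgAlg k) (f : V -> B).
Hypotheses (hb : is_alg B) (fl : linear f).

Definition homT (x : V) (b : B) : B := f x ** b.

Lemma homT_bilin : bilin homT.
Proof.
split=> [b|x]; last exact: amulLr.
by apply: (@lin_comp _ _ _ _ (fun a => a ** b)) fl; apply: amulLl.
Qed.

(** Left multiplications commute with right ones: the action on b is determined by that on 1, and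
    the relations need only be checked on 1. *)
Lemma homT_act u b : act homT u b = act homT u aone ** b.
Proof.
apply: (malg_lin_eq (act_linl homT b) (_ : linear (fun u => act homT u aone ** b))) => [|w].
  by apply: (@lin_comp _ _ _ _ (fun a => a ** b)) (act_linl _ _); apply: amulLl.
rewrite !actU; elim: (w : seq V) => [|x s IH]; first by rewrite (amul1l hb).
by rewrite -[LHS]/(f x ** wact homT s b) IH (amulA hb).
Qed.

Hypothesis f_rel : forall l r, rel l r -> act homT l aone = act homT r aone.

Lemma homT_rel l r : rel l r -> forall b, act homT l b = act homT r b.
Proof. by move=> lr b; rewrite homT_act (f_rel lr) -homT_act. Qed.

Definition phom (p : P) : B := pact Pcl homT p aone.

Lemma phom_lin : linear phom.
Proof. exact: (pact_bilin Pcl homT_bilin homT_rel).1. Qed.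

Lemma phom_gen x : phom (gn x) = f x.
Proof. by rewrite /phom (pact_gen Pcl homT_bilin homT_rel) /homT (amul1r hb). Qed.

Lemma phom_one : phom aone = aone.
Proof. exact: (pact_one Pcl homT_bilin homT_rel). Qed.

Lemma phom_mul p q : phom (p ** q) = phom p ** phom q.
Proof. by rewrite /phom (pact_mul Pcl homT_bilin homT_rel) {1}/pact homT_act. Qed.

Hypothesis f_gr : forall n x, gr n x -> gr n (f x).
Hypothesis HB : is_dgAlg B.

Lemma phom_gr n p : gr n p -> gr n (phom p).
Proof.
move: n p; apply: (pres_gr_ind Pcl (Q := fun n p => gr n (phom p)))
  => [n|n c p q _ _||i n x p xi _ IH].
- by rewrite (lin0 phom_lin); apply: gr0 (dgAlg_space HB) _.
- by rewrite phom_lin; apply: (gr_lin (dgAlg_space HB)).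
- by rewrite phom_one; apply: gr_one.
- by rewrite phom_mul phom_gen; apply: (gr_mul HB) => //; apply: f_gr.
Qed.

Hypothesis HP : is_dgAlg P.
Hypothesis P_gen : forall x, dif (gn x) = gn (dif x).
Hypothesis f_dif : forall x, f (dif x) = dif (f x).

Lemma phom_dif p : phom (dif p) = dif (phom p).
Proof.
have dP := dif_lin (dgAlg_space HP); have dB := dif_lin (dgAlg_space HB).
apply: (pres_eq (lin_comp phom_lin dP) (lin_comp dB phom_lin)) => [|i n x q xi qn IH].
  by rewrite phom_one (dif_one HP) (lin0 phom_lin) (dif_one HB).
rewrite (dif_mul HP _ (pres_gr_gen Pcl xi)) P_gen (linD phom_lin) (linZ phom_lin).
by rewrite !phom_mul !phom_gen IH f_dif (dif_mul HB _ (f_gr xi)).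
Qed.

End Hom.
End PresentedEq.

(** * The graded symmetric algebra and its Poisson bracket *)

Section LieLaws.
Variables (k : fieldType) (L : dgLie k).
Hypothesis HL : is_dgLie L.

Lemma dgLie_space : is_dgSpace L. Proof. by case: HL. Qed.
Lemma br_bilin : bilin (@br k L). Proof. by case: HL => _ []. Qed.
Lemma gr_br i j (a b : L) : gr i a -> gr j b -> gr (i + j) (br a b).
Proof. by case: HL => _ [_ H] _ _ _; apply: H. Qed.
Lemma br_anti i j (a b : L) : gr i a -> gr j b -> br a b = - (ksgn k i j *: br b a).
Proof. by case: HL => _ _ H _ _; apply: H. Qed.
Lemma br_jacobi i j l (a b c : L) : gr i a -> gr j b -> gr l c ->
  br a (br b c) = br (br a b) c + ksgn k i j *: br b (br a c).
Proof. by case: HL => _ _ _ H _; apply: H. Qed.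
Lemma dif_br i (a b : L) : gr i a ->
  dif (br a b) = br (dif a) b + ksgn k 1 i *: br a (dif b).
Proof. by case: HL => _ _ _ _ H; apply: H. Qed.

Lemma brDl a b c : br (a + b) c = br a c + br b c :> L.
Proof. exact: linD (br_bilin.1 c) _ _. Qed.
Lemma brDr a b c : br a (b + c) = br a b + br a c :> L.
Proof. exact: linD (br_bilin.2 a) _ _. Qed.
Lemma brZl x a b : br (x *: a) b = x *: br a b :> L.
Proof. exact: linZ (br_bilin.1 b) _ _. Qed.
Lemma brZr x a b : br a (x *: b) = x *: br a b :> L.
Proof. exact: linZ (br_bilin.2 a) _ _. Qed.
Lemma brNl a b : br (- a) b = - br a b :> L.
Proof. exact: linN (br_bilin.1 b) _. Qed.
Lemma brNr a b : br a (- b) = - br a b :> L.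
Proof. exact: linN (br_bilin.2 a) _. Qed.
Definition brE := (brDl, brDr, brZl, brZr, brNl, brNr).

End LieLaws.

Section PresentedCommutation.
Variables (k : fieldType) (V : dgSpace k) (rel : freealg V -> freealg V -> Prop).
Variables (P : dgAlg k) (cl : freealg V -> P) (gn : V -> P).
Hypotheses (Pcl : presents rel cl gn).
Variables (X : dgAlg k) (hx : is_alg X) (phi : P -> X).
Hypotheses (phi_lin : linear phi) (phi1 : phi aone = aone)
  (phiM : forall p q, phi (p ** q) = phi p ** phi q).

(** Commuting with b up to sign is stable under products. The map phi is there to apply this to the
    image of P in another algebra. *)
Lemma pres_comm_ind j (b : X) :
  (forall i x, gr i x -> phi (gn x) ** b = ksgn k i j *: (b ** phi (gn x))) ->
  forall n p, gr n p -> phi p ** b = ksgn k n j *: (b ** phi p).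
Proof.
move=> H; apply: (pres_gr_ind Pcl (Q := fun n p =>
  phi p ** b = ksgn k n j *: (b ** phi p))) => [n|n c p q _ _ Ep Eq||i n x p xi pn IH].
- by rewrite (lin0 phi_lin) !(amulE hx) scaler0.
- by rewrite phi_lin !(amulE hx) Ep Eq; lmod k X.
- by rewrite phi1 !(amulE hx); lmod k X.
- by rewrite phiM -(amulA hx) IH !(amulE hx) (H _ _ xi) !(amulE hx); lmod k X.
Qed.

End PresentedCommutation.

Section SymTheory.
Variables (k : fieldType) (L : dgLie k).
Hypothesis HV : is_dgSpace L.
Variables (S : dgAlg k) (cl : freealg L -> S) (gn : L -> S).
Hypothesis Scl : presents (@sym_rel k L) cl gn.

Let hs : is_alg S := ps_alg Scl.

Lemma sym_gen_comm i j x y : gr i x -> gr j y ->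
  gn x ** gn y = ksgn k i j *: (gn y ** gn x).
Proof.
move=> xi yj.
refine (ps_rel2 Scl (sym_comm xi yj) (cl_M2 Scl _ _) (cl_Z2 Scl _ _ _)).
Qed.

Lemma sym_dg : is_dgAlg S /\ forall x, dif (gn x) = gn (dif x).
Proof.
apply: (presented_dgAlg Scl HV) => [l r|l r].
  case=> i j x y xi yj; exists (i + j); split.
    by apply: hspan_mul; apply: hspan_var.
  by apply: hspanZ; rewrite addrC; apply: hspan_mul; apply: hspan_var.
case=> i j x y xi yj; have dT := difT_bilin Scl HV.
apply: (eq_by (congr1 fst (act_M2 dT _ _ _)) (congr1 fst (act_Z2 dT _ _ _ _))).
rewrite /difT /= !(amulE hs).
rewrite !(sgvE HV xi, sgvE HV yj) !(linZ (gen_lin Scl)) !(amulE hs).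
rewrite (sym_gen_comm (gr_dif HV xi) yj) (sym_gen_comm xi (gr_dif HV yj)).
by lmod k S.
Qed.

Lemma sym_dgAlg : is_dgAlg S. Proof. by case: sym_dg. Qed.
Lemma sym_dif_gen x : dif (gn x) = gn (dif x). Proof. by case: sym_dg. Qed.

Let Hs := sym_dgAlg.
Let HsV := dgAlg_space Hs.

(** Commutation spreads from generators in each factor separately: to p for fixed q, and to q for a
    fixed generator. *)
Lemma sym_mulC i j (p q : S) : gr i p -> gr j q -> p ** q = ksgn k i j *: (q ** p).
Proof.
move=> pi qj; apply: (pres_comm_ind Scl hs (phi := id)) pi => // {}i x xi /=.
have := pres_comm_ind Scl hs (phi := id) (@lin_id _ _) erefl (fun _ _ => erefl).
move=> /(_ i (gn x)) H; rewrite (H _ _ _ qj) => [|l y yl]; first by lmod k S.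
exact: sym_gen_comm.
Qed.

(** * Derivations of the symmetric algebra *)

Section Kahler.
Variables (N : lmodType k) (a : S -> N -> N).

Definition is_action :=
  [/\ bilin a, forall p q n, a (p ** q) n = a p (a q n) & forall n, a aone n = n].

(* A derivation of the graded commutative algebra S into the left module N,
   made a bimodule by the Koszul sign rule. *)
Definition kahler (D : S -> N) := linear D /\
  forall i j p q, gr i p -> gr j q ->
    D (p ** q) = a p (D q) + ksgn k i j *: a q (D p).

Hypothesis Ha : is_action.

Lemma act_bilin : bilin a. Proof. by case: Ha. Qed.
Lemma act_mul p q n : a (p ** q) n = a p (a q n). Proof. by case: Ha. Qed.
Lemma act_one n : a aone n = n. Proof. by case: Ha. Qed.
Lemma act_Dr p m n : a p (m + n) = a p m + a p n.
Proof. exact: linD (act_bilin.2 p) _ _. Qed.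
Lemma act_Zr p c n : a p (c *: n) = c *: a p n.
Proof. exact: linZ (act_bilin.2 p) _ _. Qed.
Lemma act_Zl p c n : a (c *: p) n = c *: a p n.
Proof. exact: linZ (act_bilin.1 n) _ _. Qed.

Lemma act_comm i j p q n : gr i p -> gr j q ->
  a p (a q n) = ksgn k i j *: a q (a p n).
Proof. by move=> pi qj; rewrite -!act_mul (sym_mulC pi qj) act_Zl. Qed.

Lemma kahler_one D : kahler D -> D aone = 0.
Proof.
case=> _ /(_ _ _ _ _ (gr_one Hs) (gr_one Hs)).
rewrite (amul1l hs) !act_one ksgnE oddz0 expr0 scale1r => /esym/eqP.
by rewrite -subr_eq0 addrK => /eqP.
Qed.

Lemma kahler_eq D E : kahler D -> kahler E ->
  (forall i x, gr i x -> D (gn x) = E (gn x)) -> D =1 E.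
Proof.
move=> KD KE DE; apply: (pres_eq Scl HV KD.1 KE.1).
  by rewrite !kahler_one.
move=> i n x p xi pn IH; have xi' := pres_gr_gen Scl xi.
by rewrite (KD.2 _ _ _ _ xi' pn) (KE.2 _ _ _ _ xi' pn) IH (DE _ _ xi).
Qed.

Lemma kahler_comb c D E : kahler D -> kahler E -> kahler (fun p => c *: D p + E p).
Proof.
move=> [lD KD] [lE KE]; split.
  by apply: lin_add => //; apply: lin_scale.
move=> i j p q pi qj; rewrite (KD _ _ _ _ pi qj) (KE _ _ _ _ pi qj).
by rewrite !(act_Dr, act_Zr); lmod k N.
Qed.

Section Existence.
Variable beta : L -> N.
Hypothesis beta_lin : linear beta.

Definition kahP (x : L) (v : S) : N := a v (beta x).

Lemma kahP_bilin : bilin kahP.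
Proof.
by split=> [v|x]; [apply: lin_comp (act_bilin.2 v) beta_lin|apply: act_bilin.1].
Qed.

(** Left multiplication by (beta x, x) in the square-zero extension of S by N, where beta x counts
    as having the degree of x. A derivation D amounts to the algebra map p |-> (D p, p) into this
    extension. *)
Definition kahT (x : L) (m : N * S) : N * S :=
  (a (gn x) m.1 + koszul kahP x m.2, gn x ** m.2).

Lemma kahT_bilin : bilin kahT.
Proof.
have [kl kr] := koszul_bilin HV HsV kahP_bilin.
split=> [m c x y|x c m m']; congr pair => /=.
- by rewrite (gen_lin Scl) act_bilin.1 kl; lmod k N.
- by rewrite (gen_lin Scl) !(amulE hs).
- by rewrite act_bilin.2 kr; lmod k N.
- by rewrite !(amulE hs).
Qed.

Lemma kahT_rel l r : sym_rel l r -> forall m, act kahT l m = act kahT r m.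
Proof.
case=> i j x y xi yj [n v].
apply: (eq_by (act_M2 kahT_bilin _ _ _) (act_Z2 kahT_bilin _ _ _ _)).
rewrite /kahT /=.
have [kl kr] := koszul_bilin HV HsV kahP_bilin.
pose kz := koszul kahP.
pose f v := (a (gn x) (a (gn y) n + kz y v) + kz x (gn y ** v),
  gn x ** (gn y ** v)).
pose g v := ksgn k i j *: (a (gn y) (a (gn x) n + kz x v) + kz y (gn x ** v),
  gn y ** (gn x ** v)).
(* With n fixed, f and g are affine in v. Subtracting their values at 0 makes them linear, so that
   homogeneous v suffice; the values at 0 agree because 0 is itself homogeneous. *)
pose f0 v := f v - f 0; pose g0 v := g v - g 0.
have gx := pres_gr_gen Scl xi; have gy := pres_gr_gen Scl yj.
have K x' i' : gr i' x' -> forall l' v', gr l' v' ->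
    koszul kahP x' v' = ksgn k i' l' *: a v' (beta x').
  by move=> xi' l' v' vl'; rewrite (koszulE HV HsV kahP_bilin xi' vl').
have key l' w : gr l' w -> f w = g w.
  move=> wl; rewrite /f /g /kz; congr pair => /=.
    rewrite (K _ _ xi _ _ wl) (K _ _ yj _ _ wl).
    rewrite (K _ _ xi _ _ (gr_mul Hs gy wl)) (K _ _ yj _ _ (gr_mul Hs gx wl)).
    rewrite !(act_Dr, act_Zr) !act_mul (act_comm n gx gy).
    by lmod k N.
  by rewrite !(amulA hs) (sym_gen_comm xi yj) !(amulE hs).
rewrite -[LHS]/(f v) -[RHS]/(g v).
have E0 : f 0 = g 0 by apply: (key 0); apply: gr0 HsV _.
have fl : linear f0.
  move=> c w w'; rewrite /f0 /f /kz; congr pair => /=.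
    by rewrite !(amulE hs) !kr !(act_Dr, act_Zr) !(lin0 (kr _)) !(lin0 (act_bilin.2 _)); lmod k N.
  by rewrite !(amulE hs); lmod k S.
have gl : linear g0.
  move=> c w w'; rewrite /g0 /g /kz; congr pair => /=.
    by rewrite !(amulE hs) !kr !(act_Dr, act_Zr) !(lin0 (kr _)) !(lin0 (act_bilin.2 _)); lmod k N.
  by rewrite !(amulE hs); lmod k S.
suff : f0 v = g0 v by rewrite /f0 /g0 E0 => /addIr.
by apply: (gr_lin_eq HsV fl gl) => l' w wl; rewrite /f0 /g0 E0 (key _ _ wl).
Qed.

Definition kah (p : S) : N := (pact Scl kahT p (0, aone)).1.

Let pb := pact_bilin Scl kahT_bilin kahT_rel.

Lemma kah_lin : linear kah.
Proof. by move=> c p q; rewrite /kah pb.1. Qed.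

Lemma pact_kah2 p : (pact Scl kahT p (0, aone)).2 = p.
Proof.
apply: (pres_eq Scl HV (f := fun p => (pact Scl kahT p (0, aone)).2)) => //.
- by move=> c q r; rewrite pb.1.
- by rewrite (pact_one Scl kahT_bilin kahT_rel).
- move=> i n x q xi qn E.
  by rewrite (pact_mul Scl kahT_bilin kahT_rel) (pact_gen Scl kahT_bilin kahT_rel) /= E.
Qed.

Lemma kah_one : kah aone = 0.
Proof. by rewrite /kah (pact_one Scl kahT_bilin kahT_rel). Qed.

Lemma kah_genM i j x p : gr i x -> gr j p ->
  kah (gn x ** p) = a (gn x) (kah p) + ksgn k i j *: a p (beta x).
Proof.
move=> xi pj; rewrite /kah (pact_mul Scl kahT_bilin kahT_rel).
rewrite (pact_gen Scl kahT_bilin kahT_rel) /= pact_kah2.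
by rewrite (koszulE HV HsV kahP_bilin xi pj).
Qed.

Lemma kah_gen_gr i x : gr i x -> kah (gn x) = beta x.
Proof.
move=> xi; have := kah_genM xi (gr_one Hs).
by rewrite (amul1r hs) kah_one (lin0 (act_bilin.2 _)) act_one => ->; lmod k N.
Qed.

Lemma kah_gen x : kah (gn x) = beta x.
Proof.
by apply: (gr_lin_eq HV (lin_comp kah_lin (gen_lin Scl)) beta_lin) => i y /kah_gen_gr.
Qed.

Lemma kah_kahler : kahler kah.
Proof.
split; first exact: kah_lin.
move=> i j p q + qj; move: i p.
apply: (pres_gr_ind Scl (Q := fun i p =>
  kah (p ** q) = a p (kah q) + ksgn k i j *: a q (kah p)))
  => [n|n c p p' _ _ Ep Ep'||i n x p xi pn IH].
- by rewrite (amul0l hs) (lin0 kah_lin) (lin0 (act_bilin.2 _)) (lin0 (act_bilin.1 _));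
    lmod k N.
- rewrite !(amulE hs) !kah_lin Ep Ep' act_bilin.1 act_bilin.2.
  by lmod k N.
- by rewrite (amul1l hs) kah_one act_one (lin0 (act_bilin.2 _)); lmod k N.
- have gx := pres_gr_gen Scl xi.
  rewrite -(amulA hs) (kah_genM xi (gr_mul Hs pn qj)) IH (kah_genM xi pn).
  rewrite !(act_Dr, act_Zr) !act_mul.
  rewrite (act_comm (kah p) qj gx) (act_comm (beta x) qj pn).
  by lmod k N.
Qed.

End Existence.

(** Both sides are derivations with the same values on generators. This makes the Poisson bracket
    linear in the argument that is not being extended. *)
Lemma kah_linb c (beta beta' gamma : L -> N) : linear beta -> linear beta' ->
  linear gamma -> (forall x, gamma x = c *: beta x + beta' x) ->
  forall p, kah gamma p = c *: kah beta p + kah beta' p.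
Proof.
move=> bl bl' gl E; apply: kahler_eq => [||i x xi].
- exact: kah_kahler.
- by apply: kahler_comb; apply: kah_kahler.
- by rewrite !kah_gen.
Qed.

End Kahler.
End SymTheory.

(** * The Poisson bracket of the symmetric algebra *)

Section SymBracket.
Variables (k : fieldType) (L : dgLie k).
Hypothesis HL : is_dgLie L.
Variables (S : dgAlg k) (cl : freealg L -> S) (gn : L -> S).
Hypothesis Scl : presents (@sym_rel k L) cl gn.

Let HV := dgLie_space HL.
Let hs : is_alg S := ps_alg Scl.
Let Hs : is_dgAlg S := sym_dgAlg HV Scl.
Let HsV := dgAlg_space Hs.
Let gl := gen_lin Scl.
Let gg i x (xi : gr i x) : gr i (gn x) := pres_gr_gen Scl xi.

Lemma amul_action : is_action (@amul k S).
Proof. by split; [exact: amul_bilin|move=> p q n; rewrite (amulA hs)|exact: amul1l]. Qed.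

Let Ha := amul_action.

(* {p, x} for x in L; the bracket {p, q} is the derivation in p that extends
   x |-> {x, q} = - (-1)^(|x||q|) {q, x}. *)
Definition sym_brL (p : S) (x : L) : S :=
  kah Scl (@amul k S) (fun y => gn (br y x)) p.

Definition sym_br_gen (q : S) (x : L) : S :=
  - koszul (fun x q => sym_brL q x) x q.

Definition sym_br (p q : S) : S := kah Scl (@amul k S) (sym_br_gen q) p.

Let brx_lin x : linear (fun y => gn (br y x)).
Proof. by apply: lin_comp gl _; case: (br_bilin HL). Qed.

Lemma sym_brL_kahler x : kahler (@amul k S) (sym_brL^~ x).
Proof. exact: kah_kahler. Qed.

Lemma sym_brL_gen x y : sym_brL (gn x) y = gn (br x y).
Proof. exact: (kah_gen HV Scl Ha (brx_lin y)). Qed.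

Lemma sym_brL_bilin : bilin sym_brL.
Proof.
split=> [x|p c x y]; first by case: (sym_brL_kahler x).
apply: (kah_linb HV Scl Ha (brx_lin x) (brx_lin y) (brx_lin (c *: x + y))) => z.
by rewrite (br_bilin HL).2 gl.
Qed.

Let brLC_bilin : bilin (fun x q => sym_brL q x).
Proof. by case: sym_brL_bilin => l r; split. Qed.

Lemma sym_br_gen_lin q : linear (sym_br_gen q).
Proof. by apply: lin_opp; case: (koszul_bilin HV HsV brLC_bilin). Qed.

Lemma sym_br_genE i j q x : gr i x -> gr j q ->
  sym_br_gen q x = - (ksgn k i j *: sym_brL q x).
Proof. by move=> xi qj; rewrite /sym_br_gen (koszulE HV HsV brLC_bilin xi qj). Qed.

Lemma sym_br_kahler q : kahler (@amul k S) (sym_br^~ q).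
Proof. by apply: kah_kahler => //; apply: sym_br_gen_lin. Qed.

Lemma sym_br_genL x q : sym_br (gn x) q = sym_br_gen q x.
Proof. exact: (kah_gen HV Scl Ha (sym_br_gen_lin q)). Qed.

Lemma sym_br_bilin : bilin sym_br.
Proof.
split=> [q|p c q r]; first by case: (sym_br_kahler q).
apply: (kah_linb HV Scl Ha (sym_br_gen_lin q) (sym_br_gen_lin r)
  (sym_br_gen_lin (c *: q + r))) => x.
rewrite /sym_br_gen (koszul_bilin HV HsV brLC_bilin).2.
by lmod k S.
Qed.

Lemma sym_brMl i j p q r : gr i p -> gr j q ->
  sym_br (p ** q) r = p ** sym_br q r + ksgn k i j *: (q ** sym_br p r).
Proof. by case: (sym_br_kahler r) => _; apply. Qed.

(** The two extension steps are compatible: both sides are derivations in p, and on generators they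
    agree by antisymmetry of the bracket of L. *)
Lemma sym_br_genR p x : sym_br p (gn x) = sym_brL p x.
Proof.
have El : linear (fun x => sym_br p (gn x)) by apply: lin_comp (sym_br_bilin.2 p) gl.
apply: (gr_lin_eq HV El (sym_brL_bilin.2 p)) => i {El}{}x xi.
apply: (kahler_eq HV Scl Ha (sym_br_kahler _) (sym_brL_kahler x)) => j y yj.
rewrite sym_br_genL (sym_br_genE yj (gg xi)) !sym_brL_gen (br_anti HL yj xi).
by rewrite (linN gl) (linZ gl).
Qed.

Lemma sym_br_gens x y : sym_br (gn x) (gn y) = gn (br x y).
Proof. by rewrite sym_br_genR sym_brL_gen. Qed.

Lemma sym_br_anti_gen i j x q : gr i x -> gr j q ->
  sym_br (gn x) q = - (ksgn k i j *: sym_br q (gn x)).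
Proof. by move=> xi qj; rewrite sym_br_genL (sym_br_genE xi qj) sym_br_genR. Qed.

Lemma sym_br0l q : sym_br 0 q = 0. Proof. exact: bilin0l sym_br_bilin. Qed.
Lemma sym_br0r p : sym_br p 0 = 0. Proof. exact: bilin0r sym_br_bilin. Qed.
Lemma sym_br1l q : sym_br aone q = 0.
Proof. exact: (kahler_one HV Scl Ha (sym_br_kahler q)). Qed.
Lemma sym_brDl p q r : sym_br (p + q) r = sym_br p r + sym_br q r.
Proof. exact: linD (sym_br_bilin.1 r) _ _. Qed.
Lemma sym_brDr p q r : sym_br p (q + r) = sym_br p q + sym_br p r.
Proof. exact: linD (sym_br_bilin.2 p) _ _. Qed.
Lemma sym_brZl c p q : sym_br (c *: p) q = c *: sym_br p q.
Proof. exact: linZ (sym_br_bilin.1 q) _ _. Qed.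
Lemma sym_brZr c p q : sym_br p (c *: q) = c *: sym_br p q.
Proof. exact: linZ (sym_br_bilin.2 p) _ _. Qed.
Lemma sym_brNl p q : sym_br (- p) q = - sym_br p q.
Proof. exact: linN (sym_br_bilin.1 q) _. Qed.
Lemma sym_brNr p q : sym_br p (- q) = - sym_br p q.
Proof. exact: linN (sym_br_bilin.2 p) _. Qed.
Definition sym_brE := (sym_brDl, sym_brDr, sym_brZl, sym_brZr, sym_brNl,
  sym_brNr, sym_br0l, sym_br0r, sym_br1l).

Lemma sym_br1r p : sym_br p aone = 0.
Proof.
have K0 : kahler (@amul k S) (fun=> 0).
  by split=> [|*]; [exact: lin_cst0|rewrite !(amulE hs); lmod k S].
apply: (kahler_eq HV Scl Ha (sym_br_kahler _) K0) => i x xi.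
by rewrite (sym_br_anti_gen xi (gr_one Hs)) sym_br1l scaler0 oppr0.
Qed.

Lemma kahler_gr D d : kahler (@amul k S) D ->
  (forall i x, gr i x -> gr (i + d) (D (gn x))) ->
  forall n p, gr n p -> gr (n + d) (D p).
Proof.
move=> KD Dg; apply: (pres_gr_ind Scl (Q := fun n p => gr (n + d) (D p)))
   => [n|n c p q _ _ Ep Eq||i n y p yi pn IH].
- by rewrite (lin0 KD.1); apply: (gr0 HsV).
- by rewrite KD.1; apply: (gr_lin HsV).
- by rewrite (kahler_one HV Scl Ha KD); apply: (gr0 HsV).
- rewrite (KD.2 _ _ _ _ (gg yi) pn); apply: (grD HsV).
    by rewrite -addrA; apply: gr_mul => //; apply: gg.
  apply: (grZ HsV); rewrite (addrC i n) -addrA.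
  by apply: gr_mul => //; apply: Dg.
Qed.

Lemma sym_br_gr i j p q : gr i p -> gr j q -> gr (i + j) (sym_br p q).
Proof.
have gL l x : gr l x -> forall n r, gr n r -> gr (n + l) (sym_brL r x).
  move=> xl; apply: kahler_gr (sym_brL_kahler x) _ => n y yn.
  by rewrite sym_brL_gen; apply: gg; apply: gr_br.
move=> pi qj; apply: (kahler_gr (sym_br_kahler q) _ pi) => l x xl.
rewrite sym_br_genL (sym_br_genE xl qj); apply/(grN HsV)/(grZ HsV).
by rewrite addrC; apply: gL.
Qed.

(** For a generator p the construction builds in antisymmetry, which turns the claim into the
    Leibniz rule in the first argument; that rule also carries the claim to products in p.
    Antisymmetry in general comes afterwards and rests on this. *)
Lemma sym_brMr i j l p q r : gr i p -> gr j q -> gr l r ->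
  sym_br p (q ** r) = sym_br p q ** r + ksgn k i j *: (q ** sym_br p r).
Proof.
move=> + qj rl; have gen m x : gr m x ->
    sym_br (gn x) (q ** r) = sym_br (gn x) q ** r
      + ksgn k m j *: (q ** sym_br (gn x) r).
  move=> xm; rewrite (sym_br_anti_gen xm (gr_mul Hs qj rl)) (sym_brMl _ qj rl).
  rewrite (sym_br_anti_gen xm qj) (sym_br_anti_gen xm rl) !(amulE hs).
  rewrite (sym_mulC Scl rl (sym_br_gr qj (gg xm))).
  by lmod k S.
move: i p; apply: (pres_gr_ind Scl (Q := fun i p =>
  sym_br p (q ** r) = sym_br p q ** r + ksgn k i j *: (q ** sym_br p r)))
   => [n|n c p p' _ _ Ep Eq||i n y p yi pn IH].
- by rewrite !sym_brE !(amulE hs); lmod k S.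
- by rewrite !sym_brE Ep Eq !(amulE hs); lmod k S.
- by rewrite !sym_brE !(amulE hs); lmod k S.
- have gy := gg yi.
  rewrite !(sym_brMl _ gy pn) IH (gen _ _ yi) !(amulE hs).
  rewrite (sym_mulC Scl qj gy) (sym_mulC Scl qj pn) !(amulE hs).
  by lmod k S.
Qed.

Lemma sym_br_anti i j p q : gr i p -> gr j q ->
  sym_br p q = - (ksgn k i j *: sym_br q p).
Proof.
move=> + qj; move: i p; apply: (pres_gr_ind Scl (Q := fun i p =>
  sym_br p q = - (ksgn k i j *: sym_br q p))) => [n|n c p p' _ _ Ep Eq||i n y p yi pn IH].
- by rewrite !sym_brE; lmod k S.
- by rewrite !sym_brE Ep Eq; lmod k S.
- by rewrite sym_br1r sym_br1l; lmod k S.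
- have gy := gg yi.
  rewrite (sym_brMl _ gy pn) (sym_brMr qj gy pn) IH (sym_br_anti_gen yi qj).
  rewrite !(amulE hs) (sym_mulC Scl pn (sym_br_gr qj gy)).
  by lmod k S.
Qed.

Definition sym_jacobi (p q r : S) i j :=
  sym_br p (sym_br q r) =
  sym_br (sym_br p q) r + ksgn k i j *: sym_br q (sym_br p r).

Lemma sym_jacobi_swapr i j l p q r : gr i p -> gr j q -> gr l r ->
  sym_jacobi p q r i j -> sym_jacobi p r q i l.
Proof.
move=> pi qj rl; rewrite /sym_jacobi => J.
rewrite (sym_br_anti rl qj) !sym_brE J.
rewrite (sym_br_anti (sym_br_gr pi qj) rl) (sym_br_anti qj (sym_br_gr pi rl)).
by lmod k S.
Qed.

Lemma sym_jacobi_swapl i j l p q r : gr i p -> gr j q -> gr l r ->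
  sym_jacobi p q r i j -> sym_jacobi q p r j i.
Proof.
move=> pi qj rl; rewrite /sym_jacobi => J.
by rewrite J (sym_br_anti qj pi) !sym_brE; lmod k S.
Qed.

(** The defect of the Jacobi identity is a derivation in its last argument, hence vanishes once it
    does so on generators. *)
Lemma sym_jacobi_ind i j p q : gr i p -> gr j q ->
  (forall l x, gr l x -> sym_jacobi p q (gn x) i j) ->
  forall l r, gr l r -> sym_jacobi p q r i j.
Proof.
move=> pi qj J; apply: (pres_gr_ind Scl (Q := fun l r => sym_jacobi p q r i j))
   => [n|n c r r' _ _ Ep Eq||l n y r yi pn IH]; rewrite /sym_jacobi.
- by rewrite !sym_brE; lmod k S.
- by rewrite !sym_brE Ep Eq; lmod k S.
- by rewrite !sym_br1r !sym_brE; lmod k S.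
- have gy := gg yi; have := J _ _ yi; rewrite /sym_jacobi => Jy.
  rewrite !(sym_brMr pi gy pn, sym_brMr qj gy pn) !sym_brE.
  rewrite (sym_brMr pi (sym_br_gr qj gy) pn) (sym_brMr pi gy (sym_br_gr qj pn)).
  rewrite (sym_brMr (sym_br_gr pi qj) gy pn).
  rewrite (sym_brMr qj (sym_br_gr pi gy) pn) (sym_brMr qj gy (sym_br_gr pi pn)).
  by rewrite IH Jy !(amulE hs); lmod k S.
Qed.

(** Generators are replaced by arbitrary elements in one argument at a time; antisymmetry brings the
    argument in question to the last place, where the induction applies. *)
Lemma sym_br_jacobi i j l p q r : gr i p -> gr j q -> gr l r ->
  sym_jacobi p q r i j.
Proof.
have J1 i1 j1 l1 x y z : gr i1 x -> gr j1 y -> gr l1 z ->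
    sym_jacobi (gn x) (gn y) z i1 j1.
  move=> xi yj; move: l1 z; apply: (sym_jacobi_ind (gg xi) (gg yj)) => l1 z zl.
  rewrite /sym_jacobi !sym_br_gens (br_jacobi HL xi yj zl).
  by rewrite (linD gl) (linZ gl).
have J2 i1 j1 l1 x q1 r1 : gr i1 x -> gr j1 q1 -> gr l1 r1 ->
    sym_jacobi (gn x) q1 r1 i1 j1.
  move=> xi qj1; move: l1 r1; apply: (sym_jacobi_ind (gg xi) qj1) => l1 y yl.
  by apply: (sym_jacobi_swapr (gg xi) (gg yl) qj1); apply: (J1 _ _ j1).
move=> pi qj; move: l r; apply: (sym_jacobi_ind pi qj) => l x xl.
apply: (sym_jacobi_swapr pi (gg xl) qj); apply: (sym_jacobi_swapl (gg xl) pi qj).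
exact: J2 xl pi qj.
Qed.

Definition sym_leibniz (p q : S) i :=
  dif (sym_br p q) = sym_br (dif p) q + ksgn k 1 i *: sym_br p (dif q).

Lemma sym_leibniz_ind i p : gr i p ->
  (forall l x, gr l x -> sym_leibniz p (gn x) i) ->
  forall l r, gr l r -> sym_leibniz p r i.
Proof.
move=> pi J; have dl := dif_lin HsV.
apply: (pres_gr_ind Scl (Q := fun l r => sym_leibniz p r i))
   => [n|n c r r' _ _ Ep Eq||l n y r yi pn IH]; rewrite /sym_leibniz.
- by rewrite (lin0 dl) !sym_brE (lin0 dl); lmod k S.
- by rewrite dl !sym_brE dl Ep Eq; lmod k S.
- by rewrite !sym_br1r (dif_one Hs) (lin0 dl) !sym_brE; lmod k S.
- have gy := gg yi; have := J _ _ yi; rewrite /sym_leibniz => Jy.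
  rewrite (dif_mul Hs _ gy) !sym_brE !(sym_brMr pi gy pn).
  rewrite (sym_brMr pi (gr_dif HsV gy) pn) (sym_brMr pi gy (gr_dif HsV pn)).
  rewrite (sym_brMr (gr_dif HsV pi) gy pn) !(linD dl) !(linZ dl).
  rewrite (dif_mul Hs _ gy) (dif_mul Hs _ (sym_br_gr pi gy)) IH Jy !(amulE hs).
  by lmod k S.
Qed.

Lemma sym_leibniz_swap i j p q : gr i p -> gr j q ->
  sym_leibniz p q i -> sym_leibniz q p j.
Proof.
move=> pi qj; rewrite /sym_leibniz => E; have dl := dif_lin HsV.
rewrite (sym_br_anti qj pi) (linN dl) (linZ dl) E.
rewrite (sym_br_anti pi (gr_dif HsV qj)) (sym_br_anti (gr_dif HsV pi) qj).
by lmod k S.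
Qed.

(** The scheme of the Jacobi identity with two arguments: extend in q for a generator p, exchange
    the two, extend again. *)
Lemma sym_br_dif i j p q : gr i p -> gr j q -> sym_leibniz p q i.
Proof.
have E1 i1 j1 x r : gr i1 x -> gr j1 r -> sym_leibniz (gn x) r i1.
  move=> xi; move: j1 r; apply: (sym_leibniz_ind (gg xi)) => l y yl.
  rewrite /sym_leibniz sym_br_gens !(sym_dif_gen HV Scl) (dif_br HL _ xi).
  by rewrite (linD gl) (linZ gl) !sym_br_gens.
move=> pi; move: j q; apply: (sym_leibniz_ind pi) => l x xl.
by apply: (sym_leibniz_swap (gg xl) pi); apply: E1 pi.
Qed.

Lemma sym_dgPois (b := sym_br) : is_dgPois (@DGPois k S b).
Proof.
split=> [//|i j p q pi qj||i j l p q r pi qj rl]; first exact: (sym_mulC Scl pi qj).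
  split=> //.
  - by split; [exact: sym_br_bilin|exact: sym_br_gr].
  - exact: sym_br_anti.
  - exact: sym_br_jacobi.
  - move=> i p q pi.
    have dl := dif_lin HsV.
    (* The law is required for an arbitrary second argument; linearity reduces it to homogeneous
       ones. *)
    have := @gr_lin_eq _ _ HsV _ (fun q => dif (sym_br p q))
      (fun q => sym_br (dif p) q + ksgn k 1 i *: sym_br p (dif q)).
    apply=> [||j {}q qj].
    + exact: lin_comp dl (sym_br_bilin.2 p).
    + apply: lin_add; first exact: sym_br_bilin.2.
      by apply: lin_scale; apply: lin_comp (sym_br_bilin.2 p) dl.
    + exact: (sym_br_dif pi qj).
exact: (sym_brMr pi qj rl).
Qed.

(** A biderivation is determined by its values on generators. The Leibniz rules force b to vanish
    when one argument is 1 and the other homogeneous, as b p 1 = b p 1 + b p 1. *)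
Lemma sym_br_uniq (b : S -> S -> S) : bilin b ->
  (forall x y, b (gn x) (gn y) = gn (br x y)) ->
  (forall i j l (p q r : S), gr i p -> gr j q -> gr l r ->
    b p (q ** r) = b p q ** r + ksgn k i j *: (q ** b p r)) ->
  (forall i j l (p q r : S), gr i p -> gr j q -> gr l r ->
    b (p ** q) r = p ** b q r + ksgn k j l *: (b p r ** q)) ->
  sym_br = b.
Proof.
move=> bb bg br_ bl; have [bbl bbr] := bb.
have g1 := gr_one Hs.
have b1r p i : gr i p -> b p aone = 0.
  move=> pi; have := br_ _ _ _ _ _ _ pi g1 g1.
  rewrite !(amulE hs) ksgnE oddz0 andbF expr0 scale1r => /esym/eqP.
  by rewrite -subr_eq0 addrK => /eqP.
have b1l p i : gr i p -> b aone p = 0.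
  move=> pi; have := bl _ _ _ _ _ _ g1 g1 pi.
  rewrite !(amulE hs) ksgnE oddz0 expr0 scale1r => /esym/eqP.
  by rewrite -subr_eq0 addrK => /eqP.
apply/funext => p; apply/funext => q; move: p q.
have bx i x : gr i x -> sym_br (gn x) =1 b (gn x).
  move=> xi; apply: (pres_eq Scl HV (sym_br_bilin.2 _) (bbr _)).
    by rewrite sym_br1r (b1r _ _ (gg xi)).
  move=> j n y q yj qn E.
  by rewrite (sym_brMr (gg xi) (gg yj) qn) (br_ _ _ _ _ _ _ (gg xi) (gg yj) qn)
    E sym_br_gens bg.
have bh j q : gr j q -> forall p, sym_br p q = b p q.
  move=> qj; apply: (pres_eq Scl HV (sym_br_bilin.1 q) (bbl q)).
    by rewrite sym_br1l (b1l _ _ qj).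
  move=> i n x p xi pn E; have gx := gg xi.
  rewrite (sym_brMl _ gx pn) (bl _ _ _ _ _ _ gx pn qj) E (bx _ _ xi).
  (* The rule for b has the bracket to the left of p, that for [sym_br] to the right. Exchanging
     them takes the degree of the bracket, known for [sym_br], with which b agrees here. *)
  congr (_ + _); rewrite -(bx _ _ xi) (sym_mulC Scl pn (sym_br_gr gx qj)).
  by lmod k S.
move=> p q; apply: (gr_lin_eq HsV (sym_br_bilin.2 p) (bbr p)) => j {}q qj.
exact: bh qj p.
Qed.

End SymBracket.

(** * Semidirect products and enveloping algebras *)

Section DirectSum.
Variables (k : fieldType) (V W : dgSpace k).
Hypotheses (HV : is_dgSpace V) (HW : is_dgSpace W).

Lemma dsum_dgSpace : is_dgSpace (dsum V W).
Proof.
apply: (@mk_dgSpace _ (dsum V W) (fun n p => (hcomp n p.1, hcomp n p.2))).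
- move=> n c u v [u1 u2] [v1 v2].
  by split; [apply: gr_lin HV _ _ _ _ _ _|apply: gr_lin HW _ _ _ _ _ _].
- by move=> n; split; [apply: gr0 HV _|apply: gr0 HW _].
- move=> [v w]; have -> : ((v, w) : dsum V W) = (v, 0) + (0, w).
    by congr pair; rewrite ?addr0 ?add0r.
  apply: lspan_add.
    have lv : linear (fun v : V => (v, 0) : dsum V W).
      by move=> c x y; congr pair; rewrite /= scaler0 addr0.
    apply: (lspan_img lv) (gr_span HV v) => u [n un].
    by apply: lspan_gen; exists n; split=> //; apply: gr0 HW _.
  have lw : linear (fun w : W => (0, w) : dsum V W).
    by move=> c x y; congr pair; rewrite /= scaler0 addr0.
  apply: (lspan_img lw) (gr_span HW w) => u [n un].
  by apply: lspan_gen; exists n; split=> //; apply: gr0 HV _.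
- by move=> n c u v; congr pair; rewrite /= hcomp_lin.
- move=> n m [v w] [/= vn wn]; rewrite (hcomp_hom HV _ vn) (hcomp_hom HW _ wn).
  by case: eqP.
- by move=> c u v; congr pair; rewrite /= dif_lin.
- by move=> n v [v1 v2]; split; [apply: gr_dif HV _ _ v1|apply: gr_dif HW _ _ v2].
- by move=> n v _; congr pair; rewrite /= dif_dif.
Qed.

End DirectSum.

Section Semidirect.
Variables (k : fieldType) (L : dgLie k).
Hypothesis HL : is_dgLie L.
Let HV := dgLie_space HL.

(* Hence L x| L is L (x) k[eps]/(eps^2). *)
Lemma semidirect_brE (x y : semidirect L) :
  br x y = (br x.2 y.1 + br x.1 y.2 : L, br x.2 y.2 : L).
Proof.
have bC : bilin (fun a b : L => br b a) by case: (br_bilin HL).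
have E : koszul (fun a b : L => br b a) =2 (fun a b => - br a b).
  apply: (bilin_gr_eq HV HV); first by refine (koszul_bilin HV HV bC).
    by split=> a; apply: lin_opp; [apply: (br_bilin HL).1|apply: (br_bilin HL).2].
  move=> i j v w vi wj; rewrite (koszulE HV HV bC vi wj) (br_anti HL vi wj).
  by lmod k L.
by rewrite -[LHS]/(br x.2 y.1 - koszul (fun a b : L => br b a) x.1 y.2, br x.2 y.2) E opprK.
Qed.

Lemma semidirect_dgLie : is_dgLie (semidirect L).
Proof.
split.
- exact: dsum_dgSpace.
- split; first split.
  + move=> y c x x'; rewrite !semidirect_brE; congr pair => /=.
      by rewrite !(brE HL); lmod k L.
    by rewrite !(brE HL).
  + move=> x c y y'; rewrite !semidirect_brE; congr pair => /=.
      by rewrite !(brE HL); lmod k L.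
    by rewrite !(brE HL).
  + move=> i j [a1 a2] [b1 b2] [/= a1i a2i] [/= b1j b2j]; rewrite semidirect_brE.
    split=> /=; last exact: gr_br HL _ _ _ _ a2i b2j.
    by apply: (grD HV); apply: gr_br.
- move=> i j [a1 a2] [b1 b2] [/= a1i a2i] [/= b1j b2j]; rewrite !semidirect_brE.
  congr pair => /=.
    by rewrite (br_anti HL a2i b1j) (br_anti HL a1i b2j); lmod k L.
  exact: br_anti HL _ _ _ _ a2i b2j.
- move=> i j l [a1 a2] [b1 b2] [c1 c2] [/= a1i a2i] [/= b1j b2j] [/= c1l c2l].
  rewrite !semidirect_brE; congr pair => /=.
    rewrite !(brE HL) (br_jacobi HL a2i b2j c1l) (br_jacobi HL a2i b1j c2l).
    by rewrite (br_jacobi HL a1i b2j c2l); lmod k L.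
  exact: br_jacobi HL _ _ _ _ _ _ a2i b2j c2l.
- move=> i [a1 a2] [b1 b2] [/= a1i a2i]; rewrite !semidirect_brE.
  have dl := dif_lin HV.
  congr pair => /=; last exact: dif_br HL _ _ _ a2i.
  by rewrite (linD dl) (dif_br HL _ a1i) (dif_br HL _ a2i); lmod k L.
Qed.

End Semidirect.

Section UeaTheory.
Variables (k : fieldType) (L : dgLie k).
Hypothesis HL : is_dgLie L.
Let HV := dgLie_space HL.
Variables (U : dgAlg k) (cl : freealg L -> U) (gn : L -> U).
Hypothesis Ucl : presents (@uea_rel k L) cl gn.

Let hu : is_alg U := ps_alg Ucl.

Lemma uea_gen_comm i j x y : gr i x -> gr j y ->
  gn x ** gn y - ksgn k i j *: (gn y ** gn x) = gn (br x y).
Proof.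
move=> xi yj.
refine (ps_rel2 Ucl (uea_comm xi yj) (cl_MNZ Ucl _ _ _ _ _) (ps_gen Ucl _)).
Qed.

Lemma uea_dg : is_dgAlg U /\ forall x, dif (gn x) = gn (dif x).
Proof.
apply: (presented_dgAlg Ucl HV) => [l r|l r].
  case=> i j x y xi yj; exists (i + j); split.
    apply: hspanD; first by apply: hspan_mul; apply: hspan_var.
    by apply/hspanN/hspanZ; rewrite addrC; apply: hspan_mul; apply: hspan_var.
  exact/hspan_var/gr_br.
case=> i j x y xi yj; have dT := difT_bilin Ucl HV.
apply: (eq_by (congr1 fst (act_MNZ dT _ _ _ _ _ _)) (congr1 fst (act_var _ _ _))).
rewrite /difT /= !(amulE hu) (dif_br HL _ xi) (linD (gen_lin Ucl)) (linZ (gen_lin Ucl)).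
rewrite -(uea_gen_comm (gr_dif HV xi) yj) -(uea_gen_comm xi (gr_dif HV yj)).
rewrite !(sgvE HV xi, sgvE HV yj) !(linZ (gen_lin Ucl)) !(amulE hu).
by lmod k U.
Qed.

Lemma uea_dgAlg : is_dgAlg U. Proof. by case: uea_dg. Qed.
Lemma uea_dif_gen x : dif (gn x) = gn (dif x). Proof. by case: uea_dg. Qed.

End UeaTheory.

(** * Poisson enveloping algebras *)

Section PoissonLaws.
Variables (k : fieldType) (A : dgPois k).
Hypothesis HA : is_dgPois A.

Lemma pois_dgAlg : is_dgAlg A. Proof. by case: HA. Qed.
Lemma pois_dgLie : is_dgLie (pois_lie A). Proof. by case: HA. Qed.
Lemma pois_mulC i j (a b : A) : gr i a -> gr j b -> a ** b = ksgn k i j *: (b ** a).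
Proof. by case: HA => _ H _ _; apply: H. Qed.
Lemma pois_brMr i j l (a b c : A) : gr i a -> gr j b -> gr l c ->
  pbr a (b ** c) = pbr a b ** c + ksgn k i j *: (b ** pbr a c).
Proof. by case: HA => _ _ _ H; apply: H. Qed.

Lemma pbr_bilin : bilin (@pbr k A). Proof. exact: br_bilin pois_dgLie. Qed.
Lemma gr_pbr i j (a b : A) : gr i a -> gr j b -> gr (i + j) (pbr a b).
Proof. exact: (gr_br pois_dgLie). Qed.
Lemma pbr_anti i j (a b : A) : gr i a -> gr j b ->
  pbr a b = - (ksgn k i j *: pbr b a).
Proof. exact: (br_anti pois_dgLie). Qed.
Lemma pbr_jacobi i j l (a b c : A) : gr i a -> gr j b -> gr l c ->
  pbr a (pbr b c) = pbr (pbr a b) c + ksgn k i j *: pbr b (pbr a c).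
Proof. exact: (br_jacobi pois_dgLie). Qed.
Lemma dif_pbr i (a b : A) : gr i a ->
  dif (pbr a b) = pbr (dif a) b + ksgn k 1 i *: pbr a (dif b).
Proof. exact: (dif_br pois_dgLie). Qed.

Lemma pois_brMl i j l (a b c : A) : gr i a -> gr j b -> gr l c ->
  pbr (a ** b) c = a ** pbr b c + ksgn k j l *: (pbr a c ** b).
Proof.
move=> ai bj cl; have ha := dgAlg_alg pois_dgAlg.
rewrite (pbr_anti (gr_mul pois_dgAlg ai bj) cl) (pois_brMr cl ai bj).
rewrite (pbr_anti cl ai) (pbr_anti cl bj) !(amulE ha).
by lmod k A.
Qed.

Lemma pbr_one i (a : A) : gr i a -> pbr a aone = 0.
Proof.
move=> ai; have g1 := gr_one pois_dgAlg; have ha := dgAlg_alg pois_dgAlg.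
have := pois_brMr ai g1 g1; rewrite !(amulE ha) ksgnE oddz0 andbF expr0 scale1r.
by move/esym/eqP; rewrite -subr_eq0 addrK => /eqP.
Qed.

Lemma pbr_one_l i (a : A) : gr i a -> pbr aone a = 0.
Proof.
by move=> ai; rewrite (pbr_anti (gr_one pois_dgAlg) ai) (pbr_one ai) scaler0 oppr0.
Qed.

End PoissonLaws.

(** The data of a DG algebra map from a Poisson enveloping algebra to X. Product, bracket and unit
    are parameters, so that one space can be considered with its opposite structure too. *)
Record env_pair (k : fieldType) (V : dgSpace k) (mul brk : V -> V -> V) (one : V)
    (X : dgAlg k) (m h : V -> X) : Prop := EnvPair {
  ep_lm : linear m;
  ep_lh : linear h;
  ep_mM : forall i j a b, gr i a -> gr j b -> m (mul a b) = m a ** m b;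
  ep_hM : forall i j a b, gr i a -> gr j b ->
    h (mul a b) = m a ** h b + ksgn k i j *: (m b ** h a);
  ep_mB : forall i j a b, gr i a -> gr j b ->
    m (brk a b) = h a ** m b - ksgn k i j *: (m b ** h a);
  ep_hB : forall i j a b, gr i a -> gr j b ->
    h (brk a b) = h a ** h b - ksgn k i j *: (h b ** h a);
  ep_m1 : m one = aone;
  ep_gm : forall n a, gr n a -> gr n (m a);
  ep_gh : forall n a, gr n a -> gr n (h a);
  ep_dm : forall a, dif (m a) = m (dif a);
  ep_dh : forall a, dif (h a) = h (dif a) }.

Section EnvTheory.
Variables (k : fieldType) (A : dgPois k).
Hypothesis HA : is_dgPois A.
Let HAa := pois_dgAlg HA.
Let HAs := dgAlg_space HAa.
Let HV := dsum_dgSpace HAs HAs.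
Variables (E : dgAlg k) (cl : freealg (dsum A A) -> E) (gn : dsum A A -> E).
Hypothesis Ecl : presents (@env_rel k A) cl gn.

Let he : is_alg E := ps_alg Ecl.
Let gl := gen_lin Ecl.

Definition env_m (a : A) : E := gn (a, 0).
Definition env_h (a : A) : E := gn (0, a).

Lemma env_m_lin : linear env_m.
Proof.
move=> c a b; rewrite /env_m -gl; congr (gn _).
by congr pair; rewrite /= scaler0 addr0.
Qed.

Lemma env_h_lin : linear env_h.
Proof.
move=> c a b; rewrite /env_h -gl; congr (gn _).
by congr pair; rewrite /= scaler0 addr0.
Qed.

Lemma env_gnE p : gn p = env_m p.1 + env_h p.2.
Proof.
case: p => a b; rewrite /env_m /env_h -(linD gl); congr (gn _).
by congr pair; rewrite /= ?addr0 ?add0r.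
Qed.

Let grm i (a : A) : gr i a -> gr i ((a, 0) : dsum A A).
Proof. by move=> ai; split=> //; apply: gr0 HAs _. Qed.
Let grh i (a : A) : gr i a -> gr i ((0, a) : dsum A A).
Proof. by move=> ai; split=> //; apply: gr0 HAs _. Qed.

Lemma env_mM i j (a b : A) : gr i a -> gr j b -> env_m (a ** b) = env_m a ** env_m b.
Proof.
move=> ai bj; refine (ps_rel2 Ecl (env_m_mul ai bj) (ps_gen Ecl _) (cl_M2 Ecl _ _)).
Qed.

Lemma env_hM i j (a b : A) : gr i a -> gr j b ->
  env_h (a ** b) = env_m a ** env_h b + ksgn k i j *: (env_m b ** env_h a).
Proof.
move=> ai bj; refine (ps_rel2 Ecl (env_h_mul ai bj) (ps_gen Ecl _) (cl_MZ Ecl _ _ _ _ _)).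
Qed.

Lemma env_mB i j (a b : A) : gr i a -> gr j b ->
  env_m (pbr a b) = env_h a ** env_m b - ksgn k i j *: (env_m b ** env_h a).
Proof.
move=> ai bj; refine (ps_rel2 Ecl (env_m_br ai bj) (ps_gen Ecl _) (cl_MNZ Ecl _ _ _ _ _)).
Qed.

Lemma env_hB i j (a b : A) : gr i a -> gr j b ->
  env_h (pbr a b) = env_h a ** env_h b - ksgn k i j *: (env_h b ** env_h a).
Proof.
move=> ai bj; refine (ps_rel2 Ecl (env_h_br ai bj) (ps_gen Ecl _) (cl_MNZ Ecl _ _ _ _ _)).
Qed.

Lemma env_m1 : env_m aone = aone.
Proof.
refine (ps_rel2 Ecl (@env_m_one k A) (ps_gen Ecl _) (ps_one Ecl)).
Qed.

Lemma env_dg : is_dgAlg E /\ forall x, dif (gn x) = gn (dif x).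
Proof.
have dl := dif_lin HAs.
apply: (presented_dgAlg Ecl HV) => [l r|l r].
  have vm i a (ai : gr i a) : hspan i (@mv k A a) by apply/hspan_var/grm.
  have vh i a (ai : gr i a) : hspan i (@hv k A a) by apply/hspan_var/grh.
  case=> [i j a b ai bj|i j a b ai bj|i j a b ai bj|i j a b ai bj|].
  - exists (i + j); split; first by apply: vm; apply: gr_mul.
    by apply: hspan_mul; apply: vm.
  - exists (i + j); split; first by apply: vh; apply: gr_mul.
    apply: hspanD; first by apply: hspan_mul; [apply: vm|apply: vh].
    by apply: hspanZ; rewrite addrC; apply: hspan_mul; [apply: vm|apply: vh].
  - exists (i + j); split; first by apply: vm; apply: gr_pbr.
    apply: hspanD; first by apply: hspan_mul; [apply: vh|apply: vm].
    by apply/hspanN/hspanZ; rewrite addrC; apply: hspan_mul; [apply: vm|apply: vh].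
  - exists (i + j); split; first by apply: vh; apply: gr_pbr.
    apply: hspanD; first by apply: hspan_mul; apply: vh.
    by apply/hspanN/hspanZ; rewrite addrC; apply: hspan_mul; apply: vh.
  - exists 0; split; last exact: hspan_one.
    by apply: vm; apply: gr_one.
have dT := difT_bilin Ecl HV.
have dm (a : A) : gn (dif ((a, 0) : dsum A A)) = env_m (dif a).
  by rewrite /env_m -[dif _]/(dif a, dif 0) (lin0 dl).
have dh (a : A) : gn (dif ((0, a) : dsum A A)) = env_h (dif a).
  by rewrite /env_h -[dif _]/(dif 0, dif a) (lin0 dl).
have sm i a (ai : gr i a) : gn (sgv ((a, 0) : dsum A A)) = ksgn k 1 i *: env_m a.
  by rewrite (sgvE HV (grm ai)) (linZ gl).
have sh i a (ai : gr i a) : gn (sgv ((0, a) : dsum A A)) = ksgn k 1 i *: env_h a.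
  by rewrite (sgvE HV (grh ai)) (linZ gl).
have Lm := env_m_lin; have Lh := env_h_lin.
have d1 V0 : (act (difT gn) (var V0) (0, aone)).1 = gn (dif V0).
  by rewrite act_var /difT /= !(amulE he) addr0.
case=> [i j a b ai bj|i j a b ai bj|i j a b ai bj|i j a b ai bj|].
- apply: (eq_by (d1 _) (congr1 fst (act_M2 dT _ _ _))).
  rewrite /difT /= !(dm, dh) (sm _ _ ai) (sm _ _ bj) !(amulE he) -!/(env_m _).
  rewrite (dif_mul HAa _ ai) (linD Lm) (linZ Lm).
  by rewrite (env_mM (gr_dif HAs ai) bj) (env_mM ai (gr_dif HAs bj)); lmod k E.
- apply: (eq_by (d1 _) (congr1 fst (act_MZ dT _ _ _ _ _ _))).
  rewrite /difT /= !(dm, dh) (sm _ _ ai) (sm _ _ bj) (sh _ _ ai) (sh _ _ bj).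
  rewrite !(amulE he) -!/(env_m _) -!/(env_h _).
  rewrite (dif_mul HAa _ ai) (linD Lh) (linZ Lh).
  rewrite (env_hM (gr_dif HAs ai) bj) (env_hM ai (gr_dif HAs bj)).
  by lmod k E.
- apply: (eq_by (d1 _) (congr1 fst (act_MNZ dT _ _ _ _ _ _))).
  rewrite /difT /= !(dm, dh) (sm _ _ bj) (sh _ _ ai).
  rewrite !(amulE he) -!/(env_m _) -!/(env_h _).
  rewrite (dif_pbr HA _ ai) (linD Lm) (linZ Lm).
  rewrite (env_mB (gr_dif HAs ai) bj) (env_mB ai (gr_dif HAs bj)).
  by lmod k E.
- apply: (eq_by (d1 _) (congr1 fst (act_MNZ dT _ _ _ _ _ _))).
  rewrite /difT /= !(dm, dh) (sh _ _ bj) (sh _ _ ai).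
  rewrite !(amulE he) -!/(env_m _) -!/(env_h _).
  rewrite (dif_pbr HA _ ai) (linD Lh) (linZ Lh).
  rewrite (env_hB (gr_dif HAs ai) bj) (env_hB ai (gr_dif HAs bj)).
  by lmod k E.
- apply: (eq_by (d1 _) (congr1 fst (act1 _ _))).
  by rewrite dm (dif_one HAa) (lin0 Lm).
Qed.

Lemma env_dgAlg : is_dgAlg E. Proof. by case: env_dg. Qed.
Lemma env_dif_gen x : dif (gn x) = gn (dif x). Proof. by case: env_dg. Qed.

Lemma env_self : env_pair (@amul k A) (@pbr k A) aone env_m env_h.
Proof.
have d0 := lin0 (dif_lin HAs).
split.
- exact: env_m_lin.
- exact: env_h_lin.
- exact: env_mM.
- exact: env_hM.
- exact: env_mB.
- exact: env_hB.
- exact: env_m1.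
- by move=> n a an; apply: (pres_gr_gen Ecl); apply: grm.
- by move=> n a an; apply: (pres_gr_gen Ecl); apply: grh.
- by move=> a; rewrite /env_m env_dif_gen -[dif ((a, 0) : dsum A A)]/(dif a, dif 0) d0.
- by move=> a; rewrite /env_h env_dif_gen -[dif ((0, a) : dsum A A)]/(dif 0, dif a) d0.
Qed.

Section Universal.
Variables (X : dgAlg k) (m h : A -> X).
Hypotheses (HX : is_dgAlg X).
Hypothesis mh : env_pair (@amul k A) (@pbr k A) aone m h.

Let hx := dgAlg_alg HX.

(** The relations involve m and h separately, while the generators form one space; the map on it is
    (a, b) |-> m a + h b. *)
Lemma env_universal : exists phi : E -> X,
  [/\ linear phi /\ phi aone = aone, forall p q, phi (p ** q) = phi p ** phi q,
      forall n p, gr n p -> gr n (phi p), forall p, phi (dif p) = dif (phi p) &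
      (forall a, phi (env_m a) = m a) /\ (forall a, phi (env_h a) = h a)].
Proof.
pose f (p : dsum A A) : X := m p.1 + h p.2.
have [Lm Lh] := (ep_lm mh, ep_lh mh).
have fl : linear f by move=> c p q; rewrite /f /= Lm Lh; lmod k X.
have fm a : f (a, 0) = m a by rewrite /f /= (lin0 Lh) addr0.
have fh a : f (0, a) = h a by rewrite /f /= (lin0 Lm) add0r.
have Tb := homT_bilin hx fl.
have fr l r : env_rel l r -> act (homT f) l aone = act (homT f) r aone.
  case=> [i j a b ai bj|i j a b ai bj|i j a b ai bj|i j a b ai bj|].
  - apply: (eq_by (act_var _ _ _) (act_M2 Tb _ _ _)).
    by rewrite /homT !(fm, fh) !(amul1r hx) (ep_mM mh ai bj).
  - apply: (eq_by (act_var _ _ _) (act_MZ Tb _ _ _ _ _ _)).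
    by rewrite /homT !(fm, fh) !(amul1r hx) (ep_hM mh ai bj).
  - apply: (eq_by (act_var _ _ _) (act_MNZ Tb _ _ _ _ _ _)).
    by rewrite /homT !(fm, fh) !(amul1r hx) (ep_mB mh ai bj).
  - apply: (eq_by (act_var _ _ _) (act_MNZ Tb _ _ _ _ _ _)).
    by rewrite /homT !(fm, fh) !(amul1r hx) (ep_hB mh ai bj).
  - apply: (eq_by (act_var _ _ _) (act1 _ _)).
    by rewrite /homT fm (ep_m1 mh) (amul1l hx).
have fg n (p : dsum A A) : gr n p -> gr n (f p).
  by case=> p1 p2; apply: (grD (dgAlg_space HX)); [apply: (ep_gm mh)|apply: (ep_gh mh)].
have fd p : f (dif p) = dif (f p).
  rewrite /f (linD (dif_lin (dgAlg_space HX))) (ep_dm mh) (ep_dh mh).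
  by case: p.
exists (phom Ecl f); split.
- by split; [exact: (phom_lin Ecl hx fl fr)|exact: (phom_one Ecl hx fl fr)].
- exact: (phom_mul Ecl hx fl fr).
- exact: (phom_gr Ecl hx fl fr fg HX).
- exact: (phom_dif Ecl HV hx fl fr fg HX env_dgAlg env_dif_gen fd).
- by split=> a; rewrite (phom_gen Ecl hx fl fr).
Qed.

End Universal.

(** Applies also to maps that are not multiplicative, such as maps that reverse products. *)
Lemma env_eq (W : lmodType k) (f g : E -> W) : linear f -> linear g ->
  f aone = g aone ->
  (forall i n a p, gr i a -> gr n p -> f p = g p ->
    f (env_m a ** p) = g (env_m a ** p)) ->
  (forall i n a p, gr i a -> gr n p -> f p = g p ->
    f (env_h a ** p) = g (env_h a ** p)) ->
  f =1 g.
Proof.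
move=> fl g'l E1 Em Eh; apply: (pres_eq Ecl HV fl g'l E1).
move=> i n [a b] p [/= ai bi] pn IH; rewrite env_gnE !(amulE he).
by rewrite (linD fl) (linD g'l) (Em _ _ _ _ ai pn IH) (Eh _ _ _ _ bi pn IH).
Qed.

Lemma env_hom_eq (X : dgAlg k) (phi psi : E -> X) : linear phi -> linear psi ->
  phi aone = psi aone ->
  (forall p q, phi (p ** q) = phi p ** phi q) ->
  (forall p q, psi (p ** q) = psi p ** psi q) ->
  (forall i a, gr i a -> phi (env_m a) = psi (env_m a)) ->
  (forall i a, gr i a -> phi (env_h a) = psi (env_h a)) -> phi =1 psi.
Proof.
move=> lphi lpsi E1 Mphi Mpsi Em Eh; apply: (env_eq lphi lpsi E1) => i n a p ai pn IH.
  by rewrite Mphi Mpsi IH (Em _ _ ai).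
by rewrite Mphi Mpsi IH (Eh _ _ ai).
Qed.

End EnvTheory.

(** * The isomorphism for the symmetric algebra *)

Section EnvSym.
Variables (k : fieldType) (L : dgLie k).
Hypothesis HL : is_dgLie L.
Variables (S : dgAlg k) (cls_S : freealg L -> S) (sg : L -> S).
Hypothesis Scl : presents (@sym_rel k L) cls_S sg.

Let HV := dgLie_space HL.
Let Hs : is_dgAlg S := sym_dgAlg HV Scl.
Let HsV := dgAlg_space Hs.
Let sb := sym_br Scl.
Let SP : dgPois k := @DGPois k S sb.
Let HSP : is_dgPois SP := sym_dgPois HL Scl.
Let sgl := gen_lin Scl.
Let sgg i x (xi : gr i x) : gr i (sg x) := pres_gr_gen Scl xi.

Let LL := semidirect L.
Let HLL : is_dgLie LL := semidirect_dgLie HL.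
Variables (U : dgAlg k) (cls_U : freealg LL -> U) (u : LL -> U).
Hypothesis Ucl : presents (@uea_rel k LL) cls_U u.
Let hu : is_alg U := ps_alg Ucl.
Let Hu : is_dgAlg U := uea_dgAlg HLL Ucl.
Let ul := gen_lin Ucl.

Let um (x : L) : U := u (x, 0).
Let uh (x : L) : U := u (0, x).

Let um_lin : linear um.
Proof.
move=> c x y; rewrite /um -ul; congr (u _).
by congr pair; rewrite /= scaler0 addr0.
Qed.

Let uh_lin : linear uh.
Proof.
move=> c x y; rewrite /uh -ul; congr (u _).
by congr pair; rewrite /= scaler0 addr0.
Qed.

Let uE x : u x = um x.1 + uh x.2.
Proof.
case: x => x y; rewrite /um /uh -(linD ul); congr (u _).
by congr pair; rewrite /= ?addr0 ?add0r.
Qed.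

Let ggm i (x : L) : gr i x -> gr i ((x, 0) : LL).
Proof. by move=> xi; split=> //; apply: gr0 HV _. Qed.
Let ggh i (x : L) : gr i x -> gr i ((0, x) : LL).
Proof. by move=> xi; split=> //; apply: gr0 HV _. Qed.

Let br0l (x : L) : br 0 x = 0. Proof. exact: bilin0l (br_bilin HL). Qed.
Let br0r (x : L) : br x 0 = 0. Proof. exact: bilin0r (br_bilin HL). Qed.

Let um_comm i j x y : gr i x -> gr j y -> um x ** um y = ksgn k i j *: (um y ** um x).
Proof.
move=> xi yj; apply/eqP; rewrite -subr_eq0; apply/eqP.
rewrite (uea_gen_comm Ucl (ggm xi) (ggm yj)) (semidirect_brE HL) /= !br0l br0r addr0.
exact: (lin0 ul).
Qed.

Let uhm i j x y : gr i x -> gr j y ->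
  um (br x y) = uh x ** um y - ksgn k i j *: (um y ** uh x).
Proof.
move=> xi yj; rewrite (uea_gen_comm Ucl (ggh xi) (ggm yj)) (semidirect_brE HL) /=.
by rewrite br0l br0r addr0.
Qed.

Let uhh i j x y : gr i x -> gr j y ->
  uh (br x y) = uh x ** uh y - ksgn k i j *: (uh y ** uh x).
Proof.
move=> xi yj; rewrite (uea_gen_comm Ucl (ggh xi) (ggh yj)) (semidirect_brE HL) /=.
by rewrite br0l br0r addr0.
Qed.

Let um_rel l r : sym_rel l r -> act (homT um) l aone = act (homT um) r aone.
Proof.
have Tb := homT_bilin hu um_lin.
case=> i j x y xi yj; apply: (eq_by (act_M2 Tb _ _ _) (act_Z2 Tb _ _ _ _)).
by rewrite /homT !(amul1r hu) (um_comm xi yj).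
Qed.

Definition usym_m : S -> U := phom Scl um.
Let phi := usym_m.

Let phi_lin : linear phi. Proof. exact: (phom_lin Scl hu um_lin um_rel). Qed.
Let phi1 : phi aone = aone. Proof. exact: (phom_one Scl hu um_lin um_rel). Qed.
Let phiM p q : phi (p ** q) = phi p ** phi q.
Proof. exact: (phom_mul Scl hu um_lin um_rel). Qed.
Let phi_gen x : phi (sg x) = um x. Proof. exact: (phom_gen Scl hu um_lin um_rel). Qed.
Let um_gr n x : gr n x -> gr n (um x).
Proof. by move=> xn; apply: (pres_gr_gen Ucl); apply: ggm. Qed.
Let uh_gr n x : gr n x -> gr n (uh x).
Proof. by move=> xn; apply: (pres_gr_gen Ucl); apply: ggh. Qed.
Let phi_gr n p : gr n p -> gr n (phi p).
Proof. exact: (phom_gr Scl hu um_lin um_rel um_gr Hu). Qed.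
Let um_dif x : um (dif x) = dif (um x).
Proof.
rewrite /um (uea_dif_gen HLL Ucl) -[dif ((x, 0) : LL)]/(dif x, dif 0).
by rewrite (lin0 (dif_lin HV)).
Qed.
Let uh_dif x : uh (dif x) = dif (uh x).
Proof.
rewrite /uh (uea_dif_gen HLL Ucl) -[dif ((0, x) : LL)]/(dif 0, dif x).
by rewrite (lin0 (dif_lin HV)).
Qed.
Let phi_dif p : phi (dif p) = dif (phi p).
Proof.
exact: (phom_dif Scl HV hu um_lin um_rel um_gr Hu Hs (sym_dif_gen HV Scl) um_dif).
Qed.
Let phi_comm i j p q : gr i p -> gr j q -> phi p ** phi q = ksgn k i j *: (phi q ** phi p).
Proof. by move=> pi qj; rewrite -!phiM (sym_mulC Scl pi qj) (linZ phi_lin). Qed.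

Let phiA (p : S) (n : U) : U := phi p ** n.
Let phiA_action : is_action phiA.
Proof.
split; first split.
- by move=> n; refine (lin_comp (amulLl hu n) phi_lin).
- by move=> p; apply: (amulLr hu).
- by move=> p q n; rewrite /phiA phiM (amulA hu).
- by move=> n; rewrite /phiA phi1 (amul1l hu).
Qed.

Definition usym_h : S -> U := kah Scl phiA uh.
Let eta := usym_h.

Let eta_kahler : kahler phiA eta.
Proof. exact: (kah_kahler HV Scl phiA_action uh_lin). Qed.
Let eta_lin : linear eta. Proof. by case: eta_kahler. Qed.
Let eta1 : eta aone = 0. Proof. exact: (kahler_one HV Scl phiA_action eta_kahler). Qed.
Let etaM i j p q : gr i p -> gr j q ->
  eta (p ** q) = phi p ** eta q + ksgn k i j *: (phi q ** eta p).
Proof. by case: eta_kahler => _; apply. Qed.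
Let eta_gen x : eta (sg x) = uh x.
Proof. exact: (kah_gen HV Scl phiA_action uh_lin). Qed.

Let eta_gr n p : gr n p -> gr n (eta p).
Proof.
have Hg := dgAlg_space Hu.
move: n p; apply: (pres_gr_ind Scl (Q := fun n p => gr n (eta p)))
  => [n|n c p q _ _ Ep Eq||i n x p xi pn IH].
- by rewrite (lin0 eta_lin); apply: (gr0 Hg).
- by rewrite eta_lin; apply: (gr_lin Hg).
- by rewrite eta1; apply: (gr0 Hg).
- rewrite (etaM (sgg xi) pn) eta_gen phi_gen; apply: (grD Hg).
    by apply: (gr_mul Hu) => //; apply: um_gr.
  apply: (grZ Hg); rewrite addrC; apply: (gr_mul Hu); first exact: phi_gr.
  exact: uh_gr.
Qed.

Let eta_dif p : eta (dif p) = dif (eta p).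
Proof.
have dS := dif_lin HsV; have dU := dif_lin (dgAlg_space Hu).
move: p; apply: (pres_eq Scl HV (lin_comp eta_lin dS) (lin_comp dU eta_lin)).
  by rewrite (dif_one Hs) (lin0 eta_lin) eta1 (lin0 dU).
move=> i n x p xi pn IH; have gx := sgg xi.
rewrite (etaM gx pn) (dif_mul Hs _ gx) (linD eta_lin) (linZ eta_lin).
rewrite (etaM (gr_dif HsV gx) pn) (etaM gx (gr_dif HsV pn)) IH.
rewrite (linD dU) (linZ dU) (dif_mul Hu _ (phi_gr gx)) (dif_mul Hu _ (phi_gr pn)).
rewrite !phi_dif (sym_dif_gen HV Scl) !phi_gen !eta_gen -uh_dif -um_dif.
by lmod k U.
Qed.

(** The commutator with eta (sg x) is a graded derivation along phi, so the case of two generators,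
    a relation of U, is enough. *)
Let phi_br_gen i j x q : gr i x -> gr j q ->
  phi (sb (sg x) q) = eta (sg x) ** phi q - ksgn k i j *: (phi q ** eta (sg x)).
Proof.
move=> xi; move: j q; apply: (pres_gr_ind Scl (Q := fun j q =>
  phi (sb (sg x) q) = eta (sg x) ** phi q - ksgn k i j *: (phi q ** eta (sg x))))
  => [n|n c p q _ _ Ep Eq||j n y q yj qn IH]; rewrite /sb.
- by rewrite (sym_br0r HL) !(lin0 phi_lin) !(amulE hu); lmod k U.
- by rewrite (sym_brDr HL) (sym_brZr HL) !phi_lin Ep Eq !(amulE hu); lmod k U.
- by rewrite (sym_br1r HL) (lin0 phi_lin) phi1 !(amulE hu); lmod k U.
- rewrite (sym_brMr HL Scl (sgg xi) (sgg yj) qn) (sym_br_gens HL).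
  rewrite (linD phi_lin) (linZ phi_lin) !phiM IH eta_gen !phi_gen (uhm xi yj).
  by rewrite !(amulE hu); lmod k U.
Qed.

(** For a product in the first argument, the derivation rule of [eta] matches the Leibniz rule
    because the values of [phi] commute up to sign. *)
Let phi_br i j p q : gr i p -> gr j q ->
  phi (sb p q) = eta p ** phi q - ksgn k i j *: (phi q ** eta p).
Proof.
move=> + qj; move: i p; apply: (pres_gr_ind Scl (Q := fun i p =>
  phi (sb p q) = eta p ** phi q - ksgn k i j *: (phi q ** eta p)))
  => [n|n c p p' _ _ Ep Eq||i n y p yi pn IH]; rewrite /sb.
- by rewrite (sym_br0l HL) (lin0 phi_lin) (lin0 eta_lin) !(amulE hu); lmod k U.
- by rewrite (sym_brDl HL) (sym_brZl HL) phi_lin eta_lin Ep Eq !(amulE hu); lmod k U.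
- by rewrite (sym_br1l HL) (lin0 phi_lin) eta1 !(amulE hu); lmod k U.
- have gy := sgg yi.
  rewrite (sym_brMl HL Scl _ gy pn) (linD phi_lin) (linZ phi_lin) !phiM.
  rewrite IH (phi_br_gen yi qj) (etaM gy pn) !(amulE hu).
  rewrite (phi_comm qj gy) (phi_comm qj pn) !(amulE hu).
  by lmod k U.
Qed.

Let eta_br_at i j (p q : S) :=
  eta (sb p q) = eta p ** eta q - ksgn k i j *: (eta q ** eta p).

(** Expanding [eta] on a product leaves brackets under [phi], which are already known to be
    commutators of [eta] with [phi]. *)
Let eta_br_ind i p : gr i p ->
  (forall j y, gr j y -> eta_br_at i j p (sg y)) ->
  forall j q, gr j q -> eta_br_at i j p q.
Proof.
move=> pi Ey; apply: (pres_gr_ind Scl (Q := fun j q => eta_br_at i j p q))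
  => [n|n c q q' _ _ Ep Eq||j n y q yj qn IH]; rewrite /eta_br_at /sb.
- by rewrite (sym_br0r HL) !(lin0 eta_lin) !(amulE hu); lmod k U.
- by rewrite (sym_brDr HL) (sym_brZr HL) !eta_lin Ep Eq !(amulE hu); lmod k U.
- by rewrite (sym_br1r HL) (lin0 eta_lin) eta1 !(amulE hu); lmod k U.
- have gy := sgg yj; have E := Ey _ _ yj.
  rewrite (sym_brMr HL Scl pi gy qn) (linD eta_lin) (linZ eta_lin).
  rewrite (etaM (sym_br_gr HL Scl pi gy) qn) (etaM gy (sym_br_gr HL Scl pi qn)).
  rewrite -!/(sb _ _) IH E (phi_br pi gy) (phi_br pi qn) (etaM gy qn) !(amulE hu).
  by lmod k U.
Qed.

Let eta_br_swap i j p q : gr i p -> gr j q -> eta_br_at i j p q -> eta_br_at j i q p.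
Proof.
move=> pi qj; rewrite /eta_br_at /sb (sym_br_anti HL Scl qj pi) => E.
by rewrite (linN eta_lin) (linZ eta_lin) E; lmod k U.
Qed.

Let eta_br i j p q : gr i p -> gr j q ->
  eta (sb p q) = eta p ** eta q - ksgn k i j *: (eta q ** eta p).
Proof.
have E1 i1 j1 x r : gr i1 x -> gr j1 r -> eta_br_at i1 j1 (sg x) r.
  move=> xi; move: j1 r; apply: (eta_br_ind (sgg xi)) => l y yl.
  by rewrite /eta_br_at /sb (sym_br_gens HL) !eta_gen (uhh xi yl).
move=> pi; move: j q; apply: (eta_br_ind pi) => l x xl.
by apply: (eta_br_swap (sgg xl) pi); apply: E1.
Qed.

Lemma usym_env_pair : env_pair (@amul k SP) (@pbr k SP) aone usym_m usym_h.
Proof.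
split.
- exact: phi_lin.
- exact: eta_lin.
- by move=> i j p q _ _; exact: phiM.
- exact: etaM.
- exact: phi_br.
- exact: eta_br.
- exact: phi1.
- exact: phi_gr.
- exact: eta_gr.
- move=> p; exact: esym (phi_dif p).
- move=> p; exact: esym (eta_dif p).
Qed.

Variables (E : dgAlg k) (cls_E : freealg (dsum SP SP) -> E) (gn : dsum SP SP -> E).
Hypothesis Ecl : presents (@env_rel k SP) cls_E gn.
Let he : is_alg E := ps_alg Ecl.
Let mE : S -> E := env_m gn.
Let hE : S -> E := env_h gn.
Let mEl : linear mE. Proof. exact: (env_m_lin Ecl). Qed.
Let hEl : linear hE. Proof. exact: (env_h_lin Ecl). Qed.

Let f (x : LL) : E := mE (sg x.1) + hE (sg x.2).

Let f_lin : linear f.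
Proof. by move=> c x y; rewrite /f /= !sgl mEl hEl; lmod k E. Qed.

(** In the commutator of two sums m + h, the m's commute and the other terms are relations of E. The
    mixed term with h second needs the bracket of L turned around by antisymmetry. *)
Let f_rel l r : uea_rel l r -> act (homT f) l aone = act (homT f) r aone.
Proof.
have Tb := homT_bilin he f_lin.
case=> i j [x1 x2] [y1 y2] [/= x1i x2i] [/= y1j y2j].
apply: (eq_by (act_MNZ Tb _ _ _ _ _ _) (act_var _ _ _)).
rewrite /homT (semidirect_brE HL) /f /= !(amulE he).
have gs i1 j1 x y : gr i1 x -> gr j1 y -> sg (br x y) = sb (sg x) (sg y).
  by rewrite /sb (sym_br_gens HL).
have mB i1 j1 x y (xi : gr i1 x) (yj : gr j1 y) : mE (sg (br x y)) =
    hE (sg x) ** mE (sg y) - ksgn k i1 j1 *: (mE (sg y) ** hE (sg x)).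
  by rewrite (gs _ _ _ _ xi yj); exact: (env_mB Ecl (a := sg x : SP) (sgg xi) (sgg yj)).
have hB i1 j1 x y (xi : gr i1 x) (yj : gr j1 y) : hE (sg (br x y)) =
    hE (sg x) ** hE (sg y) - ksgn k i1 j1 *: (hE (sg y) ** hE (sg x)).
  by rewrite (gs _ _ _ _ xi yj); exact: (env_hB Ecl (a := sg x : SP) (sgg xi) (sgg yj)).
have mC i1 j1 x y (xi : gr i1 x) (yj : gr j1 y) : mE (sg x) ** mE (sg y) =
    ksgn k i1 j1 *: (mE (sg y) ** mE (sg x)).
  have <- := env_mM Ecl (a := sg x : SP) (sgg xi) (sgg yj).
  have <- := env_mM Ecl (a := sg y : SP) (sgg yj) (sgg xi).
  by rewrite -(linZ mEl) -(sym_mulC Scl (sgg xi) (sgg yj)).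
rewrite (linD sgl) (linD mEl) (mB _ _ _ _ x2i y1j) (hB _ _ _ _ x2i y2j).
rewrite (br_anti HL x1i y2j) (linN sgl) (linZ sgl) (linN mEl) (linZ mEl).
rewrite (mB _ _ _ _ y2j x1i) (mC _ _ _ _ x1i y1j).
by lmod k E.
Qed.

Let G : U -> E := phom Ucl f.
Let G_lin : linear G. Proof. exact: (phom_lin Ucl he f_lin f_rel). Qed.
Let G1 : G aone = aone. Proof. exact: (phom_one Ucl he f_lin f_rel). Qed.
Let GM p q : G (p ** q) = G p ** G q.
Proof. exact: (phom_mul Ucl he f_lin f_rel). Qed.
Let G_gen x : G (u x) = f x. Proof. exact: (phom_gen Ucl he f_lin f_rel). Qed.

Let G_m p : G (phi p) = mE p.
Proof.
move: p; apply: (pres_eq Scl HV (lin_comp G_lin phi_lin) mEl).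
  by rewrite phi1 G1; exact: esym (env_m1 Ecl).
move=> i n x p xi pn IH; rewrite phiM GM IH phi_gen /um G_gen /f /=.
rewrite (lin0 sgl) (lin0 hEl) addr0.
exact: esym (env_mM Ecl (a := sg x : SP) (sgg xi) pn).
Qed.

Let mA (p : S) (n : E) : E := mE p ** n.
Let mA_action : is_action mA.
Proof.
split; first split.
- by move=> n; refine (lin_comp (amulLl he n) mEl).
- by move=> p; apply: (amulLr he).
(* The relations make [mE] multiplicative on homogeneous elements; being the composite of G and phi,
   it is multiplicative on all. *)
- by move=> p q n; rewrite /mA -!G_m phiM GM (amulA he).
- by move=> n; rewrite /mA -G_m phi1 G1 (amul1l he).
Qed.

(** Both maps are derivations along [mE] with the same values on generators. *)
Let G_h p : G (eta p) = hE p.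
Proof.
have K1 : kahler mA (fun p => G (eta p)).
  split; first exact: lin_comp G_lin eta_lin.
  move=> i j q r qi rj; rewrite (etaM qi rj) (linD G_lin) (linZ G_lin) !GM.
  by rewrite /mA !G_m.
have K2 : kahler mA hE.
  split; first exact: hEl.
  move=> i j q r qi rj; exact: (env_hM Ecl (a := q : SP) qi rj).
move: p; apply: (kahler_eq HV Scl mA_action K1 K2) => i x xi.
by rewrite eta_gen /uh G_gen /f /= (lin0 sgl) (lin0 mEl) add0r.
Qed.

Lemma env_sym_iso : dgAlg_iso E U.
Proof.
have HE := env_dgAlg HSP Ecl.
have [F [[Fl F1] FM Fg Fd [Fm Fh]]] := env_universal HSP Ecl Hu usym_env_pair.
split=> //; exists F; split=> //.
exists G => [p|q].
  apply: (env_hom_eq HSP Ecl (X := E) (lin_comp G_lin Fl) (@lin_id _ _)) => //=.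
  - by rewrite F1 G1.
  - by move=> q r; rewrite FM GM.
  - by move=> i a ai; rewrite Fm; exact: G_m.
  - by move=> i a ai; rewrite Fh; exact: G_h.
move: q; apply: (pres_eq Ucl (dgLie_space HLL) (lin_comp Fl G_lin) (@lin_id _ _)).
  by rewrite G1 F1.
move=> i n x p xi pn IH; rewrite GM FM IH G_gen /f (linD Fl).
by rewrite Fm Fh -/phi -/eta phi_gen eta_gen -uE.
Qed.

End EnvSym.

Lemma semidirect_part (k : fieldType) (L : dgLie k) : is_dgLie L ->
  is_dgLie (semidirect L) /\
  exists2 b, unique (@is_sym_bracket k L) b &
    is_dgPois (DGPois b) /\ dgAlg_iso (Env (DGPois b)) (Uea (semidirect L)).
Proof.
move=> HL; split; first exact: semidirect_dgLie.
have Scl := presented_presents (@sym_rel k L).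
exists (sym_br Scl).
  split=> [|b' [bb bg br_ bl]]; last exact: (sym_br_uniq HL Scl bb bg br_ bl).
  split.
  - exact: (sym_br_bilin HL Scl).
  - exact: (sym_br_gens HL Scl).
  - move=> i j l p q r pi qj rl; exact: (sym_brMr HL Scl pi qj rl).
  - move=> i j l p q r pi qj rl.
    exact: (pois_brMl (sym_dgPois HL Scl) pi qj rl).
split; first exact: (sym_dgPois HL Scl).
refine (env_sym_iso HL (presented_presents (@uea_rel k (semidirect L)))
  (presented_presents (@env_rel k (DGPois (sym_br Scl))))).
Qed.

(** * Tensor products and opposites *)

Section TensorConcrete.
Variables (k : fieldType) (V W : lmodType k).

Lemma pure_bilin : bilin (@pure k V W).
Proof.
split=> [w c u v|v c u w]; rewrite /pure -(cls_lin (@bilin_gen k V W)).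
  apply: cls_eq; apply: lspan_gen; exact: bilin_l.
apply: cls_eq; apply: lspan_gen; exact: bilin_r.
Qed.

Lemma tens_span (t : tens V W) : lspan [set u | exists v w, u = pure v w] t.
Proof.
rewrite -[t]repK; apply: (lspan_img (cls_lin _)) (malg_span _) => _ [[v w] _ <-].
by apply: lspan_gen; exists v, w.
Qed.

Section Ext.
Variables (Z : lmodType k) (f : V -> W -> Z).

Let ext0 := lin_ext (fun p : V * W => f p.1 p.2).

Let ext0_gen : bilin f -> forall u, bilin_gen u -> ext0 u = 0.
Proof.
move=> [fl fr] u; have el := lin_ext_lin (fun p : V * W => f p.1 p.2).
case=> [c v v' w|c v w w']; rewrite /ext0 (linB el) el !lin_extU /=.
  by rewrite fl subrr.
by rewrite fr subrr.
Qed.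

Lemma tens_ext_pure : bilin f -> forall v w, tens_ext f (pure v w) = f v w.
Proof.
move=> fb v w; rewrite /tens_ext /pure (rep_cls (lin_ext_lin _) _ (ext0_gen fb)).
by rewrite lin_extU.
Qed.

Lemma tens_ext_lin : bilin f -> linear (tens_ext f).
Proof.
move=> fb c s t; rewrite -[s]repK -[t]repK -(cls_lin (@bilin_gen k V W)) /tens_ext.
have el := lin_ext_lin (fun p : V * W => f p.1 p.2).
by rewrite !(rep_cls el _ (ext0_gen fb)) el.
Qed.

Lemma tens_ext_linf c (g h : V -> W -> Z) t :
  (forall v w, h v w = c *: f v w + g v w) ->
  tens_ext h t = c *: tens_ext f t + tens_ext g t.
Proof.
move=> E; rewrite /tens_ext /lin_ext scaler_sumr -big_split/=.
by apply: eq_bigr => p _; rewrite E scalerDr !scalerA mulrC.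
Qed.

End Ext.
End TensorConcrete.

(** An abstract description, so that the quotient is never unfolded; spanning by pure tensors
    supplies the uniqueness in the universal property. *)
Record tensor_dg (k : fieldType) (V W T : dgSpace k) (pu : V -> W -> T) : Prop :=
  TensorDg {
  td_bilin : bilin pu;
  td_span : forall t, lspan [set u | exists v w, u = pu v w] t;
  td_univ : forall (Z : lmodType k) (f : V -> W -> Z), bilin f ->
    exists g : T -> Z, linear g /\ forall v w, g (pu v w) = f v w;
  td_gr : forall n, @gr k T n = lspan [set t | exists i j v w,
    [/\ gr i v, gr j w, i + j = n & t = pu v w]];
  td_dl : linear (@dif k T);
  td_dif : forall v w, dif (pu v w) = pu (dif v) w + pu (sgv v) (dif w) }.

Section TensorConcreteDg.
Variables (k : fieldType) (V W : dgSpace k).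
Hypotheses (HV : is_dgSpace V) (HW : is_dgSpace W).

Lemma tens_dif_bilin :
  bilin (fun (v : V) (w : W) => pure (dif v) w + pure (sgv v) (dif w)).
Proof.
have [pl pr] := @pure_bilin k V W.
split=> [w|v]; apply: lin_add.
- exact: (lin_comp (pl w) (dif_lin HV)).
- exact: (lin_comp (pl (dif w)) (sgv_lin HV)).
- exact: pr.
- exact: (lin_comp (pr (sgv v)) (dif_lin HW)).
Qed.

Lemma tens_space_dg : tensor_dg (T := tens_space V W) (@pure k V W).
Proof.
split.
- exact: pure_bilin.
- exact: tens_span.
- move=> Z f fb; exists (tens_ext f).
  by split; [exact: tens_ext_lin|exact: tens_ext_pure].
- by move=> n; exact: erefl.
- exact: (tens_ext_lin tens_dif_bilin).
- move=> v w; exact: (tens_ext_pure tens_dif_bilin).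
Qed.

End TensorConcreteDg.

Section TensorKoszul.
Variables (k : fieldType) (A B : dgSpace k).
Hypotheses (HA : is_dgSpace A) (HB : is_dgSpace B).
Variables (Z : lmodType k) (G : A -> A -> B -> B -> Z).
Hypotheses (G1 : forall a' b b', linear (fun a => G a a' b b'))
  (G2 : forall a b b', linear (fun a' => G a a' b b'))
  (G3 : forall a a' b', linear (fun b => G a a' b b'))
  (G4 : forall a a' b, linear (fun b' => G a a' b b')).

(** The common form of product and bracket of a tensor product: only a' and b move past each other,
    so the sign concerns these two. *)
Definition tens_koszul (s t : tens A B) : Z :=
  tens_ext (fun a b => tens_ext (fun a' b' =>
    koszul (fun x' y => G a x' y b') a' b) t) s.

Let Kb a b' : bilin (fun x' y => G a x' y b').
Proof. by split=> [b|a']; [exact: G2|exact: G3]. Qed.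

Let inner a b : bilin (fun a' b' => koszul (fun x' y => G a x' y b') a' b).
Proof.
split=> [b'|a' c b1 b2]; first exact: (koszul_bilin HA HB (Kb a b')).1.
apply: (koszul_linf HA HB _ _ (Kb a b1) (Kb a b2)) => x y; exact: G4.
Qed.

Let outer t : bilin (fun a b => tens_ext (fun a' b' =>
    koszul (fun x' y => G a x' y b') a' b) t).
Proof.
split=> [b c a1 a2|a c b1 b2]; apply: tens_ext_linf => a' b'.
  apply: (koszul_linf HA HB _ _ (Kb a1 b') (Kb a2 b')) => x y; exact: G1.
exact: (koszul_bilin HA HB (Kb a b')).2.
Qed.

Lemma tens_koszul_bilin : bilin tens_koszul.
Proof.
split=> [t|s c t1 t2]; first exact: (tens_ext_lin (outer t)).
by apply: tens_ext_linf => a b; apply: tens_ext_lin.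
Qed.

Lemma tens_koszulE i j a b a' b' : gr i b -> gr j a' ->
  tens_koszul (pure a b) (pure a' b') = ksgn k j i *: G a a' b b'.
Proof.
move=> bi a'j; rewrite /tens_koszul (tens_ext_pure (outer _)).
by rewrite (tens_ext_pure (inner a b)) (koszulE HA HB (Kb a b') a'j bi).
Qed.

End TensorKoszul.

Section TensorSpace.
Variables (k : fieldType) (V W T : dgSpace k) (pu : V -> W -> T).
Hypotheses (HV : is_dgSpace V) (HW : is_dgSpace W) (HT : tensor_dg pu).

Lemma puDl u v w : pu (u + v) w = pu u w + pu v w.
Proof. exact: linD ((td_bilin HT).1 w) _ _. Qed.
Lemma puDr u v w : pu u (v + w) = pu u v + pu u w.
Proof. exact: linD ((td_bilin HT).2 u) _ _. Qed.
Lemma puZl c v w : pu (c *: v) w = c *: pu v w.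
Proof. exact: linZ ((td_bilin HT).1 w) _ _. Qed.
Lemma puZr c v w : pu v (c *: w) = c *: pu v w.
Proof. exact: linZ ((td_bilin HT).2 v) _ _. Qed.
Lemma puNl v w : pu (- v) w = - pu v w.
Proof. exact: linN ((td_bilin HT).1 w) _. Qed.
Lemma puNr v w : pu v (- w) = - pu v w.
Proof. exact: linN ((td_bilin HT).2 v) _. Qed.
Lemma pu0l w : pu 0 w = 0. Proof. exact: bilin0l (td_bilin HT). Qed.
Lemma pu0r v : pu v 0 = 0. Proof. exact: bilin0r (td_bilin HT). Qed.
Definition puE := (puDl, puDr, puZl, puZr, puNl, puNr, pu0l, pu0r).

Lemma pu_gr i j v w : gr i v -> gr j w -> gr (i + j) (pu v w).
Proof.
by move=> vi wj; rewrite (td_gr HT); apply: lspan_gen; exists i, j, v, w.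
Qed.

Lemma pu_gr0 n : gr n (0 : T). Proof. by rewrite (td_gr HT); apply: lspan0. Qed.
Lemma pu_gr_lin n c (s t : T) : gr n s -> gr n t -> gr n (c *: s + t).
Proof. by rewrite (td_gr HT); apply: lspan_lin. Qed.

Lemma tens_lin_eq (Z : lmodType k) (f g : T -> Z) : linear f -> linear g ->
  (forall i j v w, gr i v -> gr j w -> f (pu v w) = g (pu v w)) -> f =1 g.
Proof.
move=> fl gl E t; apply: (lspan_eq fl gl _ (td_span HT t)) => _ [v [w ->]].
have [pl pr] := td_bilin HT.
have B (h : T -> Z) : linear h -> bilin (fun v w => h (pu v w)).
  move=> hl; split=> [w'|v']; first exact: (lin_comp hl (pl w')).
  exact: (lin_comp hl (pr v')).
exact: (bilin_gr_eq HV HW (B _ fl) (B _ gl) E).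
Qed.

Lemma tens_gr_eq (Z : lmodType k) (f g : T -> Z) n t : linear f -> linear g ->
  (forall i j v w, gr i v -> gr j w -> i + j = n -> f (pu v w) = g (pu v w)) ->
  gr n t -> f t = g t.
Proof.
move=> fl gl E; rewrite (td_gr HT); apply: (lspan_eq fl gl).
by move=> _ [i [j [v [w [vi wj ij ->]]]]]; apply: E vi wj ij.
Qed.

Lemma tens_gr2_eq (Z : lmodType k) (f g : T -> T -> Z) n m : bilin f -> bilin g ->
  (forall i1 j1 a1 b1 i2 j2 a2 b2, gr i1 a1 -> gr j1 b1 -> gr i2 a2 -> gr j2 b2 ->
     i1 + j1 = n -> i2 + j2 = m -> f (pu a1 b1) (pu a2 b2) = g (pu a1 b1) (pu a2 b2)) ->
  forall s t, gr n s -> gr m t -> f s t = g s t.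
Proof.
move=> [fl fr] [gl g'r] E s t sn tm.
apply: (tens_gr_eq (fl t) (gl t) _ sn) => i1 j1 a1 b1 a1i b1j e1 {sn s}.
apply: (tens_gr_eq (fr _) (g'r _) _ tm) => i2 j2 a2 b2 a2i b2j e2.
exact: E a1i b1j a2i b2j e1 e2.
Qed.

(** The degree n component of v (x) w, the sum over i of v_i (x) w_(n-i). It is bilinear, hence
    induces the projections that give the grading of T. *)
Let prf n v w : T := hext (fun i v' => pu v' (hcomp (n - i) w)) v.

Let prf_bilin n : bilin (prf n).
Proof.
have [pl pr] := td_bilin HT.
split=> [w|v c w w'].
  by apply: (@hext_lin _ _ HV _ (fun i v' => pu v' (hcomp (n - i) w))) => i.
apply: (@hext_linF _ _ HV _ c (fun i v' => pu v' (hcomp (n - i) w))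
  (fun i v' => pu v' (hcomp (n - i) w'))
  (fun i v' => pu v' (hcomp (n - i) (c *: w + w')))).
- by move=> i; rewrite pu0l.
- by move=> i; rewrite pu0l.
- by move=> i u; rewrite (hcomp_lin HW) pr.
Qed.

Let prfE n i j v w : gr i v -> gr j w ->
  prf n v w = if n == i + j then pu v w else 0.
Proof.
move=> vi wj; rewrite /prf.
rewrite (@hextE _ _ HV _ (fun i v' => pu v' (hcomp (n - i) w)) i v) => [|m|//].
  rewrite (hcomp_hom HW _ wj) subr_eq addrC.
  by case: eqP => // _; rewrite pu0r.
by rewrite pu0l.
Qed.

Lemma td_difE i v w : gr i v -> dif (pu v w) = pu (dif v) w + ksgn k 1 i *: pu v (dif w).
Proof. by move=> vi; rewrite (td_dif HT) (sgvE HV vi) puZl. Qed.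

Lemma tens_dgSpace : is_dgSpace T.
Proof.
have ex n := td_univ HT (prf_bilin n).
pose pr n : T -> T := sval (cid (ex n)).
have prl n : linear (pr n) by rewrite /pr; case: cid => g [].
have prE n v w : pr n (pu v w) = prf n v w by rewrite /pr; case: cid => g [].
have dl := td_dl HT.
apply: (mk_dgSpace (pr := pr)) => //.
- exact: pu_gr_lin.
- exact: pu_gr0.
- move=> t; apply: (lspan_sub _ (td_span HT t)) => _ [v [w ->]].
  apply: (lspan_img ((td_bilin HT).1 w)) (gr_span HV v) => {}v [i vi].
  apply: (lspan_img ((td_bilin HT).2 v)) (gr_span HW w) => {}w [j wj].
  by apply: lspan_gen; exists (i + j); apply: pu_gr.
- move=> n m t; pose g (t : T) : T := if m == n then t else 0.
  have gl : linear g.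
    by move=> c s s'; rewrite /g; case: eqP => // _; rewrite scaler0 addr0.
  apply: (tens_gr_eq (prl m) gl) => i j v w vi wj ij.
  by rewrite prE (prfE _ vi wj) /g ij.
- move=> n t; rewrite !(td_gr HT); apply: (lspan_img dl).
  move=> _ [i [j [v [w [vi wj <- ->]]]]]; rewrite (td_difE _ vi) -(td_gr HT).
  rewrite [X in gr _ X]addrC; apply: pu_gr_lin.
    by rewrite -addrA; apply: pu_gr => //; apply: gr_dif HW _ _ wj.
  by rewrite addrAC; apply: pu_gr => //; apply: gr_dif HV _ _ vi.
- move=> n t; apply: (tens_gr_eq (f := fun t => dif (dif t)) (g := fun=> 0)).
  + exact: lin_comp.
  + exact: lin_cst0.
  + move=> i j v w vi wj _; rewrite (td_difE _ vi) (linD dl) (linZ dl).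
    rewrite (td_difE _ vi) (td_difE _ (gr_dif HV vi)) (dif_dif HV) (dif_dif HW).
    by rewrite !puE; lmod k T.
Qed.

End TensorSpace.

Record tensor_alg (k : fieldType) (A B T : dgAlg k) (pu : A -> B -> T) : Prop :=
  TensorAlg {
  ta_dg : tensor_dg pu;
  ta_bilin : bilin (@amul k T);
  ta_mul : forall i j a b a' b', gr i b -> gr j a' ->
    pu a b ** pu a' b' = ksgn k j i *: pu (a ** a') (b ** b');
  ta_one : aone = pu aone aone }.

Section TensorAlgebra.
Variables (k : fieldType) (A B T : dgAlg k) (pu : A -> B -> T).
Hypotheses (HA : is_dgAlg A) (HB : is_dgAlg B) (HT : tensor_alg pu).
Let HAs := dgAlg_space HA.
Let HBs := dgAlg_space HB.
Let ha := dgAlg_alg HA.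
Let hb := dgAlg_alg HB.
Let Htd := ta_dg HT.
Let mb := ta_bilin HT.

Let mZl c (s t : T) : (c *: s) ** t = c *: (s ** t). Proof. exact: linZ (mb.1 t) _ _. Qed.
Let mZr c (s t : T) : s ** (c *: t) = c *: (s ** t). Proof. exact: linZ (mb.2 s) _ _. Qed.
Let mDl (r s t : T) : (r + s) ** t = r ** t + s ** t. Proof. exact: linD (mb.1 t) _ _. Qed.
Let mDr (r s t : T) : r ** (s + t) = r ** s + r ** t. Proof. exact: linD (mb.2 r) _ _. Qed.

Lemma tens_is_alg : is_alg T.
Proof.
split=> //.
- move=> r s t.
  have Er : linear (fun r => r ** (s ** t)) := mb.1 _.
  have El : linear (fun r => r ** s ** t) := lin_comp (mb.1 t) (mb.1 s).
  apply: (tens_lin_eq HAs HBs Htd Er El) => i1 j1 a1 b1 a1i b1j {Er El r}.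
  have Er : linear (fun s => pu a1 b1 ** (s ** t)) := lin_comp (mb.2 _) (mb.1 t).
  have El : linear (fun s => pu a1 b1 ** s ** t) := lin_comp (mb.1 t) (mb.2 _).
  apply: (tens_lin_eq HAs HBs Htd Er El) => i2 j2 a2 b2 a2i b2j {Er El s}.
  have Er : linear (fun t => pu a1 b1 ** (pu a2 b2 ** t)) := lin_comp (mb.2 _) (mb.2 _).
  have El : linear (fun t => pu a1 b1 ** pu a2 b2 ** t) := mb.2 _.
  apply: (tens_lin_eq HAs HBs Htd Er El) => i3 j3 a3 b3 a3i b3j {Er El t}.
  rewrite (ta_mul HT _ _ b1j a2i) (ta_mul HT _ _ b2j a3i) mZl mZr.
  rewrite (ta_mul HT _ _ b1j (gr_mul HA a2i a3i)) (ta_mul HT _ _ (gr_mul HB b1j b2j) a3i).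
  by rewrite (amulA ha) (amulA hb); lmod k T.
- move=> t; apply: (tens_lin_eq HAs HBs Htd (mb.2 _) (@lin_id _ _)) => i j a b ai bj.
  rewrite (ta_one HT) (ta_mul HT _ _ (gr_one HB) ai) (amul1l ha) (amul1l hb).
  by lmod k T.
- move=> t; apply: (tens_lin_eq HAs HBs Htd (mb.1 _) (@lin_id _ _)) => i j a b ai bj.
  rewrite (ta_one HT) (ta_mul HT _ _ bj (gr_one HA)) (amul1r ha) (amul1r hb).
  by lmod k T.
Qed.

Lemma tens_dgAlg : is_dgAlg T.
Proof.
have ht := tens_is_alg; have HTs := tens_dgSpace HAs HBs Htd.
have dl := dif_lin HTs.
split=> //; first by case: ht.
- split; first by rewrite (ta_one HT) -(addr0 0); apply: (pu_gr Htd); apply: gr_one.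
  move=> n m s t; rewrite !(td_gr Htd) => sn.
  apply: (lspan_img (mb.2 s)) => _ [i2 [j2 [a2 [b2 [a2i b2j <- ->]]]]].
  apply: (lspan_img (mb.1 (pu a2 b2))) sn => _ [i1 [j1 [a1 [b1 [a1i b1j <- ->]]]]].
  rewrite (ta_mul HT _ _ b1j a2i); apply: lspan_scale; rewrite -(td_gr Htd) addrACA.
  by apply: (pu_gr Htd); apply: gr_mul.
- move=> n s t sn.
  have Lf : linear (fun s => dif (s ** t)) := lin_comp dl (mb.1 t).
  have Lg : linear (fun s => dif s ** t + ksgn k 1 n *: (s ** dif t)).
    apply: lin_add; first exact: (lin_comp (mb.1 t) dl).
    by apply: lin_scale; exact: (mb.1 _).
  apply: (tens_gr_eq Htd Lf Lg _ sn) => i j a b ai bj ij {Lf Lg sn s}.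
  have Lf : linear (fun t => dif (pu a b ** t)) := lin_comp dl (mb.2 _).
  have Lg : linear (fun t => dif (pu a b) ** t + ksgn k 1 n *: (pu a b ** dif t)).
    apply: lin_add; first exact: (mb.2 _).
    by apply: lin_scale; exact: (lin_comp (mb.2 _) dl).
  apply: (tens_lin_eq HAs HBs Htd Lf Lg) => i2 j2 a2 b2 a2i b2j {Lf Lg t}.
  rewrite (ta_mul HT _ _ bj a2i) (linZ dl) (td_difE HAs Htd _ ai) (td_difE HAs Htd _ a2i).
  rewrite (td_difE HAs Htd _ (gr_mul HA ai a2i)) (dif_mul HA _ ai) (dif_mul HB _ bj).
  rewrite mDl mDr mZl mZr (ta_mul HT _ _ bj a2i) (ta_mul HT _ _ (gr_dif HBs bj) a2i).
  rewrite (ta_mul HT _ _ bj (gr_dif HAs a2i)) (ta_mul HT _ _ bj a2i) -ij !(puE Htd).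
  by lmod k T.
Qed.

End TensorAlgebra.

Section TensorAlgConcrete.
Variables (k : fieldType) (A B : dgAlg k).
Hypotheses (HA : is_dgAlg A) (HB : is_dgAlg B).
Let HAs := dgAlg_space HA.
Let HBs := dgAlg_space HB.
Let ha := dgAlg_alg HA.
Let hb := dgAlg_alg HB.

Let G (a a' : A) (b b' : B) : tens A B := pure (a ** a') (b ** b').
Let pl := (@pure_bilin k A B).1.
Let pr := (@pure_bilin k A B).2.
Let G1 a' b b' : linear (fun a => G a a' b b').
Proof. exact: (lin_comp (pl _) (amulLl ha a')). Qed.
Let G2 a b b' : linear (fun a' => G a a' b b').
Proof. exact: (lin_comp (pl _) (amulLr ha a)). Qed.
Let G3 a a' b' : linear (fun b => G a a' b b').
Proof. exact: (lin_comp (pr _) (amulLl hb b')). Qed.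
Let G4 a a' b : linear (fun b' => G a a' b b').
Proof. exact: (lin_comp (pr _) (amulLr hb b)). Qed.

Lemma tens_alg_tensor : tensor_alg (T := tens_alg A B) (@pure k A B).
Proof.
split.
- exact: (tens_space_dg HAs HBs).
- exact: (tens_koszul_bilin HAs HBs G1 G2 G3 G4).
- move=> i j a b a' b' bi a'j.
  exact: (tens_koszulE HAs HBs G1 G2 G3 G4 a b' bi a'j).
- exact: erefl.
Qed.

End TensorAlgConcrete.

Record tensor_pois (k : fieldType) (A B T : dgPois k) (pu : A -> B -> T) : Prop :=
  TensorPois {
  tp_alg : tensor_alg pu;
  tp_bilin : bilin (@pbr k T);
  tp_br : forall i j a b a' b', gr i b -> gr j a' ->
    pbr (pu a b) (pu a' b') =
    ksgn k j i *: (pu (pbr a a') (b ** b') + pu (a ** a') (pbr b b')) }.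

(** * Tensor products of DG Poisson algebras *)

Section TensorPoisson.
Variables (k : fieldType) (A B T : dgPois k) (pu : A -> B -> T).
Hypotheses (HA : is_dgPois A) (HB : is_dgPois B) (HT : tensor_pois pu).
Let HAa := pois_dgAlg HA.
Let HBa := pois_dgAlg HB.
Let HAs := dgAlg_space HAa.
Let HBs := dgAlg_space HBa.
Let ha := dgAlg_alg HAa.
Let hb := dgAlg_alg HBa.
Let Hta := tp_alg HT.
Let Htd := ta_dg Hta.
Let HTa := tens_dgAlg HAa HBa Hta.
Let HTs := dgAlg_space HTa.
Let ht := dgAlg_alg HTa.
Let bb := tp_bilin HT.

Let bZl c (s t : T) : pbr (c *: s) t = c *: pbr s t. Proof. exact: linZ (bb.1 t) _ _. Qed.
Let bZr c (s t : T) : pbr s (c *: t) = c *: pbr s t. Proof. exact: linZ (bb.2 s) _ _. Qed.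
Let bDl (r s t : T) : pbr (r + s) t = pbr r t + pbr s t. Proof. exact: linD (bb.1 t) _ _. Qed.
Let bDr (r s t : T) : pbr r (s + t) = pbr r s + pbr r t. Proof. exact: linD (bb.2 r) _ _. Qed.
Let bE := (bZl, bZr, bDl, bDr).
Let mul_l (t : T) := amulLl ht t.
Let mul_r (t : T) := amulLr ht t.

Lemma tens_mulC n m (s t : T) : gr n s -> gr m t -> s ** t = ksgn k n m *: (t ** s).
Proof.
move: s t; apply: (@tens_gr2_eq _ _ _ _ _ Htd T (@amul k T) (fun s t => ksgn k n m *: (t ** s)));
  first exact: amul_bilin ht.
  by split=> r; apply: lin_scale; [exact: mul_r|exact: mul_l].
move=> i1 j1 a1 b1 i2 j2 a2 b2 a1i b1j a2i b2j <- <-.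
rewrite (ta_mul Hta _ _ b1j a2i) (ta_mul Hta _ _ b2j a1i).
rewrite (pois_mulC HA a2i a1i) (pois_mulC HB b2j b1j) !(puE Htd).
by lmod k T.
Qed.

Lemma tens_br_gr n m (s t : T) : gr n s -> gr m t -> gr (n + m) (pbr s t).
Proof.
rewrite !(td_gr Htd) => sn; apply: (lspan_img (bb.2 s)).
move=> _ [i2 [j2 [a2 [b2 [a2i b2j <- ->]]]]].
apply: (lspan_img (bb.1 (pu a2 b2))) sn => _ [i1 [j1 [a1 [b1 [a1i b1j <- ->]]]]].
rewrite (tp_br HT _ _ b1j a2i); apply: lspan_scale; rewrite -(td_gr Htd) addrACA.
apply: (grD HTs); apply: (pu_gr Htd).
- exact: gr_pbr.
- exact: gr_mul.
- exact: gr_mul.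
- exact: gr_pbr.
Qed.

Lemma tens_anti n m (s t : T) : gr n s -> gr m t -> pbr s t = - (ksgn k n m *: pbr t s).
Proof.
move: s t; apply: (@tens_gr2_eq _ _ _ _ _ Htd T (@pbr k T) (fun s t => - (ksgn k n m *: pbr t s)));
  first exact: bb.
  by split=> r; apply/lin_opp/lin_scale; [exact: bb.2|exact: bb.1].
move=> i1 j1 a1 b1 i2 j2 a2 b2 a1i b1j a2i b2j <- <-.
rewrite (tp_br HT _ _ b1j a2i) (tp_br HT _ _ b2j a1i).
rewrite (pois_mulC HA a2i a1i) (pois_mulC HB b2j b1j).
rewrite (pbr_anti HA a2i a1i) (pbr_anti HB b2j b1j) !(puE Htd).
by lmod k T.
Qed.

Let tens_gr3_eq (Z : lmodType k) (f g : T -> T -> T -> Z) n m l :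
  (forall t u, linear (fun s => f s t u)) -> (forall t u, linear (fun s => g s t u)) ->
  (forall s, bilin (f s)) -> (forall s, bilin (g s)) ->
  (forall i1 j1 a1 b1 i2 j2 a2 b2 i3 j3 a3 b3,
     gr i1 a1 -> gr j1 b1 -> gr i2 a2 -> gr j2 b2 -> gr i3 a3 -> gr j3 b3 ->
     i1 + j1 = n -> i2 + j2 = m -> i3 + j3 = l ->
     f (pu a1 b1) (pu a2 b2) (pu a3 b3) = g (pu a1 b1) (pu a2 b2) (pu a3 b3)) ->
  forall s t u, gr n s -> gr m t -> gr l u -> f s t u = g s t u.
Proof.
move=> fl gl fb gb E s t u sn tm ul.
apply: (tens_gr_eq Htd (fl t u) (gl t u) _ sn) => i1 j1 a1 b1 a1i b1j e1.
move: t u tm ul; apply: (tens_gr2_eq Htd (fb _) (gb _)) => i2 j2 a2 b2 i3 j3 a3 b3.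
by move=> a2i b2j a3i b3j e2 e3; apply: E a1i b1j a2i b2j a3i b3j e1 e2 e3.
Qed.

Lemma tens_leibniz n m l (s t u : T) : gr n s -> gr m t -> gr l u ->
  pbr s (t ** u) = pbr s t ** u + ksgn k n m *: (t ** pbr s u).
Proof.
move: s t u; apply: (@tens_gr3_eq T (fun s t u => pbr s (t ** u))
  (fun s t u => pbr s t ** u + ksgn k n m *: (t ** pbr s u))).
- by move=> t u; refine (bb.1 (t ** u)).
- move=> t u; apply: lin_add; first exact: (lin_comp (mul_l u) (bb.1 t)).
  by apply: lin_scale; exact: (lin_comp (mul_r t) (bb.1 u)).
- move=> s; split=> [u|t]; first exact: (lin_comp (bb.2 s) (mul_l u)).
  exact: (lin_comp (bb.2 s) (mul_r t)).
- move=> s; split=> [u|t]; apply: lin_add.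
  + exact: (lin_comp (mul_l u) (bb.2 s)).
  + by apply: lin_scale; exact: (mul_l _).
  + exact: mul_r.
  + by apply: lin_scale; exact: (lin_comp (mul_r t) (bb.2 s)).
move=> i1 j1 a1 b1 i2 j2 a2 b2 i3 j3 a3 b3 a1i b1j a2i b2j a3i b3j <- <- _.
have gA := gr_mul HAa; have gB := gr_mul HBa.
have pA := gr_pbr HA; have pB := gr_pbr HB.
rewrite (ta_mul Hta _ _ b2j a3i) (tp_br HT _ _ b1j a2i) (tp_br HT _ _ b1j a3i).
rewrite bZr (tp_br HT _ _ b1j (gA _ _ _ _ a2i a3i)) !(amulE ht).
rewrite (ta_mul Hta _ _ (gB _ _ _ _ b1j b2j) a3i) (ta_mul Hta _ _ (pB _ _ _ _ b1j b2j) a3i).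
rewrite (ta_mul Hta _ _ b2j (pA _ _ _ _ a1i a3i)) (ta_mul Hta _ _ b2j (gA _ _ _ _ a1i a3i)).
rewrite (pois_brMr HA a1i a2i a3i) (pois_brMr HB b1j b2j b3j) !(amulA ha, amulA hb).
rewrite (pois_mulC HA a2i a1i) (pois_mulC HB b2j b1j) !(amulZl ha, amulZl hb) !(puE Htd).
by lmod k T.
Qed.

(** On pure tensors, the Jacobi and Leibniz rules of each factor with antisymmetry and commutativity
    bring all terms to a common order of the arguments; a comparison of signs remains. *)
Lemma tens_jacobi n m l (s t u : T) : gr n s -> gr m t -> gr l u ->
  pbr s (pbr t u) = pbr (pbr s t) u + ksgn k n m *: pbr t (pbr s u).
Proof.
move: s t u; apply: (@tens_gr3_eq T (fun s t u => pbr s (pbr t u))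
  (fun s t u => pbr (pbr s t) u + ksgn k n m *: pbr t (pbr s u))).
- by move=> t u; refine (bb.1 (pbr t u)).
- move=> t u; apply: lin_add; first exact: (lin_comp (bb.1 u) (bb.1 t)).
  by apply: lin_scale; exact: (lin_comp (bb.2 t) (bb.1 u)).
- move=> s; split=> [u|t]; first exact: (lin_comp (bb.2 s) (bb.1 u)).
  exact: (lin_comp (bb.2 s) (bb.2 t)).
- move=> s; split=> [u|t]; apply: lin_add.
  + exact: (lin_comp (bb.1 u) (bb.2 s)).
  + by apply: lin_scale; exact: bb.1.
  + exact: bb.2.
  + by apply: lin_scale; exact: (lin_comp (bb.2 t) (bb.2 s)).
move=> i1 j1 a1 b1 i2 j2 a2 b2 i3 j3 a3 b3 a1i b1j a2i b2j a3i b3j <- <- _.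
have gA := gr_mul HAa; have gB := gr_mul HBa.
have pA := gr_pbr HA; have pB := gr_pbr HB.
rewrite (tp_br HT _ _ b2j a3i) (tp_br HT _ _ b1j a2i) (tp_br HT _ _ b1j a3i) !bE.
rewrite (tp_br HT _ _ b1j (pA _ _ _ _ a2i a3i)) (tp_br HT _ _ b1j (gA _ _ _ _ a2i a3i)).
rewrite (tp_br HT _ _ (gB _ _ _ _ b1j b2j) a3i) (tp_br HT _ _ (pB _ _ _ _ b1j b2j) a3i).
rewrite (tp_br HT _ _ b2j (pA _ _ _ _ a1i a3i)) (tp_br HT _ _ b2j (gA _ _ _ _ a1i a3i)).
rewrite (pois_brMr HA a1i a2i a3i) (pois_brMr HB b1j b2j b3j).
rewrite (pois_brMl HA a1i a2i a3i) (pois_brMl HB b1j b2j b3j).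
rewrite (pois_brMr HA a2i a1i a3i) (pois_brMr HB b2j b1j b3j).
rewrite (pbr_jacobi HA a1i a2i a3i) (pbr_jacobi HB b1j b2j b3j).
rewrite (pbr_anti HA a2i a1i) (pbr_anti HB b2j b1j).
rewrite (pois_mulC HA (pA _ _ _ _ a1i a3i) a2i) (pois_mulC HB (pB _ _ _ _ b1j b3j) b2j).
rewrite !(amulE ha) !(amulE hb) (pois_mulC HA a2i a1i) (pois_mulC HB b2j b1j).
rewrite !(amulZl ha, amulZl hb) !(puE Htd).
by lmod k T.
Qed.

Lemma tens_dif_br n (s t : T) : gr n s ->
  dif (pbr s t) = pbr (dif s) t + ksgn k 1 n *: pbr s (dif t).
Proof.
move=> sn; have dl := dif_lin HTs.
have Lf : linear (fun s => dif (pbr s t)) := lin_comp dl (bb.1 t).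
have Lg : linear (fun s => pbr (dif s) t + ksgn k 1 n *: pbr s (dif t)).
  apply: lin_add; first exact: (lin_comp (bb.1 t) dl).
  by apply: lin_scale; exact: (bb.1 _).
apply: (tens_gr_eq Htd Lf Lg _ sn) => i j a b ai bj <- {Lf Lg sn s}.
have Lf : linear (fun t => dif (pbr (pu a b) t)) := lin_comp dl (bb.2 _).
have Lg : linear (fun t => pbr (dif (pu a b)) t + ksgn k 1 (i + j) *: pbr (pu a b) (dif t)).
  apply: lin_add; first exact: (bb.2 _).
  by apply: lin_scale; exact: (lin_comp (bb.2 _) dl).
apply: (tens_lin_eq HAs HBs Htd Lf Lg) => i2 j2 a2 b2 a2i b2j {Lf Lg t}.
rewrite (tp_br HT _ _ bj a2i) (linZ dl) (linD dl).
rewrite (td_difE HAs Htd _ ai) (td_difE HAs Htd _ a2i).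
rewrite (td_difE HAs Htd _ (gr_mul HAa ai a2i)) (td_difE HAs Htd _ (gr_pbr HA ai a2i)).
rewrite (dif_mul HAa _ ai) (dif_mul HBa _ bj) (dif_pbr HA _ ai) (dif_pbr HB _ bj) !bE.
rewrite (tp_br HT _ _ bj a2i) (tp_br HT _ _ (gr_dif HBs bj) a2i).
rewrite (tp_br HT _ _ bj (gr_dif HAs a2i)) (tp_br HT _ _ bj a2i) !(puE Htd).
by lmod k T.
Qed.

Lemma tens_dgPois : is_dgPois T.
Proof.
split; [exact: HTa|exact: tens_mulC| |exact: tens_leibniz].
split; [exact: HTs|by split; [exact: bb|exact: tens_br_gr]| exact: tens_anti
  |exact: tens_jacobi|exact: tens_dif_br].
Qed.

End TensorPoisson.

Section TensorPoisConcrete.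
Variables (k : fieldType) (A B : dgPois k).
Hypotheses (HA : is_dgPois A) (HB : is_dgPois B).
Let HAa := pois_dgAlg HA.
Let HBa := pois_dgAlg HB.
Let HAs := dgAlg_space HAa.
Let HBs := dgAlg_space HBa.
Let ha := dgAlg_alg HAa.
Let hb := dgAlg_alg HBa.

Let G (a a' : A) (b b' : B) : tens A B :=
  pure (pbr a a') (b ** b') + pure (a ** a') (pbr b b').
Let pl := (@pure_bilin k A B).1.
Let pr := (@pure_bilin k A B).2.
Let G1 a' b b' : linear (fun a => G a a' b b').
Proof.
apply: lin_add; first exact: (lin_comp (pl _) ((pbr_bilin HA).1 _)).
exact: (lin_comp (pl _) (amulLl ha a')).
Qed.
Let G2 a b b' : linear (fun a' => G a a' b b').
Proof.
apply: lin_add; first exact: (lin_comp (pl _) ((pbr_bilin HA).2 _)).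
exact: (lin_comp (pl _) (amulLr ha a)).
Qed.
Let G3 a a' b' : linear (fun b => G a a' b b').
Proof.
apply: lin_add; first exact: (lin_comp (pr _) (amulLl hb b')).
exact: (lin_comp (pr _) ((pbr_bilin HB).1 _)).
Qed.
Let G4 a a' b : linear (fun b' => G a a' b b').
Proof.
apply: lin_add; first exact: (lin_comp (pr _) (amulLr hb b)).
exact: (lin_comp (pr _) ((pbr_bilin HB).2 _)).
Qed.

Lemma tens_pois_tensor : tensor_pois (T := tens_pois A B) (@pure k A B).
Proof.
split.
- exact: (tens_alg_tensor HAa HBa).
- exact: (tens_koszul_bilin HAs HBs G1 G2 G3 G4).
- move=> i j a b a' b' bi a'j.
  exact: (tens_koszulE HAs HBs G1 G2 G3 G4 a b' bi a'j).
Qed.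

End TensorPoisConcrete.

(** * Opposite algebras *)

Section Opposite.
Variables (k : fieldType) (A : dgAlg k).
Hypothesis HA : is_dgAlg A.
Let HAs := dgAlg_space HA.
Let ha := dgAlg_alg HA.

Let mC : bilin (fun a b : A => b ** a).
Proof. by split=> a; [exact: amulLr|exact: amulLl]. Qed.

Lemma op_bilin : bilin (@amul k (op A)).
Proof. refine (koszul_bilin HAs HAs mC). Qed.

Lemma op_mulE i j (a b : A) : gr i a -> gr j b ->
  @amul k (op A) a b = ksgn k i j *: (b ** a).
Proof. move=> ai bj; refine (koszulE HAs HAs mC ai bj). Qed.

(** The opposite product with values typed in A, so that it can be mixed with the product of A. *)
Let om (a b : A) : A := @amul k (op A) a b.
Let oL b : linear (fun a => om a b). Proof. exact: op_bilin.1. Qed.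
Let oR a : linear (om a). Proof. exact: op_bilin.2. Qed.
Let oZl c (s t : A) : om (c *: s) t = c *: om s t.
Proof. exact: (linZ (oL t)). Qed.
Let oZr c (s t : A) : om s (c *: t) = c *: om s t.
Proof. exact: (linZ (oR s)). Qed.
Let oE i j (a b : A) : gr i a -> gr j b -> om a b = ksgn k i j *: (b ** a).
Proof. exact: op_mulE. Qed.

Let op_A : associative om.
Proof.
move=> a b c.
apply: (gr_lin_eq HAs (oL (om b c)) (lin_comp (oL c) (oL b))) => i {}a ai.
apply: (gr_lin_eq HAs (lin_comp (oR a) (oL c)) (lin_comp (oL c) (oR a))) => j {}b bj.
apply: (gr_lin_eq HAs (lin_comp (oR a) (oR b)) (oR (om a b))) => l {}c cl.
rewrite (oE ai bj) (oE bj cl) oZl oZr (oE ai (gr_mul HA cl bj)) (oE (gr_mul HA bj ai) cl).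
by rewrite (amulA ha); lmod k A.
Qed.

Let op_1l a : om aone a = a.
Proof.
apply: (gr_lin_eq HAs (oR aone) (@lin_id _ _)) => i {}a ai.
by rewrite (oE (gr_one HA) ai) (amul1r ha); lmod k A.
Qed.

Let op_1r a : om a aone = a.
Proof.
apply: (gr_lin_eq HAs (oL aone) (@lin_id _ _)) => i {}a ai.
by rewrite (oE ai (gr_one HA)) (amul1l ha); lmod k A.
Qed.

Let op_gr i j a b : gr i a -> gr j b -> gr (i + j) (om a b).
Proof.
move=> ai bj; rewrite (oE ai bj); apply: (grZ HAs); rewrite addrC.
exact: gr_mul.
Qed.

Let op_dif i a b : gr i a -> dif (om a b) = om (dif a) b + ksgn k 1 i *: om a (dif b).
Proof.
move=> ai; have dl := dif_lin HAs.
have Lg : linear (fun b => om (dif a) b + ksgn k 1 i *: om a (dif b)).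
  by apply: lin_add; [exact: oR|apply: lin_scale; exact: (lin_comp (oR a) dl)].
apply: (gr_lin_eq HAs (lin_comp dl (oR a)) Lg) => j {}b bj.
rewrite (oE ai bj) (linZ dl) (dif_mul HA _ bj) (oE (gr_dif HAs ai) bj).
by rewrite (oE ai (gr_dif HAs bj)); lmod k A.
Qed.

Lemma op_dgAlg : is_dgAlg (op A).
Proof.
split.
- exact: HAs.
- exact: op_bilin.
- by split; [exact: op_A|split; [exact: op_1l|exact: op_1r]].
- by split; [exact: (gr_one HA)|exact: op_gr].
- exact: op_dif.
Qed.

End Opposite.

Section PoissonOpposite.
Variables (k : fieldType) (A : dgPois k).
Hypothesis HA : is_dgPois A.
Let HAa := pois_dgAlg HA.
Let HAs := dgAlg_space HAa.
Let ha := dgAlg_alg HAa.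

(** Graded commutativity undoes the reversal: the opposite of A is A with the negated bracket. *)
Lemma pop_mulE (a b : A) : @amul k (pop A) a b = a ** b.
Proof.
apply: (bilin_gr_eq HAs HAs (op_bilin HAa) (amul_bilin ha)) => i j {}a {}b ai bj.
by rewrite (op_mulE HAa ai bj) -(pois_mulC HA ai bj).
Qed.

Lemma pop_brE (a b : A) : @pbr k (pop A) a b = - pbr a b.
Proof.
have bC : bilin (fun a b : A => pbr b a).
  by split=> c; [exact: (pbr_bilin HA).2|exact: (pbr_bilin HA).1].
have bN : bilin (fun a b : A => - pbr a b).
  by split=> c; apply: lin_opp; [exact: (pbr_bilin HA).1|exact: (pbr_bilin HA).2].
apply: (bilin_gr_eq HAs HAs (koszul_bilin HAs HAs bC) bN) => i j {}a {}b ai bj.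
by rewrite (koszulE HAs HAs bC ai bj) (pbr_anti HA ai bj); lmod k A.
Qed.

Lemma pop_dgPois : is_dgPois (pop A).
Proof.
have pB := pbr_bilin HA.
pose pb (a b : A) : A := @pbr k (pop A) a b.
pose pm (a b : A) : A := @amul k (pop A) a b.
have bE (a b : A) : pb a b = - pbr a b := pop_brE a b.
have mE (a b : A) : pm a b = a ** b := pop_mulE a b.
have nl (a b : A) : pbr (- a) b = - pbr a b := linN (pB.1 b) a.
have nr (a b : A) : pbr a (- b) = - pbr a b := linN (pB.2 a) b.
have pC i j (a b : A) : gr i a -> gr j b -> pm a b = ksgn k i j *: pm b a.
  by move=> ai bj; rewrite !mE; apply: (pois_mulC HA).
have pL b : linear (fun a => pb a b).
  by move=> c a a'; rewrite !bE pB.1; lmod k A.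
have pR a : linear (pb a).
  by move=> c b b'; rewrite !bE pB.2; lmod k A.
have pG i j (a b : A) : gr i a -> gr j b -> gr (i + j) (pb a b).
  by move=> ai bj; rewrite bE; apply: (grN HAs); apply: (gr_pbr HA).
have pA i j (a b : A) : gr i a -> gr j b -> pb a b = - (ksgn k i j *: pb b a).
  by move=> ai bj; rewrite !bE (pbr_anti HA ai bj); lmod k A.
have pJ i j l (a b c : A) : gr i a -> gr j b -> gr l c ->
    pb a (pb b c) = pb (pb a b) c + ksgn k i j *: pb b (pb a c).
  move=> ai bj cl; rewrite !bE !(nl, nr) (pbr_jacobi HA ai bj cl); lmod k A.
have pD i (a b : A) : gr i a -> dif (pb a b) = pb (dif a) b + ksgn k 1 i *: pb a (dif b).
  by move=> ai; rewrite !bE (linN (dif_lin HAs)) (dif_pbr HA _ ai); lmod k A.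
have pM i j l (a b c : A) : gr i a -> gr j b -> gr l c ->
    pb a (pm b c) = pm (pb a b) c + ksgn k i j *: pm b (pb a c).
  move=> ai bj cl; rewrite !(bE, mE) (pois_brMr HA ai bj cl) !(amulE ha); lmod k A.
split; [exact: op_dgAlg|exact: pC| |exact: pM].
split; [exact: HAs| |exact: pA|exact: pJ|exact: pD].
by split; [split; [exact: pL|exact: pR]|exact: pG].
Qed.

End PoissonOpposite.

(** * Pairs satisfying the relations of a Poisson enveloping algebra *)

Section EnvPairLemmas.
Variables (k : fieldType) (V : dgSpace k) (mul brk : V -> V -> V) (one : V).
Hypotheses (mulC : forall i j a b, gr i a -> gr j b -> mul a b = ksgn k i j *: mul b a)
  (brkC : forall i j a b, gr i a -> gr j b -> brk a b = - (ksgn k i j *: brk b a)).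
Variables (X : dgAlg k) (m h : V -> X).
Hypotheses (HX : is_dgAlg X) (mh : env_pair mul brk one m h).
Let hx := dgAlg_alg HX.

Lemma ep_mC i j a b : gr i a -> gr j b -> m a ** m b = ksgn k i j *: (m b ** m a).
Proof.
move=> ai bj; rewrite -(ep_mM mh ai bj) -(ep_mM mh bj ai) (mulC ai bj).
exact: linZ (ep_lm mh) _ _.
Qed.

(** Antisymmetry of the bracket expresses m_{a,b} in two ways; this is their equality solved for
    [h b ** m a]. *)
Lemma ep_hmC i j a b : gr i a -> gr j b ->
  h b ** m a = ksgn k i j *: (m a ** h b)
    - ksgn k i j *: (h a ** m b - ksgn k i j *: (m b ** h a)).
Proof.
move=> ai bj; rewrite -(ep_mB mh ai bj) (brkC ai bj).
by rewrite (linN (ep_lm mh)) (linZ (ep_lm mh)) (ep_mB mh bj ai); lmod k X.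
Qed.

Lemma ep_h1 : gr 0 one -> mul one one = one -> h one = 0.
Proof.
move=> g1 E1; have := ep_hM mh g1 g1.
rewrite E1 (ep_m1 mh) !(amul1l hx) ksgnE oddz0 expr0 scale1r => /esym/eqP.
by rewrite -subr_eq0 addrK => /eqP.
Qed.

(** In the relation for h of a product, reversal changes the two terms by m_{a,b} with opposite
    signs, and the changes cancel. The commutators in the two bracket relations change sign, which
    accounts for the negated bracket. *)
Lemma env_pair_op : env_pair mul (fun a b => - brk a b) one (X := op X) m h.
Proof.
have [lm lh] := (ep_lm mh, ep_lh mh).
have [gm gh] := (ep_gm mh, ep_gh mh).
split.
- exact: lm.
- exact: lh.
- move=> i j a b ai bj; rewrite (op_mulE HX (gm _ _ ai) (gm _ _ bj)).
  by rewrite (ep_mM mh ai bj) (ep_mC ai bj).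
- move=> i j a b ai bj; rewrite (op_mulE HX (gm _ _ ai) (gh _ _ bj)).
  rewrite (op_mulE HX (gm _ _ bj) (gh _ _ ai)) (ep_hM mh ai bj) (ep_hmC ai bj).
  by lmod k X.
- move=> i j a b ai bj; rewrite (op_mulE HX (gh _ _ ai) (gm _ _ bj)).
  rewrite (op_mulE HX (gm _ _ bj) (gh _ _ ai)) (linN lm) (ep_mB mh ai bj).
  by lmod k X.
- move=> i j a b ai bj; rewrite (op_mulE HX (gh _ _ ai) (gh _ _ bj)).
  rewrite (op_mulE HX (gh _ _ bj) (gh _ _ ai)) (linN lh) (ep_hB mh ai bj).
  by lmod k X.
- exact: ep_m1 mh.
- exact: gm.
- exact: gh.
- exact: ep_dm mh.
- exact: ep_dh mh.
Qed.

(** The relations for m_{a,b}, m_{b,a} and h_{a,b} have left-hand side 0 and become commutation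
    rules. *)
Lemma ep_comm0 i j a b : gr i a -> gr j b -> brk a b = 0 ->
  [/\ m a ** m b = ksgn k i j *: (m b ** m a),
      h a ** m b = ksgn k i j *: (m b ** h a),
      m a ** h b = ksgn k i j *: (h b ** m a) &
      h a ** h b = ksgn k i j *: (h b ** h a)].
Proof.
move=> ai bj E; have E' : brk b a = 0 by rewrite (brkC bj ai) E scaler0 oppr0.
have e1 := ep_mB mh ai bj; have e2 := ep_hB mh ai bj; have e3 := ep_mB mh bj ai.
rewrite E (lin0 (ep_lm mh)) in e1; rewrite E (lin0 (ep_lh mh)) in e2.
rewrite E' (lin0 (ep_lm mh)) in e3.
split.
- exact: ep_mC.
- by apply/eqP; rewrite -subr_eq0 -e1.
- have /eqP := esym e3; rewrite subr_eq0 => /eqP ->; lmod k X.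
- by apply/eqP; rewrite -subr_eq0 -e2.
Qed.

End EnvPairLemmas.

Lemma env_pair_ext (k : fieldType) (V : dgSpace k) (mul mul' brk brk' : V -> V -> V)
    (one : V) (X : dgAlg k) (m h : V -> X) :
  mul =2 mul' -> brk =2 brk' -> env_pair mul brk one m h -> env_pair mul' brk' one m h.
Proof.
move=> Em Eb mh; have -> : mul' = mul by apply/funext => a; apply/funext => b.
by have -> : brk' = brk by apply/funext => a; apply/funext => b.
Qed.

(** Pulls a pair back along a map j of DG Poisson algebras. *)
Lemma env_pair_comp (k : fieldType) (V W : dgSpace k) (mul brk : V -> V -> V) (one : V)
    (mul' brk' : W -> W -> W) (one' : W) (j : W -> V) (X : dgAlg k) (m h : V -> X) :
  linear j -> j one' = one -> (forall n a, gr n a -> gr n (j a)) ->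
  (forall a, dif (j a) = j (dif a)) ->
  (forall i1 i2 a b, gr i1 a -> gr i2 b -> j (mul' a b) = mul (j a) (j b)) ->
  (forall i1 i2 a b, gr i1 a -> gr i2 b -> j (brk' a b) = brk (j a) (j b)) ->
  env_pair mul brk one m h ->
  env_pair mul' brk' one' (fun a => m (j a)) (fun a => h (j a)).
Proof.
move=> jl j1 jg jd jm jb mh; split.
- exact: lin_comp (ep_lm mh) jl.
- exact: lin_comp (ep_lh mh) jl.
- by move=> i1 i2 a b ai bi; rewrite (jm _ _ _ _ ai bi) (ep_mM mh (jg _ _ ai) (jg _ _ bi)).
- by move=> i1 i2 a b ai bi; rewrite (jm _ _ _ _ ai bi) (ep_hM mh (jg _ _ ai) (jg _ _ bi)).
- by move=> i1 i2 a b ai bi; rewrite (jb _ _ _ _ ai bi) (ep_mB mh (jg _ _ ai) (jg _ _ bi)).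
- by move=> i1 i2 a b ai bi; rewrite (jb _ _ _ _ ai bi) (ep_hB mh (jg _ _ ai) (jg _ _ bi)).
- by rewrite j1 (ep_m1 mh).
- by move=> n a an; apply: (ep_gm mh); apply: jg.
- by move=> n a an; apply: (ep_gh mh); apply: jg.
- by move=> a; rewrite (ep_dm mh) jd.
- by move=> a; rewrite (ep_dh mh) jd.
Qed.

Section EnvPairTensor.
Variables (k : fieldType) (A B T : dgPois k) (pu : A -> B -> T).
Hypotheses (HA : is_dgPois A) (HB : is_dgPois B) (HT : tensor_pois pu).
Variables (X Y R : dgAlg k) (pr : X -> Y -> R).
Hypotheses (HX : is_dgAlg X) (HY : is_dgAlg Y) (HR : tensor_alg pr).
Variables (m h : A -> X) (m' h' : B -> Y).
Hypotheses (mh : env_pair (@amul k A) (@pbr k A) aone m h)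
  (mh' : env_pair (@amul k B) (@pbr k B) aone m' h').
Let HAa := pois_dgAlg HA.
Let HBa := pois_dgAlg HB.
Let HAs := dgAlg_space HAa.
Let HBs := dgAlg_space HBa.
Let Hta := tp_alg HT.
Let Htd := ta_dg Hta.
Let HTp := tens_dgPois HA HB HT.
Let Hrd := ta_dg HR.
Let HRa := tens_dgAlg HX HY HR.
Let HRs := dgAlg_space HRa.
Let hr := dgAlg_alg HRa.
Let prl := (td_bilin Hrd).1.
Let prr := (td_bilin Hrd).2.

(** Since h is a derivation along m, its value on a (x) b follows the Leibniz rule. All relations
    are bilinear and hence checked on pure tensors. *)
Lemma env_pair_tensor : exists mT hT : T -> R,
  [/\ env_pair (@amul k T) (@pbr k T) aone mT hT,
      forall a b, mT (pu a b) = pr (m a) (m' b) &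
      forall a b, hT (pu a b) = pr (h a) (m' b) + pr (m a) (h' b)].
Proof.
have mb : bilin (fun a b => pr (m a) (m' b)).
  split=> [b|a]; first exact: (lin_comp (prl _) (ep_lm mh)).
  exact: (lin_comp (prr _) (ep_lm mh')).
have hb : bilin (fun a b => pr (h a) (m' b) + pr (m a) (h' b)).
  split=> [b|a]; apply: lin_add.
  - exact: (lin_comp (prl _) (ep_lh mh)).
  - exact: (lin_comp (prl _) (ep_lm mh)).
  - exact: (lin_comp (prr _) (ep_lm mh')).
  - exact: (lin_comp (prr _) (ep_lh mh')).
have [mT [mTl mTE]] := td_univ Htd mb; have [hT [hTl hTE]] := td_univ Htd hb.
exists mT, hT; split=> //.
have [gm gh gm' gh'] := And4 (ep_gm mh) (ep_gh mh) (ep_gm mh') (ep_gh mh').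
have mC := pois_mulC HA; have mC' := pois_mulC HB.
have bC := pbr_anti HA; have bC' := pbr_anti HB.
have ml t := amulLl hr t; have mr t := amulLr hr t.
have dR := dif_lin HRs; have dT := td_dl Htd.
have mulT := amul_bilin (dgAlg_alg (pois_dgAlg HTp)).
have brT := pbr_bilin HTp.
have B1 (f : T -> T -> T) (g : T -> R) : bilin f -> linear g -> bilin (fun s t => g (f s t)).
  by move=> [fl fr] gl; split=> [t|s]; [exact: (lin_comp gl (fl t))|exact: (lin_comp gl (fr s))].
have B2 (f g : T -> R) : linear f -> linear g -> bilin (fun s t => f s ** g t).
  move=> fl gl; split=> [t|s]; first exact: (lin_comp (ml _) fl).
  exact: (lin_comp (mr _) gl).
have B3 (f g : T -> R) : linear f -> linear g -> bilin (fun s t => g t ** f s).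
  by move=> fl gl; have [? ?] := B2 _ _ gl fl; split.
have B4 c (f g : T -> T -> R) : bilin f -> bilin g -> bilin (fun s t => f s t + c *: g s t).
  move=> [fl fr] [gl g'r]; split=> [t|s]; apply: lin_add => //; exact: lin_scale.
have B5 c (f g : T -> T -> R) : bilin f -> bilin g -> bilin (fun s t => f s t - c *: g s t).
  move=> [fl fr] [gl g'r]; split=> [t|s]; apply: lin_sub => //; exact: lin_scale.
have gA := gr_mul HAa; have gB := gr_mul HBa.
have pA := gr_pbr HA; have pB := gr_pbr HB.
have hmC := ep_hmC bC mh; have hmC' := ep_hmC bC' mh'.
have mmC := ep_mC mC mh; have mmC' := ep_mC mC' mh'.
have tM := ta_mul HR.
split=> //.
- move=> i j s t si tj; apply: (tens_gr2_eq Htd (B1 _ _ mulT mTl) (B2 _ _ mTl mTl) _ si tj).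
  move=> i1 j1 a1 b1 i2 j2 a2 b2 a1i b1j a2i b2j _ _ {si tj}.
  rewrite (ta_mul Hta _ _ b1j a2i) (linZ mTl) !mTE (tM _ _ _ _ _ _ (gm' _ _ b1j) (gm _ _ a2i)).
  by rewrite (ep_mM mh a1i a2i) (ep_mM mh' b1j b2j).
- move=> i j s t si tj; apply: (tens_gr2_eq Htd (B1 _ _ mulT hTl)
    (B4 _ _ _ (B2 _ _ mTl hTl) (B3 _ _ hTl mTl)) _ si tj).
  move=> i1 j1 a1 b1 i2 j2 a2 b2 a1i b1j a2i b2j <- <- {si tj}.
  rewrite (ta_mul Hta _ _ b1j a2i) (linZ hTl) !mTE !hTE !(amulE hr).
  rewrite (tM _ _ _ _ _ _ (gm' _ _ b1j) (gh _ _ a2i)) (tM _ _ _ _ _ _ (gm' _ _ b1j) (gm _ _ a2i)).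
  rewrite (tM _ _ _ _ _ _ (gm' _ _ b2j) (gh _ _ a1i)) (tM _ _ _ _ _ _ (gm' _ _ b2j) (gm _ _ a1i)).
  rewrite (ep_mM mh a1i a2i) (ep_mM mh' b1j b2j) (ep_hM mh a1i a2i) (ep_hM mh' b1j b2j).
  rewrite (mmC _ _ _ _ a2i a1i) (mmC' _ _ _ _ b2j b1j) !(puE Hrd).
  by lmod k R.
- move=> i j s t si tj; apply: (tens_gr2_eq Htd (B1 _ _ brT mTl)
    (B5 _ _ _ (B2 _ _ hTl mTl) (B3 _ _ hTl mTl)) _ si tj).
  move=> i1 j1 a1 b1 i2 j2 a2 b2 a1i b1j a2i b2j <- <- {si tj}.
  rewrite (tp_br HT _ _ b1j a2i) (linZ mTl) (linD mTl) !mTE !hTE !(amulE hr).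
  rewrite (tM _ _ _ _ _ _ (gm' _ _ b1j) (gm _ _ a2i)) (tM _ _ _ _ _ _ (gh' _ _ b1j) (gm _ _ a2i)).
  rewrite (tM _ _ _ _ _ _ (gm' _ _ b2j) (gh _ _ a1i)) (tM _ _ _ _ _ _ (gm' _ _ b2j) (gm _ _ a1i)).
  rewrite (ep_mM mh a1i a2i) (ep_mM mh' b1j b2j) (ep_mB mh a1i a2i) (ep_mB mh' b1j b2j).
  rewrite (mmC _ _ _ _ a2i a1i) (mmC' _ _ _ _ b2j b1j) !(puE Hrd).
  by lmod k R.
- move=> i j s t si tj; apply: (tens_gr2_eq Htd (B1 _ _ brT hTl)
    (B5 _ _ _ (B2 _ _ hTl hTl) (B3 _ _ hTl hTl)) _ si tj).
  move=> i1 j1 a1 b1 i2 j2 a2 b2 a1i b1j a2i b2j <- <- {si tj}.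
  rewrite (tp_br HT _ _ b1j a2i) (linZ hTl) (linD hTl) !hTE !(amulE hr).
  rewrite (tM _ _ _ _ _ _ (gm' _ _ b1j) (gm _ _ a2i)) (tM _ _ _ _ _ _ (gh' _ _ b1j) (gm _ _ a2i)).
  rewrite (tM _ _ _ _ _ _ (gm' _ _ b1j) (gh _ _ a2i)) (tM _ _ _ _ _ _ (gh' _ _ b1j) (gh _ _ a2i)).
  rewrite (tM _ _ _ _ _ _ (gm' _ _ b2j) (gm _ _ a1i)) (tM _ _ _ _ _ _ (gh' _ _ b2j) (gm _ _ a1i)).
  rewrite (tM _ _ _ _ _ _ (gm' _ _ b2j) (gh _ _ a1i)) (tM _ _ _ _ _ _ (gh' _ _ b2j) (gh _ _ a1i)).
  rewrite (ep_mM mh a1i a2i) (ep_mM mh' b1j b2j) (ep_mB mh a1i a2i) (ep_mB mh' b1j b2j).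
  rewrite (ep_hM mh a1i a2i) (ep_hM mh' b1j b2j) (ep_hB mh a1i a2i) (ep_hB mh' b1j b2j).
  (* Eliminates [h a2 ** m a1] and [h' b2 ** m' b1], which the relations express through the other
     products. *)
  rewrite (hmC _ _ _ _ a1i a2i) (hmC' _ _ _ _ b1j b2j).
  rewrite (mmC _ _ _ _ a2i a1i) (mmC' _ _ _ _ b2j b1j) !(puE Hrd).
  by lmod k R.
- by rewrite (ta_one Hta) mTE (ep_m1 mh) (ep_m1 mh') (ta_one HR).
- move=> n t; rewrite (td_gr Htd) (td_gr Hrd); apply: (lspan_img mTl).
  move=> _ [i [j [a [b [ai bj <- ->]]]]]; rewrite mTE -(td_gr Hrd).
  by apply: (pu_gr Hrd); [apply: gm|apply: gm'].
- move=> n t; rewrite (td_gr Htd) (td_gr Hrd); apply: (lspan_img hTl).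
  move=> _ [i [j [a [b [ai bj <- ->]]]]]; rewrite hTE -(td_gr Hrd).
  apply: (grD HRs); apply: (pu_gr Hrd); [exact: gh|exact: gm'|exact: gm|exact: gh'].
- apply: (tens_lin_eq HAs HBs Htd (lin_comp dR mTl) (lin_comp mTl dT)) => i j a b ai bj.
  rewrite mTE (td_difE HAs Htd _ ai) (linD mTl) (linZ mTl) !mTE.
  by rewrite (td_difE (dgAlg_space HX) Hrd _ (gm _ _ ai)) (ep_dm mh) (ep_dm mh').
- apply: (tens_lin_eq HAs HBs Htd (lin_comp dR hTl) (lin_comp hTl dT)) => i j a b ai bj.
  rewrite hTE (td_difE HAs Htd _ ai) (linD hTl) (linZ hTl) !hTE (linD dR).
  rewrite (td_difE (dgAlg_space HX) Hrd _ (gm _ _ ai)) (td_difE (dgAlg_space HX) Hrd _ (gh _ _ ai)).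
  rewrite (ep_dm mh) (ep_dm mh') (ep_dh mh) (ep_dh mh').
  by lmod k R.
Qed.

End EnvPairTensor.

(** * Env of the enveloping Poisson algebra *)

Section EnvEnveloping.
Variables (k : fieldType) (A : dgPois k).
Hypothesis HA : is_dgPois A.
Let B := pop A.
Let HB : is_dgPois B := pop_dgPois HA.
Variables (T : dgPois k) (pu : A -> B -> T).
Hypothesis HT : tensor_pois pu.
Variables (E : dgAlg k) (cls_E : freealg (dsum A A) -> E) (gn : dsum A A -> E).
Hypothesis Ecl : presents (@env_rel k A) cls_E gn.
Variables (M : dgAlg k) (cls_M : freealg (dsum T T) -> M) (gM : dsum T T -> M).
Hypothesis Mcl : presents (@env_rel k T) cls_M gM.
Variables (R : dgAlg k) (pr : E -> op E -> R).
Hypothesis HR : tensor_alg pr.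

Let HAa := pois_dgAlg HA.
Let HBa := pois_dgAlg HB.
Let HAs := dgAlg_space HAa.
Let HBs := dgAlg_space HBa.
Let ha := dgAlg_alg HAa.
Let hb := dgAlg_alg HBa.
Let Hta := tp_alg HT.
Let Htd := ta_dg Hta.
Let HTp := tens_dgPois HA HB HT.
Let HE := env_dgAlg HA Ecl.
Let he := dgAlg_alg HE.
Let HO := op_dgAlg HE.
Let HM := env_dgAlg HTp Mcl.
Let hm := dgAlg_alg HM.
Let HMo := op_dgAlg HM.
Let HRa := tens_dgAlg HE HO HR.
Let hr := dgAlg_alg HRa.
Let Hrd := ta_dg HR.

Let mA : A -> E := env_m gn.
Let hA : A -> E := env_h gn.
Let mT : T -> M := env_m gM.
Let hT : T -> M := env_h gM.
Let pairA := env_self HA Ecl.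
Let pairT := env_self HTp Mcl.

Let pairB : env_pair (@amul k B) (@pbr k B) aone (X := op E) mA hA.
Proof.
refine (env_pair_ext _ _ (env_pair_op (pois_mulC HA) (pbr_anti HA) HE pairA)).
  by move=> a b; rewrite pop_mulE.
by move=> a b; rewrite pop_brE.
Qed.

Let j1 (a : A) : T := pu a aone.
Let j2 (b : B) : T := pu aone b.
Let gA1 : gr 0 (aone : A) := gr_one HAa.
Let gB1 : gr 0 (aone : B) := gr_one HBa.

Let pair1 : env_pair (@amul k A) (@pbr k A) aone (fun a => mT (j1 a)) (fun a => hT (j1 a)).
Proof.
apply: (env_pair_comp _ _ _ _ _ _ pairT); rewrite /j1.
- exact: (td_bilin Htd).1.
- by rewrite (ta_one Hta).
- by move=> n a an; rewrite -[n]addr0; apply: (pu_gr Htd).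
- by move=> a; rewrite (td_dif Htd) (dif_one HBa) (pu0r Htd) addr0.
- move=> i1 i2 a b ai bi; rewrite (ta_mul Hta _ _ gB1 bi) (amul1l hb).
  by lmod k T.
- move=> i1 i2 a b ai bi; rewrite (tp_br HT _ _ gB1 bi) (amul1l hb).
  by rewrite (pbr_one HB gB1) (pu0r Htd); lmod k T.
Qed.

Let pair2 : env_pair (@amul k B) (@pbr k B) aone (fun b => mT (j2 b)) (fun b => hT (j2 b)).
Proof.
apply: (env_pair_comp _ _ _ _ _ _ pairT); rewrite /j2.
- exact: (td_bilin Htd).2.
- by rewrite (ta_one Hta).
- by move=> n a an; rewrite -[n]add0r; apply: (pu_gr Htd).
- move=> a; rewrite (td_difE HAs Htd _ gA1) (dif_one HAa) (pu0l Htd).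
  by lmod k T.
- move=> i1 i2 a b ai bi; rewrite (ta_mul Hta _ _ ai gA1) (amul1l ha).
  by lmod k T.
- move=> i1 i2 a b ai bi; rewrite (tp_br HT _ _ ai gA1) (amul1l ha).
  by rewrite (pbr_one HA gA1) (pu0l Htd); lmod k T.
Qed.

(** Taking opposites a second time restores the structure of A, so b |-> 1 (x) b induces an algebra
    map from E to the opposite of M. *)
Let pair2op : env_pair (@amul k A) (@pbr k A) aone (X := op M)
  (fun b => mT (j2 b)) (fun b => hT (j2 b)).
Proof.
refine (env_pair_ext _ _ (env_pair_op (pois_mulC HB) (pbr_anti HB) HM pair2)).
  by move=> a b; rewrite /B pop_mulE.
by move=> a b; rewrite /B pop_brE // opprK.
Qed.

Let j12_br i j a b : gr i a -> gr j b -> pbr (j1 a) (j2 b) = 0.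
Proof.
move=> ai bj; rewrite /j1 /j2 (tp_br HT _ _ gB1 gA1) (pbr_one HA ai).
by rewrite (pbr_one_l HB bj) (pu0l Htd) (pu0r Htd); lmod k T.
Qed.

Let j1_gr i a : gr i a -> gr i (j1 a).
Proof. by move=> ai; rewrite -[i]addr0; apply: (pu_gr Htd). Qed.
Let j2_gr i b : gr i b -> gr i (j2 b).
Proof. by move=> bi; rewrite -[i]add0r; apply: (pu_gr Htd). Qed.

Let j12_mul a b i j : gr i a -> gr j b -> pu a b = j1 a ** j2 b.
Proof.
move=> ai bj; rewrite /j1 /j2 (ta_mul Hta _ _ gB1 gA1) (amul1r ha) (amul1l hb).
by lmod k T.
Qed.

Lemma env_enveloping_iso : dgAlg_iso M R.
Proof.
have [mR [hR [pairR mRE hRE]]] := env_pair_tensor HA HB HT HE HO HR pairA pairB.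
have [F [[Fl F1] FM Fg Fd [Fm Fh]]] := env_universal HTp Mcl HRa pairR.
have [u [[ul u1] uM ug ud [um uh]]] := env_universal HA Ecl HM pair1.
have [v [[vl v1] vM vg vd [vm vh]]] := env_universal HA Ecl HMo pair2op.
(* Read in M, the map v reverses products up to sign. *)
have vMh i j (p q : E) : gr i p -> gr j q ->
    v (p ** q) = ksgn k i j *: ((v q : M) ** (v p : M)).
  by move=> pi qj; rewrite vM; exact: (op_mulE HM (vg _ _ pi) (vg _ _ qj)).
have com1 j (y : M) : (forall i a, gr i a -> mT (j1 a) ** y = ksgn k i j *: (y ** mT (j1 a))) ->
    (forall i a, gr i a -> hT (j1 a) ** y = ksgn k i j *: (y ** hT (j1 a))) ->
    forall n e, gr n e -> u e ** y = ksgn k n j *: (y ** u e).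
  move=> Hm Hh; apply: (pres_comm_ind Ecl hm ul u1 uM) => i [a b] [/= ai bi].
  rewrite (env_gnE Ecl) /= (linD ul) um uh !(amulE hm) (Hm _ _ ai) (Hh _ _ bi).
  by lmod k M.
have com0 i j a b (ai : gr i a) (bj : gr j b) := ep_comm0 (pois_mulC HTp)
  (pbr_anti HTp) pairT (j1_gr ai) (j2_gr bj) (j12_br ai bj).
(* The values of u and v commute up to sign. This is shown for a generator in place of e' by [com1],
   and spread to all e' within the opposite of M, where v is multiplicative. *)
have comm n l (e e' : E) : gr n e -> gr l e' ->
    (v e' : M) ** u e = ksgn k l n *: (u e ** (v e' : M)).
  move=> en el; have un := ug _ _ en.
  have gens j x : gr j x -> (v (gn x) : M) ** u e = ksgn k j n *: (u e ** (v (gn x) : M)).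
    case: x => a b [/= aj bj].
    have Em := com1 j (mT (j2 a)) (fun i c ci => let: And4 p _ _ _ := com0 _ _ _ _ ci aj in p)
      (fun i c ci => let: And4 _ p _ _ := com0 _ _ _ _ ci aj in p) _ _ en.
    have Eh := com1 j (hT (j2 b)) (fun i c ci => let: And4 _ _ p _ := com0 _ _ _ _ ci bj in p)
      (fun i c ci => let: And4 _ _ _ p := com0 _ _ _ _ ci bj in p) _ _ en.
    have -> : (v (gn (a, b)) : M) = mT (j2 a) + hT (j2 b).
      by rewrite (env_gnE Ecl) (linD vl) vm vh.
    rewrite !(amulE hm) Em Eh.
    by lmod k M.
  have vgn j x : gr j x -> gr j (v (gn x) : M).
    by move=> xj; apply: vg; apply: (pres_gr_gen Ecl).
  have H := pres_comm_ind Ecl (dgAlg_alg HMo) vl v1 vM (j := n) (b := u e).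
  have {}H := H _ _ _ el.
  have : @amul k (op M) (v e') (u e) = ksgn k l n *: @amul k (op M) (u e) (v e').
    apply: H => i x xi.
    rewrite (op_mulE HM (vgn _ _ xi) un) (op_mulE HM un (vgn _ _ xi)) (gens _ _ xi).
    by lmod k M.
  rewrite (op_mulE HM (vg _ _ el) un) (op_mulE HM un (vg _ _ el)) => E0.
  by rewrite E0; lmod k M.
have Gb : bilin (fun (e : E) (e' : op E) => u e ** (v e' : M)).
  split=> [e'|e]; first exact: (lin_comp (amulLl hm _) ul).
  exact: (lin_comp (amulLr hm _) vl).
have [G [Gl GE]] := td_univ Hrd Gb.
have HEs := dgAlg_space HE.
have GM r r' : G (r ** r') = G r ** G r'.
  have ml t := amulLl hr t; have mr t := amulLr hr t.
  (* G sends e (x) e' to u e times v e'; it is multiplicative because the middle factors of u e1, v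
     e2, u e3, v e4 can be exchanged. *)
  apply: (tens_lin_eq HEs HEs Hrd (lin_comp Gl (ml r')) (lin_comp (amulLl hm _) Gl)).
  move=> i1 i2 e1 e2 e1i e2i.
  apply: (tens_lin_eq HEs HEs Hrd (lin_comp Gl (mr _)) (lin_comp (amulLr hm _) Gl)).
  move=> i3 i4 e3 e4 e3i e4i.
  rewrite (ta_mul HR _ _ e2i e3i) (linZ Gl) !GE uM (op_mulE HE e2i e4i) (linZ vl).
  rewrite (vMh _ _ _ _ e4i e2i) !(amulZr hm).
  have -> : u e1 ** (v e2 : M) ** (u e3 ** (v e4 : M)) =
      ksgn k i2 i3 *: (u e1 ** u e3 ** ((v e2 : M) ** (v e4 : M))).
    rewrite (amulA hm) -(amulA hm (u e1)) (comm _ _ _ _ e3i e2i) !(amulE hm).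
    by lmod k M.
  by lmod k M.
have G1 : G aone = aone.
  rewrite (ta_one HR) GE u1; have -> : v aone = aone :> M := v1.
  exact: (amul1l hm).
have mA1 : mA aone = aone := ep_m1 pairA.
have hA1 : hA aone = 0.
  by apply: (ep_h1 HE pairA gA1); rewrite (amul1l ha).
have Fu e : F (u e) = pr e aone.
  pose f e := pr e aone : R.
  have fl : linear f := (td_bilin Hrd).1 _.
  apply: (env_hom_eq HA Ecl (lin_comp Fl ul) fl).
  - by rewrite u1 F1 (ta_one HR).
  - by move=> p q; rewrite uM FM.
  - move=> p q; rewrite /f; move: p.
    have L1 : linear (fun p => pr (p ** q) aone) := lin_comp fl (amulLl he q).
    have L2 : linear (fun p => pr p aone ** pr q aone) := lin_comp (amulLl hr _) fl.
    apply: (gr_lin_eq HEs L1 L2) => i p pi {L1 L2}; move: q.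
    have L1 : linear (fun q => pr (p ** q) aone) := lin_comp fl (amulLr he p).
    have L2 : linear (fun q => pr p aone ** pr q aone) := lin_comp (amulLr hr _) fl.
    apply: (gr_lin_eq HEs L1 L2) => j q qj {L1 L2}.
    rewrite (ta_mul HR _ _ (gr_one HO) qj) (amul1l (dgAlg_alg HO)).
    by lmod k R.
  - by move=> i a ai; rewrite um Fm mRE -/mA mA1.
  - by move=> i a ai; rewrite uh Fh hRE -/mA -/hA mA1 hA1 (pu0r Hrd) addr0.
(* As maps from E, both sides reverse products, so they are compared by induction on generators and
   not as algebra maps. *)
have Fv e : F (v e) = pr aone e.
  pose f e := pr aone e : R.
  have fl : linear f := (td_bilin Hrd).2 _.
  have Fv_l : linear (fun e => F (v e)) := lin_comp Fl vl.
  have Fvm a : F (v (env_m gn a)) = pr aone (env_m gn a).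
    by rewrite vm Fm mRE -/mA mA1.
  have Fvh a : F (v (env_h gn a)) = pr aone (env_h gn a).
    by rewrite vh Fh hRE -/mA -/hA mA1 hA1 (pu0l Hrd) add0r.
  have key i n (x p : E) : gr i x -> gr n p -> F (v x) = pr aone x ->
      F (v p) = pr aone p -> F (v (x ** p)) = pr aone (x ** p).
    move=> xi pn Ex Ep; rewrite (vMh _ _ _ _ xi pn) (linZ Fl) FM Ex Ep.
    rewrite (ta_mul HR _ _ pn (gr_one HE)) (amul1l he) (op_mulE HE pn xi) (puZr Hrd).
    by lmod k R.
  apply: (env_eq HA Ecl Fv_l fl).
  - have -> : v aone = aone :> M := v1.
    by rewrite F1 (ta_one HR).
  - move=> i n a p ai pn Ep; apply: key pn _ Ep; last exact: Fvm.
    exact: (ep_gm pairA ai).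
  - move=> i n a p ai pn Ep; apply: key pn _ Ep; last exact: Fvh.
    exact: (ep_gh pairA ai).
have pr1 e e' : gr 0 (aone : E) -> pr e e' = pr e aone ** pr aone e'.
  move=> g1; rewrite (ta_mul HR _ _ (gr_one HO) g1) (amul1r he).
  by rewrite (amul1l (dgAlg_alg HO)); lmod k R.
split=> //; exists F; split=> //.
exists G => [p|r].
  apply: (env_hom_eq HTp Mcl (X := M) (lin_comp Gl Fl) (@lin_id _ _)) => //.
  - by rewrite F1 G1.
  - by move=> q r; rewrite FM GM.
  - move=> i t _; rewrite Fm; move: t.
    apply: (tens_lin_eq HAs HBs Htd (lin_comp Gl (ep_lm pairR)) (ep_lm pairT)).
    move=> i1 i2 a b ai bi; rewrite mRE GE um.
    have -> : v (mA b) = mT (j2 b) :> M := vm b.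
    rewrite (j12_mul ai bi); exact: esym (ep_mM pairT (j1_gr ai) (j2_gr bi)).
  - move=> i t _; rewrite Fh; move: t.
    apply: (tens_lin_eq HAs HBs Htd (lin_comp Gl (ep_lh pairR)) (ep_lh pairT)).
    move=> i1 i2 a b ai bi; rewrite hRE (linD Gl) !GE um uh.
    have -> : v (mA b) = mT (j2 b) :> M := vm b.
    have -> : v (hA b) = hT (j2 b) :> M := vh b.
    rewrite (j12_mul ai bi) (ep_hM pairT (j1_gr ai) (j2_gr bi)).
    (* The relation for h of [j1 a ** j2 b] has m (j2 b) in front of h (j1 a); they may be exchanged
       because the bracket of j1 a and j2 b is 0. *)
    have [_ E2 _ _] := com0 _ _ _ _ ai bi; rewrite /mT /hT E2.
    by lmod k M.
move: r; apply: (tens_lin_eq HEs HEs Hrd (lin_comp Fl Gl) (@lin_id _ _)).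
move=> i1 i2 e e' ei e'i; rewrite GE FM Fu.
have -> : F (v e') = pr aone e' := Fv e'.
by rewrite -(pr1 e e' (gr_one HE)).
Qed.

End EnvEnveloping.

Lemma enveloping_part (k : fieldType) (A : dgPois k) : is_dgPois A ->
  is_dgPois (penvE A) /\ dgAlg_iso (Env (penvE A)) (envE (Env A)).
Proof.
move=> HA; have HB := pop_dgPois HA.
have HT := tens_pois_tensor HA HB.
split; first exact: (tens_dgPois HA HB HT).
have Ecl := presented_presents (@env_rel k A).
have HE := env_dgAlg HA Ecl.
refine (env_enveloping_iso HA HT Ecl (presented_presents (@env_rel k (penvE A)))
  (tens_alg_tensor HE (op_dgAlg HE))).
Qed.

Theorem corollaryD (k : fieldType) :
  (forall L : dgLie k, is_dgLie L ->
     is_dgLie (semidirect L) /\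
     exists2 b, unique (@is_sym_bracket k L) b &
       is_dgPois (DGPois b) /\
       dgAlg_iso (Env (DGPois b)) (Uea (semidirect L)))
  /\
  (forall A : dgPois k, is_dgPois A ->
     is_dgPois (penvE A) /\
     dgAlg_iso (Env (penvE A)) (envE (Env A))).
Proof. by split=> [L|A]; [apply: semidirect_part|apply: enveloping_part]. Qed.
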